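(* There exists a pair of isospectral connected compact flat manifolds $M_1,M_2$ with mixed boundary conditions (both the Dirichlet part and the Neumann part of the boundary being nonempty) such that $M_1$ is orientable while $M_2$ is not orientable, and such that $M_1$ and $M_2$ have different numbers of Dirichlet boundary components.
   Context: Let $M$ be a compact flat Riemannian manifold with piecewise smooth boundary and disjoint smooth open subsets $\partial_DM,\partial_NM\subseteq\partial M$ with $\partial M=\overline{\partial_DM\cup\partial_NM}$. The spectrum of $M$ (with these boundary conditions) is the sequence of eigenvalues $\lambda$, with multiplicities, of $\Delta\varphi=\lambda\varphi$ on the interior $M^\circ$, $\varphi=0$ on $\partial_DM$, $\partial\varphi/\partial n=0$ on $\partial_NM$, with $\varphi\in C(M)\cap C^\infty(M^\circ\cup\partial_DM\cup\partial_NM)$ and $\Delta=-\operatorname{div}\nabla$. Manifolds with given boundary conditions are isospectral if their spectra coincide. Dirichlet boundary components are the connected components of the closure of $\partial_DM$. *)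

(* Defs.v *)
From HB Require Import structures.
From mathcomp Require Import all_boot all_order all_algebra.
From mathcomp Require Import all_classical all_reals all_analysis.

Set Implicit Arguments.
Unset Strict Implicit.
Unset Printing Implicit Defensive.

Import Order.TTheory GRing.Theory Num.Theory.
Import numFieldNormedType.Exports.

Local Open Scope classical_set_scope.
Local Open Scope ring_scope.

Section Euclidean.
Variable R : realType.

Definition orthogonal_mx m (Q : 'M[R]_m) : Prop := Q *m Q^T = 1%:M.

Fixpoint iter_partial m (s : seq 'I_m) (F : 'rV[R]_m -> R) : 'rV[R]_m -> R :=
  if s is i :: s' then fun x => 'D_(delta_mx 0 i) (iter_partial s' F) x else F.

(* C^infty on a neighbourhood of a: all iterated partial derivatives exist
   there and are themselves differentiable (hence continuous). *)
Definition smooth_near m (F : 'rV[R]_m -> R) (a : 'rV[R]_m) : Prop :=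
  \forall x \near a, forall s : seq 'I_m, differentiable (iter_partial s F) x.

(* PC^infty functions: continuous selections of finitely many C^infty ones. *)
Definition piecewise_smooth_near m (h : 'rV[R]_m -> R) (a : 'rV[R]_m) : Prop :=
  exists k (hs : 'I_k -> 'rV[R]_m -> R),
    (forall i, smooth_near (hs i) a) /\
    (\forall x \near a, {for x, continuous h} /\ exists i, h x = hs i x).

Definition height n (x : 'rV[R]_n.+2) : R := x ord0 ord0.
Definition base n (x : 'rV[R]_n.+2) : 'rV[R]_n.+1 :=
  \row_j x ord0 (lift ord0 j).

(* In the rotated coordinates x *m Q, the set P is near its boundary point a
   the epigraph of h; `reg` is the regularity imposed on h at the base point
   of a. *)
Definition epigraph_at n (reg : ('rV[R]_n.+1 -> R) -> 'rV[R]_n.+1 -> Prop)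
    (P : set 'rV[R]_n.+2) (a : 'rV[R]_n.+2)
    (Q : 'M[R]_n.+2) (h : 'rV[R]_n.+1 -> R) : Prop :=
  [/\ orthogonal_mx Q,
      reg h (base (a *m Q)),
      height (a *m Q) = h (base (a *m Q)) &
      \forall x \near a, P x <-> h (base (x *m Q)) <= height (x *m Q)].

Definition piecewise_smooth_boundary_at n (P : set 'rV[R]_n.+2) a : Prop :=
  exists Q h, epigraph_at (@piecewise_smooth_near n.+1) P a Q h.

Definition smooth_boundary_at n (P : set 'rV[R]_n.+2) a : Prop :=
  exists Q h, epigraph_at (@smooth_near n.+1) P a Q h.

(* The gradient of h(base) - height, pulled back along x |-> x *m Q. It is a
   positive multiple of the outward unit normal; only the vanishing of the
   derivative in this direction is used below. *)
Definition outward_normal_at n (P : set 'rV[R]_n.+2) a (v : 'rV[R]_n.+2)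
    : Prop :=
  exists Q h, epigraph_at (@smooth_near n.+1) P a Q h /\
    v = (row_mx (const_mx (-1) : 'M[R]_1)
           (\row_j 'D_(delta_mx 0 j) h (base (a *m Q))) : 'rV[R]_(1 + n.+1))
        *m Q^T.

End Euclidean.

Section FlatManifolds.
Variable R : realType.

(* A homeomorphism from an open part of T onto a subset of R^(n+2) each point
   of which is interior or lies on a piecewise smooth boundary hypersurface;
   cinv is relevant on cmap @` cdom only. *)
Record chart (n : nat) (T : topologicalType) := Chart {
  cdom : set T;
  cmap : T -> 'rV[R]_n.+2;
  cinv : 'rV[R]_n.+2 -> T;
  cdom_open : open cdom;
  cmap_continuous : {within cdom, continuous cmap};
  cinv_continuous : {within cmap @` cdom, continuous cinv};
  cmapK : forall p, cdom p -> cinv (cmap p) = p;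
  cimage_boundary : forall p, cdom p ->
    (cmap @` cdom)° (cmap p) \/
    piecewise_smooth_boundary_at (cmap @` cdom) (cmap p)
}.

(* The changes of charts are, locally, restrictions of isometries of Euclidean
   space, whose linear part satisfies `lin`. *)
Definition euclidean_transition n (T : topologicalType)
    (lin : 'M[R]_n.+2 -> Prop) (c d : chart n T) : Prop :=
  forall p, cdom c p -> cdom d p ->
    exists Q b, [/\ orthogonal_mx Q, lin Q &
      \forall q \near p, cmap d q = cmap c q *m Q + b].

(* A flat metric is one that is locally isometric to the Euclidean one: it is
   given by an atlas whose charts are isometries, so that the metric tensor is
   the identity matrix in every chart. The dimension is n + 2: only dimensions
   at least 2 are considered, all intervals and circles being orientable. *)
Record compact_flat_manifold (n : nat) := CompactFlatManifold {
  fm_carrier :> topologicalType;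
  fm_hausdorff : hausdorff_space fm_carrier;
  fm_compact : compact [set: fm_carrier];
  atlas : set (chart n fm_carrier);
  atlas_cover : forall p, exists2 c, atlas c & cdom c p;
  atlas_flat : forall c d, atlas c -> atlas d ->
    euclidean_transition (fun=> True) c d
}.

Definition orientable n (M : compact_flat_manifold n) : Prop :=
  exists B : set (chart n M),
    [/\ forall p, exists2 c, B c & cdom c p,
        forall c d, atlas c -> B d -> euclidean_transition (fun=> True) c d &
        forall c d, B c -> B d ->
          euclidean_transition (fun Q => 0 < \det Q) c d].

Definition minterior n (M : compact_flat_manifold n) : set M :=
  [set p | exists c, [/\ atlas c, cdom c p &
                         (cmap c @` cdom c)° (cmap c p)]].
Arguments minterior {n} M.

Definition mboundary n (M : compact_flat_manifold n) : set M :=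
  ~` minterior M.
Arguments mboundary {n} M.

Definition smooth_boundary_point n (M : compact_flat_manifold n) (p : M)
    : Prop :=
  exists c, [/\ atlas c, cdom c p &
                smooth_boundary_at (cmap c @` cdom c) (cmap c p)].

(* The last field is part of the boundary being *piecewise* smooth: what is
   left of it outside of its smooth Dirichlet and Neumann parts (the corners
   and the interfaces of these parts) has codimension 2, i.e., it is locally
   covered by finitely many smooth images of R^n. Without it, a Cantor-like
   leftover set could carry no boundary condition at all, and the spectrum
   would not be discrete. *)
Record mixed_manifold (n : nat) := MixedManifold {
  mm_manifold :> compact_flat_manifold n;
  dirichlet : set mm_manifold;
  neumann : set mm_manifold;
  dirichlet_open : exists2 O, open O &
    dirichlet = O `&` mboundary mm_manifold;
  neumann_open : exists2 O, open O &
    neumann = O `&` mboundary mm_manifold;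
  dirichlet_smooth : forall p, dirichlet p -> smooth_boundary_point p;
  neumann_smooth : forall p, neumann p -> smooth_boundary_point p;
  dirichlet_neumann_disjoint : dirichlet `&` neumann = set0;
  dirichlet_neumann_dense :
    mboundary mm_manifold = closure (dirichlet `|` neumann);
  leftover_codim2 : forall p,
    (mboundary mm_manifold `\` (dirichlet `|` neumann)) p ->
    exists c k (gamma : 'I_k -> 'rV[R]_n -> 'rV[R]_n.+2),
      [/\ atlas c, cdom c p,
          forall i t j, smooth_near (fun u => gamma i u 0 j) t &
          \forall q \near p,
            (mboundary mm_manifold `\` (dirichlet `|` neumann)) q ->
            exists i t, cmap c q = gamma i t]
}.
Arguments dirichlet {n} m.
Arguments neumann {n} m.

Section Spectrum.
Variables (n : nat) (M : mixed_manifold n).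

(* F is a smooth extension, to a full neighbourhood of cmap c p in R^(n+2),
   of phi read in the chart c around p. *)
Definition smooth_extension (phi : M -> R) (p : M) (c : chart n M)
    (F : 'rV[R]_n.+2 -> R) : Prop :=
  [/\ atlas c, cdom c p, smooth_near F (cmap c p) &
      \forall q \near p, phi q = F (cmap c q)].

Definition smooth_at (phi : M -> R) (p : M) : Prop :=
  exists c F, smooth_extension phi p c F.

(* Laplacian = - div grad, in flat coordinates. *)
Definition laplacian (c : chart n M) (phi : M -> R) (p : M) : R :=
  - \sum_(i < n.+2) iter_partial [:: i; i] (phi \o cinv c) (cmap c p).

(* The solutions of the boundary value problem, including 0. *)
Definition eigenfunctions (lambda : R) : set (M -> R) :=
  [set phi |
    [/\ continuous phi,
        forall p, (minterior M `|` dirichlet M `|` neumann M) p ->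
          smooth_at phi p,
        forall p c, minterior M p -> atlas c -> cdom c p ->
          laplacian c phi p = lambda * phi p,
        forall p, dirichlet M p -> phi p = 0 &
        forall p c F v, neumann M p -> smooth_extension phi p c F ->
          outward_normal_at (cmap c @` cdom c) (cmap c p) v ->
          'D_v F (cmap c p) = 0]].

Definition multiplicity_ge (lambda : R) (m : nat) : Prop :=
  exists phi : 'I_m -> M -> R,
    (forall i, eigenfunctions lambda (phi i)) /\
    (forall a : 'I_m -> R,
       (forall p, \sum_(i < m) a i * phi i p = 0) -> forall i, a i = 0).

Definition dirichlet_components : set (set M) :=
  [set connected_component (closure (dirichlet M)) p
     | p in closure (dirichlet M)].

End Spectrum.
Arguments dirichlet_components {n} M.
Arguments eigenfunctions {n} M lambda.

(* The spectra coincide as multisets: every real number has the same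
   multiplicity (0 when it is not an eigenvalue) for both problems. *)
Definition isospectral n (M1 M2 : mixed_manifold n) : Prop :=
  forall lambda m, multiplicity_ge M1 lambda m <-> multiplicity_ge M2 lambda m.

End FlatManifolds.

Arguments minterior {R n} M.
Arguments mboundary {R n} M.
Arguments dirichlet {R n} m.
Arguments neumann {R n} m.
Arguments dirichlet_components {R n} M.
Arguments eigenfunctions {R n} M lambda.

(* Main.v *)
(* Four copies of a cross-shaped tile are glued along the ends of its arms, in
   two ways. Reading an eigenfunction tile by tile turns the eigenvalue problem
   into one for vectors of functions on the tile, in which the gluings and the
   boundary conditions appear only through one signed permutation of the four
   tiles for each arm. An invertible matrix intertwining the two families of
   signed permutations therefore maps eigenfunctions to eigenfunctions
   (transplantation). The regularity of the transplanted function across a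
   gluing line that used to be a boundary piece is the reflection principle for
   the Helmholtz equation. In the first gluing the tiles form a star, so that
   they can be coloured alternately, whence orientability; the second gluing
   contains a triangle. All arms are disjoint, hence the Dirichlet components
   are exactly the Dirichlet arm ends: four in the first manifold, two in the
   second one. *)
From HB Require Import structures.
Require Import Defs.
From mathcomp Require Import all_boot all_order all_algebra.
From mathcomp Require Import all_classical all_reals all_analysis.
From mathcomp Require Import ring lra.
Set Implicit Arguments.
Unset Strict Implicit.
Unset Printing Implicit Defensive.
Import Order.TTheory GRing.Theory Num.Theory.
Import numFieldNormedType.Exports.
Local Open Scope card_scope.
Local Open Scope classical_set_scope.
Local Open Scope ring_scope.

(** * Differentiability *)

Section Differential.
Variables (R : realType) (V W : normedModType R).

(** The arm ends of a cross are pairwise disjoint, so a gluing identifies points at most in pairs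
    and imposes no condition around vertices. The corners of the tile are put in neither boundary
    part, even where a gluing straightens two free edges into one line. Both manifolds thus leave
    out the same points of the tile; only continuity is asked of an eigenfunction there, and
    transplantation preserves it.

    What remains is regularity across open arm ends. Near an unglued end an eigenfunction is smooth
    up to the boundary, but its odd or even reflection is C^infinity only if its normal derivatives
    of even order (Dirichlet) or of odd order (Neumann) vanish there. The Helmholtz equation gives
    this order by order, since it expresses the second normal derivative by tangential ones; the
    argument therefore runs over all words of partial derivatives at once.

    The intertwining matrix exists because the first colour acts in the star as the diagonal matrix
    (-1, -1, 1, 1) and in the second gluing as a product of two transpositions, which has the same
    eigenvalues; the other three colours act alike in both gluings. *)

Lemma is_diff_epsP (f : V -> W) x (L : {linear V -> W}) : continuous L ->
  (forall e, 0 < e -> \forall h \near (0 : V),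
     `|f (h + x) - f x - L h| <= e * `|h|) -> is_diff x f L.
Proof.
move=> cL fL.
have H : f \o shift x = cst (f x) + L +o_ (0 : V) id.
  apply/eqaddoP => e e0; near=> h => /=.
  rewrite -[(_ - _) h]/(f (h + x) - (f x + L h)) opprD addrA.
  by near: h; exact: fL.
have dE := diff_unique cL H.
apply: DiffDef => //; apply/diff_locallyP; rewrite dE; split => //.
Unshelve. all: by end_near. Qed.

Lemma differentiable_eps (f : V -> W) x : differentiable f x ->
  forall e, 0 < e -> \forall h \near (0 : V),
     `|f (h + x) - f x - 'd f x h| <= e * `|h|.
Proof.
move=> /diff_locally/eqaddoP H e e0; near=> h.
have : `|(f \o shift x - (cst (f x) + 'd f x)) h| <= e * `|h|.
  by near: h; exact: H.
by rewrite -[(_ - _) h]/(f (h + x) - (f x + 'd f x h)) opprD addrA.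
Unshelve. all: by end_near. Qed.

(** Both branches have the same first-order expansion at x, so the error estimate holds whichever
    branch is selected at each point. This differentiates a reflected function on the mirror line
    itself. *)
Lemma differentiable_selection (f f1 f2 : V -> W) x :
  differentiable f1 x -> differentiable f2 x ->
  'd f1 x = 'd f2 x :> (V -> W) -> f1 x = f x -> f2 x = f x ->
  (\forall y \near x, f y = f1 y \/ f y = f2 y) ->
  differentiable f x /\ 'd f x = 'd f1 x :> (V -> W).
Proof.
move=> d1 d2 d12 e1 e2 sel.
suff H : is_diff x f ('d f1 x) by split; [exact: ex_diff|exact: diff_val].
apply: is_diff_epsP; first exact: diff_continuous.
move=> e e0; have sel0 : \forall h \near (0 : V),
    f (h + x) = f1 (h + x) \/ f (h + x) = f2 (h + x).
  by move: sel; rewrite (near_shift 0 x) subr0.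
have D1 := differentiable_eps d1 e0; have D2 := differentiable_eps d2 e0.
near=> h; have [->|->] : f (h + x) = f1 (h + x) \/ f (h + x) = f2 (h + x).
- exact: (near sel0 h).
- by rewrite -e1; apply: (near D1 h).
- by rewrite -e2 d12; apply: (near D2 h).
Unshelve. all: by end_near. Qed.

Lemma near_eq_differentiable (f g : V -> W) x :
  (\forall y \near x, f y = g y) -> differentiable f x -> differentiable g x.
Proof.
move=> fg df; have fgx : f x = g x by exact: nbhs_singleton fg.
apply: (differentiable_selection df df _ fgx fgx _).1 => //.
by apply: filterS fg => y ->; left.
Qed.

End Differential.

(** * One-sided comparison along rays, and the symmetry of second derivatives *)

Section Rays.
Variables (R : realType) (V : normedModType R).
Implicit Types (f g F : V -> R) (x u v : V).

Lemma near0_scale (v : V) (Q : V -> Prop) :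
  (\forall y \near (0 : V), Q y) -> \forall h \near (0 : R), Q (h *: v).
Proof.
move=> Q0; have c : (h *: v) @[h --> (0 : R)] --> (0 : V).
  by rewrite -[X in _ --> X](scale0r v); exact: scalel_continuous.
exact: c Q0.
Qed.

Lemma near_line x v (Q : V -> Prop) :
  (\forall y \near x, Q y) -> \forall h \near (0 : R), Q (h *: v + x).
Proof.
by rewrite (near_shift 0 x) subr0 => /(near0_scale v).
Qed.

Lemma near0_ex_pos (Q : R -> Prop) :
  (\forall h \near (0 : R), Q h) -> exists2 h, 0 < h & Q h.
Proof.
move=> /nbhs_ballP[e /= e0 H]; have e2 : 0 < e / 2 by rewrite divr_gt0.
exists (e / 2) => //; apply: H.
by rewrite /ball /= sub0r normrN gtr0_norm// ltr_pdivrMr// ltr_pMr// ltr1n.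
Qed.

Lemma continuous_eq_ray f g x v : {for x, continuous f} ->
  {for x, continuous g} ->
  (\forall h \near (0 : R), 0 < h -> f (h *: v + x) = g (h *: v + x)) ->
  f x = g x.
Proof.
move=> cf cg fg; apply/eqP; rewrite -subr_eq0 -normr_le0.
apply/ler_addgt0Pl => e e0; rewrite addr0.
have e2 : 0 < e / 2 by rewrite divr_gt0.
have /(near_line v) nf : \forall y \near x, `|f x - f y| <= e / 2.
  by move/cvgrPdist_le : cf; apply.
have /(near_line v) ng : \forall y \near x, `|g x - g y| <= e / 2.
  by move/cvgrPdist_le : cg; apply.
have [h h0 [[/= H1 H2] H3]] := near0_ex_pos (filterI (filterI nf ng) fg).
rewrite -(subrKA (f (h *: v + x))) [in X in _ + X]H3// (splitr e).
by rewrite (le_trans (ler_normD _ _))// lerD// distrC.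
Qed.

(** Both functions are differentiable at x already, so agreement on one side pins down the
    derivative along v. Near a boundary edge an eigenfunction is compared with its extensions on one
    side only. *)
Lemma diff_eq_ray f g x v : differentiable f x -> differentiable g x ->
  f x = g x ->
  (\forall h \near (0 : R), 0 < h -> f (h *: v + x) = g (h *: v + x)) ->
  'd f x v = 'd g x v.
Proof.
move=> df dg e fg; apply/eqP; rewrite -subr_eq0 -normr_le0.
apply/ler_addgt0Pl => r r0; rewrite addr0.
(* Chosen so that the two linearisation errors at h * v add up to at most h * r; the summand 1
   covers v = 0. *)
pose d := r / (2 * (`|v| + 1)).
have v1 : 0 < `|v| + 1 by rewrite ltr_wpDl.
have d0 : 0 < d by rewrite divr_gt0// mulr_gt0.
have /(near0_scale v) nf := differentiable_eps df d0.
have /(near0_scale v) ng := differentiable_eps dg d0.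
have [h h0 [[H1 H2] H3]] := near0_ex_pos (filterI (filterI nf ng) fg).
have /= {}H3 := H3 h0; rewrite /= -H3 -e in H2.
have : `|'d f x (h *: v) - 'd g x (h *: v)| <= d * `|h *: v| + d * `|h *: v|.
  rewrite -(subrKA (f (h *: v + x) - f x)) (le_trans (ler_normD _ _))//.
  by apply: lerD; [rewrite distrC; exact: H1|exact: H2].
have -> : 'd f x (h *: v) - 'd g x (h *: v) = h * ('d f x v - 'd g x v).
  by rewrite mulrBr; congr (_ - _); rewrite linearZ.
rewrite normrM normrZ !(gtr0_norm h0) -mulrDl mulrCA ler_pM2l//.
move=> /le_trans; apply.
have -> : d + d = r / (`|v| + 1) by rewrite /d; field; rewrite gt_eqF.
by rewrite mulrAC ler_pdivrMr// ler_pM2l// lerDl.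
Qed.

Lemma derivable_line F u y s : derivable F (s *: u + y) u ->
  is_derive s 1 (fun s : R => F (s *: u + y)) ('D_u F (s *: u + y)).
Proof.
move=> dF.
have E : (fun h : R => h^-1 *: (((fun s : R => F (s *: u + y)) \o shift s) (h *: 1) -
    F (s *: u + y))) =
  (fun h : R => h^-1 *: ((F \o shift (s *: u + y)) (h *: u) - F (s *: u + y))).
  apply/funext => h /=; congr (_ *: (F _ - _)).
  by rewrite addrA -scalerDl [h *: 1]mulr1.
by apply: DeriveDef; [rewrite /derivable E|rewrite /derive E].
Qed.

(* Mean value theorem for s |-> F (x + su + hv) - F (x + su). *)
Lemma second_difference F x u v :
  (\forall y \near x, differentiable F y) -> differentiable ('D_u F) x ->
  forall e, 0 < e -> \forall h \near (0 : R), 0 < h ->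
    `|F (h *: u + (h *: v + x)) - F (h *: u + x) - F (h *: v + x) + F x
       - h ^+ 2 * 'D_v ('D_u F) x| <= e * h ^+ 2.
Proof.
move=> dF ddF e e0; rewrite deriveE//.
(* The derivative is linearised at two points, each within h(|u| + |v| + 1) of x; with error rate e
   / M the two errors add up to at most e * h, and the mean value theorem contributes another factor
   h. *)
pose M := 2 * (`|u| + `|v| + 1).
have M0 : 0 < M by rewrite mulr_gt0// ltr_wpDl// addr_ge0.
have d0 : 0 < e / M by rewrite divr_gt0.
have := differentiable_eps ddF d0.
have : \forall k \near (0 : V), differentiable F (k + x).
  by move: dF; rewrite (near_shift 0 x) subr0.
move=> /filterI H /H /nbhs_ballP[r /= r0 {}H].
near=> h => h0.
have hr : h * (`|u| + `|v| + 1) < r.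
  near: h; have r1 : 0 < r / (`|u| + `|v| + 1).
    by rewrite divr_gt0// ltr_wpDl// addr_ge0.
  apply: filterS (nbhs0_lt r1) => h hh.
  rewrite -ltr_pdivlMr ?ltr_wpDl ?addr_ge0//.
  exact: le_lt_trans (ler_norm _) hh.
have inb s t : 0 <= s <= h -> 0 <= t <= h -> ball 0 r (s *: u + t *: v).
  move=> /andP[s0 sh] /andP[t0 th]; rewrite -ball_normE /ball_ /= sub0r normrN.
  apply: le_lt_trans hr; rewrite (le_trans (ler_normD _ _))//.
  rewrite !normrZ !ger0_norm// mulrDr mulr1 mulrDr -[leLHS]addr0.
  by rewrite !lerD// ?(ltW h0)// ler_wpM2r.
pose phi s := F (s *: u + (h *: v + x)) - F (s *: u + x).
pose dphi s := 'D_u F (s *: u + (h *: v + x)) - 'D_u F (s *: u + x).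
have hh : 0 <= h <= h by rewrite lexx ltW.
have h00 : 0 <= (0:R) <= h by rewrite lexx ltW.
have dphiP s : 0 <= s <= h -> is_derive s 1 phi (dphi s).
  move=> sh; apply: is_deriveB; apply: derivable_line; apply: diff_derivable.
    by rewrite addrA; apply: (H _ (inb _ _ sh hh)).1.
  by have := (H _ (inb _ _ sh h00)).1; rewrite scale0r addr0.
have [s||s /[!in_itv]/= sh Es] := @MVT R phi dphi 0 h h0.
- by rewrite in_itv/= => /andP[s0 s1]; apply: dphiP; rewrite !ltW.
- apply: derivable_within_continuous => s; rewrite in_itv/= => sh.
  exact: @ex_derive _ _ _ _ _ _ _ (dphiP s sh).
have {}sh : 0 <= s <= h by case/andP: sh => *; rewrite !ltW.
have -> : F (h *: u + (h *: v + x)) - F (h *: u + x) - F (h *: v + x) + F x =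
    phi h - phi 0 by rewrite /phi !scale0r !add0r; ring.
rewrite {}Es subr0 /dphi.
set A := 'D_u F (s *: u + (h *: v + x)); set B := 'D_u F (s *: u + x).
pose C := 'D_u F x; pose p := 'd ('D_u F) x u; set q := 'd _ x v.
have H1 : `|A - C - (s * p + h * q)| <= e / M * `|s *: u + h *: v|.
  have -> : s * p + h * q = 'd ('D_u F) x (s *: u + h *: v).
    by rewrite linearD; congr (_ + _); rewrite linearZ.
  by rewrite /A addrA; exact: (H _ (inb _ _ sh hh)).2.
have H2 : `|B - C - s * p| <= e / M * `|s *: u|.
  have -> : s * p = 'd ('D_u F) x (s *: u) by rewrite linearZ.
  by have := (H _ (inb _ _ sh h00)).2; rewrite scale0r addr0.
(* The uncontrolled intermediate point s enters both expansions through [s * p], which cancels. *)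
have -> : (A - B) * h - h ^+ 2 * q =
   h * ((A - C - (s * p + h * q)) - (B - C - s * p)) by ring.
rewrite normrM gtr0_norm// (le_trans (ler_wpM2l (ltW h0) (ler_normB _ _)))//.
rewrite expr2 mulrCA ler_pM2l// (le_trans (lerD H1 H2))//.
have E1 : `|s *: u + h *: v| <= h * (`|u| + `|v| + 1).
  rewrite (le_trans (ler_normD _ _))// !normrZ !ger0_norm ?(ltW h0)//; last by case/andP: sh.
  by rewrite mulrDr mulr1 mulrDr -[leLHS]addr0 !lerD ?(ltW h0)// ler_wpM2r//; case/andP: sh.
have E2 : `|s *: u| <= h * (`|u| + `|v| + 1).
  rewrite normrZ ger0_norm; last by case/andP: sh.
  by rewrite (@le_trans _ _ (h * `|u|)) ?ler_wpM2r ?ler_pM2l//;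
    [case/andP: sh|rewrite -addrA lerDl addr_ge0].
rewrite -mulrDr (le_trans (ler_wpM2l (ltW d0) (lerD E1 E2)))//.
by rewrite le_eqVlt; apply/orP; left; apply/eqP; rewrite /M; field;
  rewrite gt_eqF// ltr_wpDl// addr_ge0.
Unshelve. all: by end_near. Qed.

(** Young's form of the symmetry theorem: the second difference is symmetric in u and v, and it
    equals h^2 times either mixed derivative up to o(h^2). Continuity of the second derivatives is
    replaced by differentiability of the first ones. *)
Lemma derive_comm F x u v : (\forall y \near x, differentiable F y) ->
  differentiable ('D_u F) x -> differentiable ('D_v F) x ->
  'D_v ('D_u F) x = 'D_u ('D_v F) x.
Proof.
move=> dF du dv; apply/eqP; rewrite -subr_eq0 -normr_le0.
apply/ler_addgt0Pl => e e0; rewrite addr0.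
have e2 : 0 < e / 2 by rewrite divr_gt0.
have [h h0 [/(_ h0) H1 /(_ h0) H2]] := near0_ex_pos
  (filterI (second_difference v dF du e2) (second_difference u dF dv e2)).
have h2 : 0 < h ^+ 2 by rewrite exprn_gt0.
rewrite -(ler_pM2l h2) -{1}(gtr0_norm h2) -normrM.
move: H1 H2; set a := 'D_v _ x; set b := 'D_u _ x => H1 H2.
set D := F (h *: u + (h *: v + x)) - F (h *: u + x) - F (h *: v + x) + F x in H1.
have -> : h ^+ 2 * (a - b) = (D - h ^+ 2 * b) - (D - h ^+ 2 * a) by ring.
apply: le_trans (ler_normB _ _) _; rewrite (splitr e) mulrDr.
apply: lerD; rewrite [leRHS]mulrC; last exact: H1.
have DE : D = F (h *: v + (h *: u + x)) - F (h *: v + x) - F (h *: u + x) + F x.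
  by rewrite /D addrCA; ring.
by rewrite DE; exact: H2.
Qed.

End Rays.

(** * Iterated partial derivatives and the reflection principle *)

Section IterPartial.
Variables (R : realType) (m : nat).
Implicit Types (F G : 'rV[R]_m -> R) (a x : 'rV[R]_m) (s : seq 'I_m).

Lemma iter_partial_cat s1 s2 F :
  iter_partial (s1 ++ s2) F = iter_partial s1 (iter_partial s2 F).
Proof. by elim: s1 => //= i s1 ->. Qed.

Lemma smooth_near_open F a : smooth_near F a ->
  exists U, [/\ open U, U a & forall x, U x ->
    forall s, differentiable (iter_partial s F) x].
Proof.
move=> Fa; exists (interior [set x | forall s, differentiable (iter_partial s F) x]).
split; [exact: open_interior|exact: Fa|].
by move=> x; apply: interior_subset.
Qed.

Lemma smooth_near_differentiable F a : smooth_near F a -> differentiable F a.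
Proof. by move=> /nbhs_singleton /(_ [::]). Qed.

(** A guessed family [G], indexed by words and closed under partial derivatives on an open set, must
    be the family of iterated partials. Proving smoothness then amounts to exhibiting [G] with
    differentiable members. *)
Lemma iter_partialE U F (G : seq 'I_m -> 'rV[R]_m -> R) : open U ->
  (forall x, U x -> F x = G [::] x) ->
  (forall s i x, U x -> 'D_(delta_mx 0 i) (G s) x = G (i :: s) x) ->
  forall s x, U x -> iter_partial s F x = G s x.
Proof.
move=> oU F0 Gs; elim=> [|i s IH] x Ux /=; first exact: F0.
rewrite -Gs//; apply: near_eq_derive.
by apply: filterS (open_nbhs_nbhs (conj oU Ux)) => y /IH.
Qed.

Lemma smooth_near_iter U F (G : seq 'I_m -> 'rV[R]_m -> R) a : open U -> U a ->
  (forall x, U x -> F x = G [::] x) ->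
  (forall s i x, U x -> 'D_(delta_mx 0 i) (G s) x = G (i :: s) x) ->
  (forall s x, U x -> differentiable (G s) x) -> smooth_near F a.
Proof.
move=> oU Ua F0 Gs dG; apply: filterS (open_nbhs_nbhs (conj oU Ua)) => x Ux s.
apply: near_eq_differentiable (dG s x Ux).
by apply: filterS (open_nbhs_nbhs (conj oU Ux)) => y /(iter_partialE oU F0 Gs) ->.
Qed.

Lemma near_eq_iter_partial F G a : (\forall x \near a, F x = G x) ->
  forall s, iter_partial s F a = iter_partial s G a.
Proof.
move=> FG s; pose U := interior [set x | F x = G x].
apply: (@iter_partialE U F (fun s => iter_partial s G)) => //.
- exact: open_interior.
- by move=> x; apply: interior_subset.
Qed.

Lemma near_eq_smooth F G a : (\forall x \near a, F x = G x) ->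
  smooth_near F a -> smooth_near G a.
Proof.
move=> FG Fa; have [U [oU Ua dF]] := smooth_near_open Fa.
pose W := U `&` interior [set x | F x = G x].
have oW : open W by apply: openI => //; exact: open_interior.
apply: (@smooth_near_iter W G (fun s => iter_partial s F)) => //.
- by move=> x [_ /interior_subset].
- by move=> s x [Ux _]; apply: dF.
Qed.

Lemma smooth_near_iter_partial F a s : smooth_near F a ->
  smooth_near (iter_partial s F) a.
Proof.
by apply: filterS => x H t; rewrite -iter_partial_cat.
Qed.

Lemma smooth_near_cst (c : R) a : smooth_near (cst c) a.
Proof.
apply: (@smooth_near_iter setT _ (fun s => if s is [::] then cst c else cst 0)) => //.
- exact: openT.
- by move=> s i x _; case: s => [|j s]; rewrite derive_cst.
- by move=> [|j s] x _; exact: differentiable_cst.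
Qed.

Lemma iter_partial_sum n (c : 'I_n -> R) (F : 'I_n -> 'rV[R]_m -> R) a :
  (forall i, smooth_near (F i) a) ->
  smooth_near (fun x => \sum_i c i * F i x) a /\
  forall s, iter_partial s (fun x => \sum_i c i * F i x) a =
     \sum_i c i * iter_partial s (F i) a.
Proof.
move=> Fa.
have nU : \forall x \near a, forall i s, differentiable (iter_partial s (F i)) x.
  exact: filter_forall Fa.
pose W := interior (fun x => forall i : 'I_n, forall s, differentiable (iter_partial s (F i)) x).
have oW : open W by exact: open_interior.
have dW x : W x -> forall i s, differentiable (iter_partial s (F i)) x.
  by move=> /interior_subset.
pose G s x := \sum_i c i * iter_partial s (F i) x.
have E s : G s = \sum_i (c i *: iter_partial s (F i)).
  by apply/funext => x; rewrite /G fct_sumE.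
have dG s i x : W x -> 'D_(delta_mx 0 i) (G s) x = G (i :: s) x.
  move=> Wx; have dv j : derivable (iter_partial s (F j)) x (delta_mx 0 i).
    by apply: diff_derivable; exact: dW.
  rewrite E derive_sum; last by move=> j; apply: derivableZ; exact: dv.
  by apply: eq_bigr => j _; rewrite deriveZ.
split; last first.
  by move=> s; exact: (@iter_partialE W _ G oW (fun _ _ => erefl) dG s a nU).
apply: (@smooth_near_iter W _ G a oW nU (fun _ _ => erefl) dG) => s x Wx.
have H i : differentiable (c i *: iter_partial s (F i)) x.
  by apply: differentiableZ; exact: dW.
by rewrite E; exact: differentiable_sum H.
Qed.

(** Under a diagonal affine map each partial derivative pulls back to a multiple of the same
    partial, so a word of partials only picks up the product of the factors [e k]. Reflections in
    coordinate lines are of this form. *)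
Definition axis_map (e t : 'I_m -> R) x : 'rV[R]_m := \row_k (e k * x 0 k + t k).

Lemma differentiable_axis_map e t x : differentiable (axis_map e t) x.
Proof.
have -> : axis_map e t =
    \sum_k (fun x : 'rV[R]_m => (e k * x 0 k + t k) *: (delta_mx 0 k : 'rV[R]_m)).
  apply/funext => y; rewrite fct_sumE [LHS]row_sum_delta.
  by apply: eq_bigr => k _; rewrite mxE.
have H k : differentiable
    (fun x : 'rV[R]_m => (e k * x 0 k + t k) *: (delta_mx 0 k : 'rV[R]_m)) x.
  apply: differentiableZl; apply: differentiableD; last exact: differentiable_cst.
  apply: differentiableZ; exact: differentiable_coord.
exact: differentiable_sum H.
Qed.

Lemma continuous_axis_map e t : continuous (axis_map e t).
Proof. by move=> x; apply: differentiable_continuous; exact: differentiable_axis_map. Qed.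

Lemma derive_axis_map F e t x k : differentiable F (axis_map e t x) ->
  'D_(delta_mx 0 k) (F \o axis_map e t) x =
  e k * 'D_(delta_mx 0 k) F (axis_map e t x).
Proof.
move=> dF; rewrite [in RHS]deriveE//.
have -> : e k * 'd F (axis_map e t x) (delta_mx 0 k) =
    'D_(e k *: delta_mx 0 k) F (axis_map e t x) by rewrite deriveE// linearZ.
suff E h : (F \o axis_map e t) (h *: delta_mx 0 k + x) =
    F (h *: (e k *: delta_mx 0 k) + axis_map e t x).
  rewrite /derive.
  have -> : (fun h => h^-1 *: (((F \o axis_map e t) \o shift x) (h *: delta_mx 0 k)
      - (F \o axis_map e t) x)) = (fun h => h^-1 *: ((F \o shift (axis_map e t x))
      (h *: (e k *: delta_mx 0 k)) - F (axis_map e t x))).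
    by apply/funext => h; congr (_ *: (_ - _)); exact: E.
  by [].
congr F; apply/rowP => j; rewrite !mxE eqxx /=.
by case: eqP => [->|_] /=; ring.
Qed.

Lemma iter_partial_axis_map F e t a : smooth_near F (axis_map e t a) ->
  smooth_near (F \o axis_map e t) a /\
  forall s, iter_partial s (F \o axis_map e t) a =
     (\prod_(k <- s) e k) * iter_partial s F (axis_map e t a).
Proof.
move=> Fa; have [U [oU Ua dF]] := smooth_near_open Fa.
pose W := axis_map e t @^-1` U.
have oW : open W by apply: open_comp => // x _; exact: continuous_axis_map.
pose G s x := (\prod_(k <- s) e k) * iter_partial s F (axis_map e t x).
have E s : G s = (\prod_(k <- s) e k) *: (iter_partial s F \o axis_map e t) by [].
have d s x : W x -> differentiable (iter_partial s F \o axis_map e t) x.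
  by move=> Wx; apply: differentiable_comp;
    [exact: differentiable_axis_map|exact: dF].
have G0 x : W x -> (F \o axis_map e t) x = G [::] x.
  by move=> _; rewrite /G big_nil mul1r.
have dG s i x : W x -> 'D_(delta_mx 0 i) (G s) x = G (i :: s) x.
  move=> Wx; rewrite E deriveZ; last by apply: diff_derivable; exact: d.
  rewrite derive_axis_map; last exact: dF.
  by rewrite /G big_cons /= -[_ *: _]/(_ * _) mulrCA mulrA.
split; last by move=> s; exact: (@iter_partialE W _ G oW G0 dG s a Ua).
apply: (@smooth_near_iter W _ G a oW Ua G0 dG) => s x Wx.
by rewrite E; apply: differentiableZ; exact: d.
Qed.

Lemma diffE_delta F x (v : 'rV[R]_m) : differentiable F x ->
  'd F x v = \sum_i v 0 i * 'D_(delta_mx 0 i) F x.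
Proof.
move=> dF; rewrite [v in LHS]row_sum_delta linear_sum.
by apply: eq_bigr => i _; rewrite linearZ deriveE.
Qed.

Lemma diff_eq_half F G x k (sg : R) : sg != 0 ->
  differentiable F x -> differentiable G x ->
  (\forall y \near x, 0 <= sg * ((y : 'rV[R]_m) 0 k - x 0 k) -> F y = G y) ->
  'd F x = 'd G x :> ('rV[R]_m -> R).
Proof.
move=> sg0 dF dG FG; apply/funext => v.
have Fx : F x = G x by apply: (nbhs_singleton FG); rewrite subrr mulr0.
(* Either v or -v points into the half-space, and both differentials are linear. *)
suff H (w : 'rV[R]_m) : 0 <= sg * w 0 k -> 'd F x w = 'd G x w.
  have [/H//|/ltW v0] := leP 0 (sg * v 0 k).
  have vN : 0 <= sg * (- v) 0 k by rewrite mxE mulrN oppr_ge0.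
  have N (h : {linear 'rV[R]_m -> R}) : h (- v) = - h v by exact: raddfN.
  by apply: oppr_inj; rewrite -2!N; exact: H.
move=> w0; apply: diff_eq_ray => //.
apply: filterS (near_line w FG) => h H h0; apply: H.
by rewrite !mxE addrK mulrCA mulr_ge0// ltW.
Qed.

Lemma derive_eq_half F G x k (sg : R) v : sg != 0 ->
  differentiable F x -> differentiable G x ->
  (\forall y \near x, 0 <= sg * ((y : 'rV[R]_m) 0 k - x 0 k) -> F y = G y) ->
  'D_v F x = 'D_v G x.
Proof.
move=> sg0 dF dG FG.
by rewrite (deriveE v dF) (deriveE v dG) (diff_eq_half sg0 dF dG FG).
Qed.

Lemma continuous_eq_half F G x k (sg : R) : sg != 0 ->
  {for x, continuous F} -> {for x, continuous G} ->
  (\forall y \near x, 0 < sg * ((y : 'rV[R]_m) 0 k - x 0 k) -> F y = G y) -> F x = G x.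
Proof.
move=> sg0 cF cG FG; apply: (continuous_eq_ray (v := sg *: delta_mx 0 k)) => //.
apply: filterS (near_line (sg *: delta_mx 0 k) FG) => h H h0; apply: H.
rewrite !mxE !eqxx addrK mulr1 mulrCA mulr_gt0// -expr2 lt_def sqrf_eq0 sg0.
exact: sqr_ge0.
Qed.

Lemma partial_comm F x i j : smooth_near F x ->
  iter_partial [:: i; j] F x = iter_partial [:: j; i] F x.
Proof.
move=> Fx; apply: derive_comm.
- by apply: filterS Fx => y /(_ [::]).
- exact: (nbhs_singleton Fx [:: j]).
- exact: (nbhs_singleton Fx [:: i]).
Qed.

End IterPartial.

(** * The reflection principle for the Helmholtz equation *)

Section Reflection.
Variables (R : realType) (m : nat) (k : 'I_m) (c sg : R).
Hypothesis sg2 : sg * sg = 1.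
Implicit Types (F G : 'rV[R]_m -> R) (a x y : 'rV[R]_m) (s : seq 'I_m).

Let refl_sign (j : 'I_m) : R := if j == k then -1 else 1.
Let refl_shift (j : 'I_m) : R := if j == k then 2 * c else 0.
Definition mirror : 'rV[R]_m -> 'rV[R]_m := axis_map refl_sign refl_shift.

Lemma mirrorE x j : mirror x 0 j = if j == k then 2 * c - x 0 k else x 0 j.
Proof.
rewrite mxE /refl_sign /refl_shift; case: eqP => [->|_]; ring.
Qed.

Lemma mirrorK : involutive mirror.
Proof.
move=> x; apply/rowP => j; rewrite !mirrorE eqxx; case: eqP => // ->; ring.
Qed.

Lemma mirror_fix x : x 0 k = c -> mirror x = x.
Proof.
move=> xk; apply/rowP => j; rewrite mirrorE; case: eqP => // ->.
by rewrite xk; ring.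
Qed.

Lemma continuous_mirror : continuous mirror.
Proof. exact: continuous_axis_map. Qed.

Lemma iter_partial_mirror F a : smooth_near F (mirror a) ->
  smooth_near (F \o mirror) a /\
  forall s, iter_partial s (F \o mirror) a =
     (\prod_(j <- s) refl_sign j) * iter_partial s F (mirror a).
Proof. exact: iter_partial_axis_map. Qed.

Lemma iter_partial2_mirror F a i : smooth_near F (mirror a) ->
  iter_partial [:: i; i] (F \o mirror) a = iter_partial [:: i; i] F (mirror a).
Proof.
move=> /iter_partial_mirror[_ ->]; rewrite !big_cons big_nil mulr1.
rewrite [X in X * _](_ : _ = 1) ?mul1r// /refl_sign.
by case: eqP => _; ring.
Qed.

(* The odd extension, for a Dirichlet condition, if b; else the even one, for a
   Neumann condition. *)
Definition reflect_ext (b : bool) F y : R :=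
  if sg * y 0 k <= sg * c then F y else (-1) ^+ b * F (mirror y).

Let bc (b : bool) F y : Prop :=
  if b then F y = 0 else 'D_(delta_mx 0 k) F y = 0.

(* Stable under partial derivatives, up to exchanging the boundary conditions for
   the derivative in the direction k. *)
Let good (U : set 'rV[R]_m) (mu : R) b F :=
  [/\ forall y, U y -> forall s, differentiable (iter_partial s F) y,
      forall y, U y -> sg * y 0 k < sg * c ->
         \sum_i iter_partial [:: i; i] F y = mu * F y &
      forall y, U y -> y 0 k = c -> bc b F y].

Lemma sg_neq0 : sg != 0.
Proof. by apply/eqP => s0; move: sg2; rewrite s0 mul0r => /esym/eqP; rewrite oner_eq0. Qed.

Lemma near_side y : sg * y 0 k < sg * c ->
  \forall z \near y, sg * (z : 'rV[R]_m) 0 k < sg * c.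
Proof.
move=> yc; have cc : {for y, continuous (fun z : 'rV[R]_m => sg * z 0 k)}.
  by apply: differentiable_continuous; apply: differentiableZ; exact: differentiable_coord.
exact: (cc [set r | r < sg * c] (lt_nbhsl yc)).
Qed.

Lemma near_side_gt y : sg * c < sg * y 0 k ->
  \forall z \near y, sg * c < sg * (z : 'rV[R]_m) 0 k.
Proof.
move=> yc; have cc : {for y, continuous (fun z : 'rV[R]_m => sg * z 0 k)}.
  by apply: differentiable_continuous; apply: differentiableZ; exact: differentiable_coord.
exact: (cc [set r | sg * c < r] (lt_nbhsr yc)).
Qed.

Section Patch.
Variables (U : set 'rV[R]_m) (mu : R).
Hypotheses (oU : open U) (Um : forall y, U y -> U (mirror y)).

Let nearU y : U y -> \forall z \near y, U z.
Proof. by move=> Uy; exact: open_nbhs_nbhs. Qed.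

Let good_smooth b F y : good U mu b F -> U y -> smooth_near F y.
Proof. by move=> [dF _ _] Uy; apply: filterS (nearU Uy) => z /dF. Qed.

Let derive_line0 F y i : smooth_near F y -> i != k ->
  (\forall z \near y, (z : 'rV[R]_m) 0 k = y 0 k -> F z = 0) ->
  'D_(delta_mx 0 i) F y = 0.
Proof.
move=> sF ik F0; have dF := smooth_near_differentiable sF.
have d0 : differentiable (cst 0 : 'rV[R]_m -> R) y by exact: differentiable_cst.
rewrite deriveE// (diff_eq_ray (g := cst 0))// ?diff_cst//.
  exact: (nbhs_singleton F0).
apply: filterS (near_line (delta_mx 0 i) F0) => h H h0.
by rewrite H// !mxE eqxx eq_sym (negPf ik) mulr0 add0r.
Qed.

(** The equation reaches the line by continuity from the open side. There it expresses the second
    normal derivative by F and its tangential derivatives. *)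
Let helmholtz_line b F y : good U mu b F -> U y -> y 0 k = c ->
  \sum_i iter_partial [:: i; i] F y = mu * F y.
Proof.
move=> gF Uy yk; have sF := good_smooth gF Uy.
have -> : \sum_i iter_partial [:: i; i] F y = (\sum_i iter_partial [:: i; i] F) y.
  by rewrite fct_sumE.
apply: (@continuous_eq_half R m (\sum_i iter_partial [:: i; i] F) (fun y => mu * F y) y k (- sg)) => //.
- by rewrite oppr_eq0 sg_neq0.
- apply: differentiable_continuous; apply: differentiable_sum => i.
  exact: (nbhs_singleton sF).
- apply: differentiable_continuous; apply: differentiableZ.
  exact: smooth_near_differentiable.
- apply: filterS (nearU Uy) => z Uz; rewrite yk mulNr -mulrN opprB mulrBr subr_gt0.
  by case: gF => _ hF _ /(hF _ Uz) <-; rewrite fct_sumE.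
Qed.

Let good_step b F i : good U mu b F ->
  good U mu (b (+) (i == k)) (iter_partial [:: i] F).
Proof.
move=> gF; have [dF hF bF] := gF; split.
- by move=> y Uy s; rewrite -iter_partial_cat; exact: dF.
- move=> y Uy yc; have sF := good_smooth gF Uy.
  have -> : \sum_j iter_partial [:: j; j] (iter_partial [:: i] F) y =
      \sum_j 'D_(delta_mx 0 i) (iter_partial [:: j; j] F) y.
    apply: eq_bigr => j _.
    rewrite -[RHS]/(iter_partial [:: i; j] (iter_partial [:: j] F) y).
    rewrite (partial_comm i j (smooth_near_iter_partial [:: j] sF)).
    rewrite -[LHS]/('D_(delta_mx 0 j) (iter_partial [:: j; i] F) y).
    rewrite -[RHS]/('D_(delta_mx 0 j) (iter_partial [:: i; j] F) y).
    apply: near_eq_derive; apply: filterS (nearU Uy) => z Uz.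
    exact: partial_comm (good_smooth gF Uz).
  rewrite -derive_sum; last by move=> j; apply: diff_derivable; exact: dF.
  rewrite -[RHS]/(mu *: _) -deriveZ; last by apply: diff_derivable; exact: (dF y Uy [::]).
  apply: near_eq_derive; apply: filterS2 (nearU Uy) (near_side yc) => z Uz zc.
  by rewrite fct_sumE hF.
- move=> y Uy yk; have sF := good_smooth gF Uy.
  case: (eqVneq i k) => [->|ik]; last first.
    have nb : \forall z \near y, (z : 'rV[R]_m) 0 k = y 0 k -> bc b F z.
      by apply: filterS (nearU Uy) => z Uz; rewrite yk; exact: bF.
    rewrite addbF /bc; case: b gF bF nb => gF bF nb; first exact: derive_line0.
    rewrite -[LHS]/(iter_partial [:: k; i] F y) partial_comm//.
    by apply: derive_line0 => //; exact: (smooth_near_iter_partial [:: k] sF).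
  rewrite addbT /bc; case: b gF bF => gF bF /=; last exact: bF.
  rewrite -[LHS]/(iter_partial [:: k; k] F y).
  (* The only case that uses the equation: F vanishes on the line, hence so do its tangential second
     derivatives, and what is left says that the second normal derivative vanishes. So the normal
     derivative satisfies a Neumann condition. *)
  have := helmholtz_line gF Uy yk; rewrite (bF _ Uy yk) mulr0 (bigD1 k)//= big1 ?addr0//.
  move=> j jk; rewrite -[LHS]/('D_(delta_mx 0 j) (iter_partial [:: j] F) y).
  apply: derive_line0 => //; first exact: (smooth_near_iter_partial [:: j] sF).
  apply: filterS (nearU Uy) => z Uz; rewrite yk => zk.
  rewrite -[LHS]/('D_(delta_mx 0 j) F z); apply: derive_line0 => //.
    exact: good_smooth gF Uz.
  by apply: filterS (nearU Uz) => w Uw; rewrite zk => wk; exact: bF.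
Qed.

(** A partial derivative of the extension is the extension of that derivative, with the parity
    toggled in the direction k, which the mirror reverses. Off the line this is the chain rule; on
    the line the boundary conditions of F and of its first partials make the two branches agree to
    first order. *)
Let patch_diff b F y : good U mu b F -> U y ->
  differentiable (reflect_ext b F) y /\ forall i,
  'D_(delta_mx 0 i) (reflect_ext b F) y =
  reflect_ext (b (+) (i == k)) (iter_partial [:: i] F) y.
Proof.
move=> gF Uy; have sF := good_smooth gF Uy.
have dF := smooth_near_differentiable sF.
have sFm := good_smooth gF (Um Uy).
have [sM dM] := iter_partial_mirror sFm.
pose G z := (-1) ^+ b * (F \o mirror) z.
have dG : differentiable G y by apply: differentiableZ; exact: smooth_near_differentiable.
have DG i : 'D_(delta_mx 0 i) G y =
    (-1) ^+ (b (+) (i == k)) * iter_partial [:: i] F (mirror y).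
  rewrite deriveZ; last exact: diff_derivable (smooth_near_differentiable sM).
  have := dM [:: i]; rewrite big_seq1 => /= ->.
  rewrite -[LHS]/(_ * _) signr_addb -mulrA /refl_sign; congr (_ * _).
  by case: eqP => _; rewrite ?expr1 ?expr0.
have [yc|yc|yc] := ltrgtP (sg * y 0 k) (sg * c).
- have E : \forall z \near y, F z = reflect_ext b F z.
    by apply: filterS (near_side yc) => z zc; rewrite /reflect_ext ltW.
  split=> [|i]; first exact: near_eq_differentiable E dF.
  rewrite -(near_eq_derive _ E) /reflect_ext ltW//.
- have E : \forall z \near y, G z = reflect_ext b F z.
    by apply: filterS (near_side_gt yc) => z zc; rewrite /reflect_ext leNgt zc.
  split=> [|i]; first exact: near_eq_differentiable E dG.
  by rewrite -(near_eq_derive _ E) DG /reflect_ext leNgt yc.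
- have yk : y 0 k = c by exact: (mulfI sg_neq0).
  have my : mirror y = y by exact: mirror_fix.
  have [_ _ bF] := gF; have {}bF := bF _ Uy yk.
  have GF : G y = F y.
    rewrite /G /= my; case: b gF @G dG DG bF => gF G dG DG /= bF.
      by rewrite bF mulr0.
    by rewrite expr0 mul1r.
  have D i : 'D_(delta_mx 0 i) G y = 'D_(delta_mx 0 i) F y.
    rewrite DG my; have [_ _ /(_ _ Uy yk)] := good_step i gF.
    rewrite /bc; case: (b (+) (i == k)) => /= [->|_]; first by rewrite mulr0.
    by rewrite expr0 mul1r.
  have dFG : 'd F y = 'd G y :> ('rV[R]_m -> R).
    apply/funext => v; rewrite !diffE_delta//.
    by apply: eq_bigr => i _; rewrite D.
  have Ey : F y = reflect_ext b F y by rewrite /reflect_ext yk lexx.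
  have [|d dE] := differentiable_selection dF dG dFG Ey (etrans GF Ey).
    apply: filterE => z; rewrite /reflect_ext; case: ifP => _; [by left|by right].
  split=> // i; rewrite deriveE// dE -deriveE//.
  by rewrite /reflect_ext yk lexx.
Qed.

Let good_iter b F s : good U mu b F ->
  good U mu (b (+) odd (count_mem k s)) (iter_partial s F).
Proof.
move=> gF; elim: s => [|i s IH]; first by rewrite addbF.
have := good_step i IH; rewrite -iter_partial_cat /=.
by rewrite oddD oddb [(i == k) (+) _]addbC addbA.
Qed.

Lemma reflect_ext_smooth b F a : good U mu b F -> U a ->
  smooth_near (reflect_ext b F) a.
Proof.
move=> gF Ua; pose G s := reflect_ext (b (+) odd (count_mem k s)) (iter_partial s F).
apply: (@smooth_near_iter _ _ U _ G a oU Ua) => [x _|s i x Ux|s x Ux].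
- by rewrite /G /= addbF.
- rewrite /G (patch_diff (good_iter s gF) Ux).2 -iter_partial_cat /=.
  by rewrite oddD oddb [(i == k) (+) _]addbC addbA.
- exact: (patch_diff (good_iter s gF) Ux).1.
Qed.

End Patch.

(** The equation is assumed on one side only: beyond the line F is an arbitrary smooth continuation,
    whose values [reflect_ext] discards. Differentiability of F on both sides is what makes F a
    smooth branch at points of the line. *)
Lemma reflection_principle b F a mu : a 0 k = c -> smooth_near F a ->
  (\forall y \near a, sg * (y : 'rV[R]_m) 0 k < sg * c ->
     \sum_i iter_partial [:: i; i] F y = mu * F y) ->
  (\forall y \near a, (y : 'rV[R]_m) 0 k = c ->
     if b then F y = 0 else 'D_(delta_mx 0 k) F y = 0) ->
  smooth_near (reflect_ext b F) a.
Proof.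
move=> ak sF hF bF.
pose N := interior (fun y => [/\ forall s, differentiable (iter_partial s F) y,
  sg * y 0 k < sg * c -> \sum_i iter_partial [:: i; i] F y = mu * F y &
  y 0 k = c -> if b then F y = 0 else 'D_(delta_mx 0 k) F y = 0]).
have oN : open N by exact: open_interior.
have Na : N a by rewrite /N /interior; near=> y; split; [near: y|near: y|near: y].
(* Intersecting with the mirror image makes the neighbourhood symmetric, as the extension at y
   involves F at [mirror y]. *)
pose U := N `&` mirror @^-1` N.
have oU : open U.
  by apply: openI => //; apply: open_comp => // x _; exact: continuous_mirror.
apply: (@reflect_ext_smooth U mu oU _ b F a).
- by move=> y [Ny My]; split; [exact: My|rewrite /= mirrorK; exact: Ny].
- by split=> y [/interior_subset[? ? ?] _].
- by split=> //=; rewrite mirror_fix.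
Unshelve. all: by end_near. Qed.

End Reflection.

(** * The tile *)

Section Tile.
Variable R : realType.
Implicit Types (x y : 'rV[R]_2) (k : 'I_2) (c d : 'I_2 * bool).

Lemma I2_neq k j : j != k -> j = rev_ord k.
Proof. by case: k j => -[|[|]]// ? [[|[|]]// ?] //= _; apply/val_inj. Qed.

Lemma rev_ord2_neq k : rev_ord k != k.
Proof. by case: k => -[|[|]]. Qed.

Lemma I2_all (P : 'I_2 -> Prop) k : P k -> P (rev_ord k) -> forall j, P j.
Proof. by move=> Pk Pk' j; have [->//|/I2_neq->] := eqVneq j k. Qed.

Lemma near_coord x j (a b : R) : a < x 0 j -> x 0 j < b ->
  \forall y \near x, a < (y : 'rV[R]_2) 0 j /\ y 0 j < b.
Proof.
move=> ax xb; have c : {for x, continuous (fun y : 'rV[R]_2 => y 0 j)}.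
  exact: coord_continuous.
have c1 := c [set r | a < r] (lt_nbhsr ax).
have c2 := c [set r | r < b] (lt_nbhsl xb).
by near=> y; split; [near: y; exact: c1|near: y; exact: c2].
Unshelve. all: by end_near. Qed.

Definition tile x : bool :=
  [exists k, (`|x 0 k| <= 2) && (`|x 0 (rev_ord k)| <= 1)].

Definition sgn (b : bool) : R := (-1) ^+ b.

Lemma sgn_cases b : (sgn b = 1) + (sgn b = -1).
Proof. by rewrite /sgn; case: b; rewrite ?expr0 ?expr1; [right|left]. Qed.

Lemma sgn2 b : sgn b * sgn b = 1.
Proof. by case: (sgn_cases b) => ->; ring. Qed.

Lemma sgn_inj : injective sgn.
Proof. by move=> [] []//; rewrite /sgn expr0 expr1 => H; exfalso; lra. Qed.

Definition facet c x : bool := x 0 c.1 == 2 * sgn c.2.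

Definition flip c : 'rV[R]_2 -> 'rV[R]_2 := mirror c.1 (2 * sgn c.2).

Lemma tileP x : reflect (exists k, [/\ -2 <= x 0 k, x 0 k <= 2,
  -1 <= x 0 (rev_ord k) & x 0 (rev_ord k) <= 1]) (tile x).
Proof.
apply: (iffP existsP) => -[k].
  by rewrite !ler_norml => /andP[/andP[? ?] /andP[? ?]]; exists k; split.
by move=> [? ? ? ?]; exists k; rewrite !ler_norml; apply/andP; split; apply/andP.
Qed.

Lemma tile_bound x k : tile x -> -2 <= x 0 k /\ x 0 k <= 2.
Proof.
move=> /tileP[j [h1 h2 h3 h4]]; have [->//|/I2_neq->] := eqVneq k j.
by split; lra.
Qed.

Lemma facet_other c x : tile x -> facet c x ->
  -1 <= x 0 (rev_ord c.1) /\ x 0 (rev_ord c.1) <= 1.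
Proof.
move=> /tileP[j [h1 h2 h3 h4]] /eqP xc.
have [->//|/I2_neq cj] := eqVneq c.1 j.
by move: xc; rewrite cj; case: (sgn_cases c.2) => ->; lra.
Qed.

(** On an arm end one coordinate is 2 or -2 and the other has absolute value at most 1; this
    disjointness keeps every class of the gluing to at most two points. *)
Lemma facet_uniq c d x : tile x -> facet c x -> facet d x -> c = d.
Proof.
move=> tx cx dx; have [h1 h2] := facet_other tx cx.
have [e|/I2_neq e] := eqVneq d.1 c.1; last first.
  by exfalso; move: dx h1 h2 => /eqP; rewrite e; clear; case: (sgn_cases d.2) => ->; lra.
have n2 : (2 : R) != 0 by rewrite pnatr_eq0.
move: cx dx => /eqP cx /eqP; rewrite e cx => /(mulfI n2)/sgn_inj e2.
by rewrite (surjective_pairing c) (surjective_pairing d) e e2.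
Qed.

Lemma tile0 : tile 0.
Proof. by apply/tileP; exists ord0; rewrite !mxE; split; lra. Qed.

Lemma facet0 c : ~~ facet c 0.
Proof. by apply/negP => /eqP; rewrite mxE; case: (sgn_cases c.2) => ->; lra. Qed.

Lemma near_facet x : \forall y \near x, forall c, facet c y -> facet c x.
Proof.
suff H c : \forall y \near x, facet c y -> facet c x by exact: filter_forall H.
have [xc|xc] := boolP (facet c x); first by apply: filterE.
have nx : x 0 c.1 != 2 * sgn c.2 by [].
have cc : {for x, continuous (fun y : 'rV[R]_2 => y 0 c.1)}.
  exact: coord_continuous.
have [lt|gt|e] := ltrgtP (x 0 c.1) (2 * sgn c.2); last by rewrite e eqxx in nx.
  have H : \forall y \near x, (y : 'rV[R]_2) 0 c.1 < 2 * sgn c.2.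
    exact: cc (lt_nbhsl lt).
  by apply: filterS H => y H; rewrite /facet lt_eqF.
have H : \forall y \near x, 2 * sgn c.2 < (y : 'rV[R]_2) 0 c.1.
  exact: cc (lt_nbhsr gt).
by apply: filterS H => y H; rewrite /facet gt_eqF.
Qed.

Lemma near_not_tile x : ~~ tile x -> \forall y \near x, ~~ tile y.
Proof.
move=> xT.
have H (j : 'I_2) (r : R) : r < `|x 0 j| -> \forall y \near x, r < `|(y : 'rV[R]_2) 0 j|.
  move=> rx; have cc : {for x, continuous (fun y : 'rV[R]_2 => `|y 0 j|)}.
    apply: continuous_comp; [exact: coord_continuous|exact: norm_continuous].
  exact: (cc [set s | r < s] (lt_nbhsr rx)).
have {}H k : \forall y \near x, ~~ ((`|(y : 'rV[R]_2) 0 k| <= 2) && (`|y 0 (rev_ord k)| <= 1)).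
  have : ~~ ((`|x 0 k| <= 2) && (`|x 0 (rev_ord k)| <= 1)).
    by move: xT; rewrite negb_exists => /forallP.
  by rewrite negb_and -!ltNge => /orP[/H|/H]; apply: filterS => y ?;
    rewrite negb_and -!ltNge; apply/orP; [left|right].
have {}H : \forall y \near x, forall k : 'I_2,
  ~~ ((`|(y : 'rV[R]_2) 0 k| <= 2) && (`|y 0 (rev_ord k)| <= 1)).
  exact: filter_forall H.
by apply: filterS H => y H'; rewrite negb_exists; apply/forallP.
Qed.

Lemma closed_tile : closed [set x | tile x].
Proof.
rewrite -openC openE => x /= /negP xT; rewrite /interior.
by apply: filterS (near_not_tile xT) => y /negP.
Qed.

Lemma compact_tile : compact [set x | tile x].
Proof.
apply: bounded_closed_compact closed_tile.
exists 2; split; first exact: num_real.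
move=> M M2 x /= xT; rewrite [X in X <= _]/Num.Def.normr/= mx_normrE.
apply: bigmax_le => [|[i j] _ /=]; first lra.
by have [? ?] := tile_bound j xT; rewrite ord1 ler_norml; apply/andP; split; lra.
Qed.

Lemma tile_scale x (t : R) : tile x -> 0 <= t <= 1 -> tile (t *: x).
Proof.
move=> /existsP[k /andP[h1 h2]] /andP[t0 t1]; apply/existsP; exists k.
rewrite !mxE !normrM !(ger0_norm t0); apply/andP; split; nra.
Qed.

Lemma connected_tile : connected [set x | tile x].
Proof.
have -> : [set x | tile x] = \bigcup_(x in [set x | tile x])
    ((fun t : R => t *: x) @` `[0, 1]%classic).
  rewrite eqEsubset; split=> [x xT|_ [x xT [t /= t01] <-]].
    by exists x => //; exists 1; rewrite /= ?scale1r// in_itv/= !lexx ler01.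
  by apply: tile_scale => //; move: t01; rewrite in_itv.
apply: bigcup_connected.
  exists 0 => x xT; exists 0; last by rewrite scale0r.
  by rewrite /= in_itv/= lexx ler01.
move=> x xT; apply: connected_continuous_connected.
  exact: segment_connected.
by apply: continuous_subspaceT; exact: scalel_continuous.
Qed.

End Tile.

(** * Gluing four tiles *)

(* A colour (k, b) stands for the arm end x_k = 2 (-1)^b of the tile. There the
   i-th tile is glued by reflection to the tile lnk (k, b) i; if this is i itself,
   the arm end is a boundary piece, of Dirichlet type if dir (k, b) i. *)
Record tile_graph := TileGraph {
  lnk : 'I_2 * bool -> 'I_4 -> 'I_4;
  dir : 'I_2 * bool -> 'I_4 -> bool;
  lnkK : forall c, involutive (lnk c);
  dir_loop : forall c i, dir c i -> lnk c i = i;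
  hub : 'I_4;
  hubP : forall i, i = hub \/ exists c, lnk c hub = i /\ i != hub }.

Section Glued.
Variables (R : realType) (g : tile_graph).
Implicit Types (x y z : 'rV[R]_2) (i j t : 'I_4) (c d : 'I_2 * bool).

(* A point shared by two tiles is represented in the one of smaller index. What
   lies outside of the tile is sent to the centre of the first one. *)
Definition norm_pt (p : 'I_4 * 'rV[R]_2) : 'I_4 * 'rV[R]_2 :=
  if tile p.2 then
    (if [pick c | facet c p.2] is Some c
     then (if lnk g c p.1 <= p.1 then lnk g c p.1 else p.1)%N else p.1, p.2)
  else (ord0, 0).

Lemma pick_facet c x : tile x -> facet c x -> [pick d | facet d x] = Some c.
Proof.
move=> tx cx; case: pickP => [d dx|/(_ c)]; last by rewrite cx.
by rewrite (facet_uniq tx dx cx).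
Qed.

Lemma pick_no_facet x : (forall c, ~~ facet c x) -> [pick d | facet d x] = None.
Proof. by move=> nx; case: pickP => // d; rewrite (negPf (nx d)). Qed.

Lemma norm_pt_idem p : norm_pt (norm_pt p) = norm_pt p.
Proof.
case: p => i x; rewrite [norm_pt (i, x)]/norm_pt /=; case: ifP => tx; last first.
  (* The default point is the centre of a tile, on no arm end, and is therefore its own
     representative. *)
  by rewrite /norm_pt /= tile0 pick_no_facet//= => c; exact: facet0.
rewrite /norm_pt /= tx; case: pickP => //= c cx.
case: (leqP (lnk g c i) i) => h; last by rewrite leqNgt h.
by rewrite lnkK; case: leqP => // h'; congr (_, _); apply/val_inj/anti_leq; rewrite h h'.
Qed.

(** The quotient space, encoded by canonical representatives: the fixed points of the idempotent
    [norm_pt]. *)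
Definition glued := {p : 'I_4 * 'rV[R]_2 | norm_pt p == p}.

HB.instance Definition _ := Choice.on glued.

Definition inj_tile i x : glued := exist _ (norm_pt (i, x)) (introT eqP (norm_pt_idem (i, x))).
(** Gluing by reflection identifies only points with equal coordinates, so the whole surface folds
    onto a single tile. *)
Definition fold (m : glued) : 'rV[R]_2 := (val m).2.

Lemma glued_ex (m : glued) : exists i x, tile x /\ m = inj_tile i x.
Proof.
exists (val m).1, (val m).2; case: m => -[i x] /= e; split; last first.
  by apply/val_inj; rewrite /= (eqP e).
have [//|tx] := boolP (tile x).
by move/eqP: e; rewrite /norm_pt /= (negPf tx) => -[_ xE]; rewrite -xE tile0 in tx.
Qed.

Lemma fold_inj i x : tile x -> fold (inj_tile i x) = x.
Proof. by rewrite /fold /= /norm_pt /= => ->. Qed.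

Lemma inj_tileP i j x : tile x ->
  inj_tile i x = inj_tile j x <-> i = j \/ exists2 c, facet c x & j = lnk g c i.
Proof.
move=> tx; split=> [/(congr1 val)|[->//|[c cx ->]]].
  rewrite /= /norm_pt /= tx; case: pickP => [c cx|_]; last by case=> ->; left.
  case: (leqP (lnk g c i)) => h1; case: (leqP (lnk g c j)) => h2 [].
  - by move=> /(can_inj (lnkK g c)) ->; left.
  - by move=> <-; right; exists c.
  - by move=> ->; right; exists c => //; rewrite lnkK.
  - by move=> ->; left.
apply/val_inj; rewrite /= /norm_pt /= tx (pick_facet tx cx) lnkK.
by case: ltngtP => // h; congr (_, _); apply/val_inj.
Qed.

Lemma inj_tile_eq i j x y : tile x -> tile y ->
  inj_tile i x = inj_tile j y -> x = y.
Proof. by move=> tx ty /(congr1 fold); rewrite !fold_inj. Qed.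

Lemma inj_tile_lnk c i x : tile x -> facet c x ->
  inj_tile (lnk g c i) x = inj_tile i x.
Proof. by move=> tx cx; apply/inj_tileP => //; right; exists c; rewrite ?lnkK. Qed.

(** The quotient topology given by its filters: around each representative of m, the set must
    contain a neighbourhood relative to the tile of that representative. *)
Definition glued_nbhs (m : glued) : set_system glued := [set A |
  forall t x, tile x -> inj_tile t x = m ->
  \forall y \near x, tile y -> A (inj_tile t y)].

Lemma glued_nbhs_filter (m : glued) : ProperFilter (glued_nbhs m).
Proof.
have [i [x [tx mE]]] := glued_ex m.
split; last first.
  split.
  - by move=> t y ty _; apply: filterE.
  - move=> A B mA mB t y ty my.
    apply: filterS2 (mA t y ty my) (mB t y ty my) => z Az Bz tz.
    by split; [exact: Az|exact: Bz].
  - move=> A B AB mA t y ty my.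
    by apply: filterS (mA t y ty my) => z mz /mz /AB.
move=> /(_ i x tx (esym mE)) /nbhs_singleton; exact.
Qed.

Lemma glued_nbhs_singleton (m : glued) A : glued_nbhs m A -> A m.
Proof.
have [i [x [tx mE]]] := glued_ex m.
by move=> /(_ i x tx (esym mE)) /nbhs_singleton /(_ tx); rewrite -mE.
Qed.

Lemma glued_nbhs_nbhs (m : glued) A : glued_nbhs m A ->
  glued_nbhs m (glued_nbhs^~ A).
Proof.
move=> mA t x tx mE.
have H : \forall y \near x, forall t', inj_tile t' x = m ->
    \forall z \near y, tile z -> A (inj_tile t' z).
  suff H t' : \forall y \near x, inj_tile t' x = m ->
    \forall z \near y, tile z -> A (inj_tile t' z) by exact: filter_forall H.
  have [e|ne] := pselect (inj_tile t' x = m); last by apply: filterE.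
  have := mA t' x tx e; rewrite -nbhs_nearE => /nbhs_interior.
  by apply: filterS.
(* An arm end through a point near x passes through x as well, so any other representative of the
   nearby point lies in a tile that also represents m. *)
apply: filterS2 H (near_facet x) => y H fy ty t' z tz /[dup] e.
move=> /(inj_tile_eq tz ty) zE; rewrite {}zE in tz e *.
apply: H; rewrite -mE; apply/inj_tileP => //.
by move/inj_tileP : e => /(_ tz) [->|[c cy ->]]; [left|right; exists c => //; exact: fy].
Qed.

HB.instance Definition _ := hasNbhs.Build glued glued_nbhs.

HB.instance Definition _ := Nbhs_isNbhsTopological.Build glued
  glued_nbhs_filter glued_nbhs_singleton glued_nbhs_nbhs.

Lemma near_gluedP t x (P : glued -> Prop) : tile x ->
  (\forall m \near inj_tile t x, P m) <->
  forall t', inj_tile t' x = inj_tile t x ->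
     \forall y \near x, tile y -> P (inj_tile t' y).
Proof.
move=> tx; split=> [H t' e|H]; first exact: (H : glued_nbhs _ _).
suff: glued_nbhs (inj_tile t x) P by [].
move=> t' y ty e.
by have yx := inj_tile_eq ty tx e; rewrite {}yx in ty e *; exact: H.
Qed.

Lemma near_inj_tile t x (P : glued -> Prop) : tile x ->
  (\forall m \near inj_tile t x, P m) ->
  \forall y \near x, tile y -> P (inj_tile t y).
Proof. by move=> tx /near_gluedP => /(_ tx); apply. Qed.

Lemma within_continuousP (T U : topologicalType) (A : set T) (f : T -> U) :
  {within A, continuous f} <->
  (forall p : T, A p -> forall B, nbhs (f p) B -> \forall q \near p, A q -> B (f q)).
Proof. exact: subspace_continuousP. Qed.

Lemma inj_tile_continuous t : {within [set x | tile x], continuous (inj_tile t)}.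
Proof. by apply/within_continuousP => x tx B nB; exact: near_inj_tile nB. Qed.

Lemma glued_continuousP (T : topologicalType) (f : glued -> T) :
  continuous f <-> forall t, {within [set x | tile x], continuous (f \o inj_tile t)}.
Proof.
split=> [cf t|cf m].
  apply/within_continuousP => x tx B nB.
  exact: near_inj_tile (cf _ _ nB).
have [t [x [tx ->]]] := glued_ex m; move=> B nB.
apply/near_gluedP => // t' e.
by move/within_continuousP : (cf t') => /(_ x tx B); apply; rewrite /= e.
Qed.

Lemma fold_continuous : continuous fold.
Proof.
apply/glued_continuousP => t; apply/within_continuousP => x tx B /=.
rewrite fold_inj// => nB; apply: filterS nB => y By ty.
by rewrite /= fold_inj.
Qed.

(** Points with different images under [fold] are separated in the plane. If the images agree, [N r]
    collects points of the tiles that represent r, on no arm end missing x; two such sets can meet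
    only through an identification that already holds at x. *)
Lemma glued_hausdorff : hausdorff_space glued.
Proof.
move=> p q pq.
have [i [x [tx pE]]] := glued_ex p; have [j [y [ty qE]]] := glued_ex q.
have xy : x = y.
  apply: norm_hausdorff => A B nA nB.
  have nA' : nbhs p (fold @^-1` A).
    by apply: fold_continuous; rewrite pE fold_inj.
  have nB' : nbhs q (fold @^-1` B).
    by apply: fold_continuous; rewrite qE fold_inj.
  by have [m [? ?]] := pq _ _ nA' nB'; exists (fold m).
pose N r := [set m | exists t z, [/\ tile z, m = inj_tile t z,
   inj_tile t x = r & forall c, facet c z -> facet c x]].
have NP r k : inj_tile k x = r -> nbhs r (N r).
  move=> <-; apply/near_gluedP => // t' e.
  by apply: filterS (near_facet x) => z fz tz; exists t', z.
have Nq : nbhs q (N q) by apply: (NP _ j); rewrite qE xy.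
have [_ [[t [z [tz -> <- fz]]] [t' [z' [tz' e <- _]]]]] := pq _ _ (NP _ i (esym pE)) Nq.
have zz := inj_tile_eq tz tz' e; rewrite -{}zz in tz' e.
apply/inj_tileP => //.
by move/inj_tileP : e => /(_ tz) [->|[c cy ->]]; [left|right; exists c => //; exact: fz].
Qed.

Lemma glued_cover : [set: glued] = \bigcup_i (inj_tile i @` [set x | tile x]).
Proof.
apply/esym; rewrite -subTset => m _; have [i [x [tx ->]]] := glued_ex m.
by exists i => //; exists x.
Qed.

Lemma compact_inj_tile t : compact (inj_tile t @` [set x | tile x]).
Proof.
by apply: continuous_compact; [exact: inj_tile_continuous|exact: compact_tile].
Qed.

Lemma glued_compact : compact [set: glued].
Proof.
rewrite glued_cover -[X in bigcup X](_ : [set` enum 'I_4] = _); last first.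
  by rewrite -subTset => i _; rewrite /= mem_enum.
by rewrite bigcup_seq; apply: bigsetU_compact => i _; exact: compact_inj_tile.
Qed.

Definition facet_pt c : 'rV[R]_2 := (2 * sgn R c.2) *: delta_mx 0 c.1.

Lemma facet_pt_tile c : tile (facet_pt c).
Proof.
apply/tileP; exists c.1; rewrite !mxE !eqxx /= (negPf (rev_ord2_neq c.1)) /= mulr1 mulr0.
by case: (sgn_cases R c.2) => ->; split; lra.
Qed.

Lemma facet_ptP c : facet c (facet_pt c).
Proof. by rewrite /facet !mxE !eqxx mulr1. Qed.

Lemma connected_inj_tile i : connected (inj_tile i @` [set x | tile x]).
Proof.
apply: connected_continuous_connected (@connected_tile R) _.
exact: inj_tile_continuous.
Qed.

Lemma glued_connected : connected [set: glued].
Proof.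
have -> : [set: glued] = \bigcup_i ((inj_tile (hub g) @` [set x | tile x]) `|`
    (inj_tile i @` [set x | tile x])).
  apply/esym; rewrite -subTset => m _; have [i [x [tx ->]]] := glued_ex m.
  by exists i => //; right; exists x.
apply: bigcup_connected.
  by exists (inj_tile (hub g) 0) => i _; left; exists 0 => //; exact: tile0.
move=> i _; apply: connectedU; try exact: connected_inj_tile.
have [->|[c [<- _]]] := hubP g i.
  by exists (inj_tile (hub g) 0); split; exists 0 => //; exact: tile0.
exists (inj_tile (hub g) (facet_pt c)); split; exists (facet_pt c) => //;
  try exact: facet_pt_tile.
by apply: inj_tile_lnk; [exact: facet_pt_tile|exact: facet_ptP].
Qed.

End Glued.

(** * Half-planes and corners *)

Section HalfSpaces.
Variable R : realType.
Implicit Types (x y a : 'rV[R]_2) (P : set 'rV[R]_2) (k j : 'I_2).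

Lemma I2_sum (F : 'I_2 -> R) k : \sum_i F i = F k + F (rev_ord k).
Proof.
rewrite (bigD1 k)//= (bigD1 (rev_ord k)) ?rev_ord2_neq//= big1 ?addr0// => j.
by case/andP => jk; rewrite (I2_neq jk) eqxx.
Qed.

Lemma rev_ord0 : rev_ord (ord0 : 'I_2) = ord_max. Proof. exact/val_inj. Qed.

(* Row 0 of the new basis is the inward normal sg * e_k. *)
Definition half_mx k (sg : R) : 'M[R]_2 :=
  \matrix_(i, j) (if j == ord0 then (if i == k then sg else 0)
                  else (if i == k then 0 else 1)).

Lemma half_mx_orthogonal k sg : sg * sg = 1 -> orthogonal_mx (half_mx k sg).
Proof.
move=> s2; apply/matrixP => i j; rewrite !mxE (I2_sum _ ord0) rev_ord0 !mxE /=.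
have [e|ik] := eqVneq i k; have [e'|jk] := eqVneq j k.
- by rewrite e e' eqxx s2 /= mulr0 addr0.
- by rewrite e eq_sym (negPf jk) /= mulr0 mul0r addr0.
- by rewrite e' (negPf ik) /= mulr0 mul0r addr0.
- by rewrite (I2_neq ik) (I2_neq jk) eqxx /= mulr0 mulr1 add0r.
Qed.

Lemma height_half_mx k sg x : height (x *m half_mx k sg) = sg * x 0 k.
Proof.
rewrite /height mxE (I2_sum _ k) !mxE !eqxx (negPf (rev_ord2_neq k)).
by rewrite mulr0 addr0 mulrC.
Qed.

Lemma smooth_boundary_half P a k sg : sg * sg = 1 ->
  (\forall y \near a, P y <-> 0 <= sg * ((y : 'rV[R]_2) 0 k - a 0 k)) ->
  smooth_boundary_at P a.
Proof.
move=> s2 Pa; exists (half_mx k sg), (cst (sg * a 0 k)); split.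
- exact: half_mx_orthogonal.
- exact: smooth_near_cst.
- by rewrite height_half_mx.
- by apply: filterS Pa => y ->; rewrite height_half_mx mulrBr subr_ge0.
Qed.

Lemma smooth_boundary_piecewise P a : smooth_boundary_at P a ->
  piecewise_smooth_boundary_at P a.
Proof.
move=> [Q [h [oQ sh ha hP]]]; exists Q, h; split=> //.
exists 1%N, (fun=> h); split=> //; apply: filterS sh => x sh; split.
  by apply: differentiable_continuous; exact: (sh [::]).
by exists ord0.
Qed.

(* A 3-4-5 rotation puts a quadrant, or its complement, above a graph. *)
Definition corner_mx (s0 s1 : R) : 'M[R]_2 :=
  \matrix_(i, j) (if j == ord0 then (if i == ord0 then 3 / 5 * s0 else 4 / 5 * s1)
                  else (if i == ord0 then 4 / 5 * s0 else - (3 / 5) * s1)).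

Lemma corner_mx_orthogonal s0 s1 : s0 * s0 = 1 -> s1 * s1 = 1 ->
  orthogonal_mx (corner_mx s0 s1).
Proof.
move=> h0 h1; apply/matrixP => i j; rewrite !mxE (I2_sum _ ord0) rev_ord0 !mxE /=.
have [e|/I2_neq e] := eqVneq i ord0; have [e'|/I2_neq e'] := eqVneq j ord0;
  rewrite e e' ?rev_ord0 ?eqxx /=.
- by transitivity (s0 * s0); [field|rewrite h0].
- by rewrite mulr0n; field.
- by rewrite mulr0n; field.
- by transitivity (s1 * s1); [field|rewrite h1].
Qed.

Lemma height_corner_mx s0 s1 x : height (x *m corner_mx s0 s1) =
  3 / 5 * (s0 * x 0 ord0) + 4 / 5 * (s1 * x 0 ord_max).
Proof.
by rewrite /height mxE (I2_sum _ ord0) rev_ord0 !mxE /=; ring.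
Qed.

Lemma base_corner_mx s0 s1 x : base (x *m corner_mx s0 s1) 0 ord0 =
  4 / 5 * (s0 * x 0 ord0) - 3 / 5 * (s1 * x 0 ord_max).
Proof.
by rewrite /base mxE mxE (I2_sum _ ord0) rev_ord0 !mxE /=; ring.
Qed.

Definition affine1 (al be : R) (u : 'rV[R]_1) : R := al * u 0 ord0 + be.

Lemma smooth_affine1 al be u : smooth_near (affine1 al be) u.
Proof.
pose G (s : seq 'I_1) : 'rV[R]_1 -> R :=
  match s with [::] => affine1 al be | [:: _] => cst al | _ => cst 0 end.
have dA v : differentiable (affine1 al be) v.
  apply: differentiableD; last exact: differentiable_cst.
  by apply: differentiableZ; exact: differentiable_coord.
apply: (@smooth_near_iter _ _ setT _ G) => //.
- exact: openT.
- move=> [|i [|j s]] k v _ /=; rewrite ?derive_cst//.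
  rewrite /affine1 /derive; apply: cvg_lim => //.
  apply: (@cvg_trans _ (cst al @ (0 : R)^')); last exact: cvg_cst.
  apply: near_eq_cvg; near=> h; rewrite /= !mxE eqxx !ord1 /= mulr1.
  have h0 : h != 0 by near: h; exact: nbhs_dnbhs_neq.
  by rewrite -[_ *: _]/(_ * _); field.
- by move=> [|i [|j s]] v _ /=; [exact: dA|exact: differentiable_cst..].
Unshelve. all: by end_near. Qed.

Lemma continuous_affine1 al be : continuous (affine1 al be).
Proof.
move=> u; apply: differentiable_continuous.
exact: smooth_near_differentiable (smooth_affine1 al be u).
Qed.

Section Corner.
Variables (a : 'rV[R]_2) (s0 s1 : R).
Hypotheses (s02 : s0 * s0 = 1) (s12 : s1 * s1 = 1).
Let ta := 3 / 5 * (s0 * a 0 ord0) + 4 / 5 * (s1 * a 0 ord_max).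
Let ua := 4 / 5 * (s0 * a 0 ord0) - 3 / 5 * (s1 * a 0 ord_max).
(** In the rotated coordinates the two half-planes meeting at a are the epigraphs of lines through
    its image, of slopes -4/3 and 3/4. Their intersection lies above the maximum of the two lines,
    their union above the minimum. *)
Let h1 := affine1 (- (4 / 3)) (ta + 4 / 3 * ua).
Let h2 := affine1 (3 / 4) (ta - 3 / 4 * ua).

Let piecewise (h : 'rV[R]_1 -> R) u : continuous h ->
  (forall v, h v = h1 v \/ h v = h2 v) -> piecewise_smooth_near h u.
Proof.
move=> ch hs; exists 2, (fun i => if i == ord0 then h1 else h2); split.
  by move=> i; case: ifP => _; exact: smooth_affine1.
apply: filterE => v; split; first exact: ch.
by have [->|->] := hs v; [exists ord0|exists ord_max].
Qed.

Lemma boundary_and P :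
  (\forall y \near a, P y <-> 0 <= s0 * ((y : 'rV[R]_2) 0 ord0 - a 0 ord0) /\
     0 <= s1 * (y 0 ord_max - a 0 ord_max)) -> piecewise_smooth_boundary_at P a.
Proof.
move=> Pa; exists (corner_mx s0 s1), (fun u => Num.max (h1 u) (h2 u)); split.
- exact: corner_mx_orthogonal.
- apply: piecewise => [u|v]; last by case: leP; [right|left].
  by apply: continuous_max; exact: continuous_affine1.
- rewrite height_corner_mx /h1 /h2 /affine1 base_corner_mx -/ta -/ua.
  have -> : - (4 / 3) * ua + (ta + 4 / 3 * ua) = ta by ring.
  have -> : 3 / 4 * ua + (ta - 3 / 4 * ua) = ta by ring.
  by rewrite maxxx.
- apply: filterS Pa => y ->; rewrite height_corner_mx ge_max.
  rewrite /h1 /h2 /affine1 base_corner_mx /ta /ua !mulrBr.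
  split=> [[? ?]|/andP[? ?]]; [apply/andP|]; split; lra.
Qed.

Lemma boundary_or P :
  (\forall y \near a, P y <-> 0 <= s0 * ((y : 'rV[R]_2) 0 ord0 - a 0 ord0) \/
     0 <= s1 * (y 0 ord_max - a 0 ord_max)) -> piecewise_smooth_boundary_at P a.
Proof.
move=> Pa; exists (corner_mx s0 s1), (fun u => Num.min (h1 u) (h2 u)); split.
- exact: corner_mx_orthogonal.
- apply: piecewise => [u|v]; last by case: leP; [left|right].
  by apply: continuous_min; exact: continuous_affine1.
- rewrite height_corner_mx /h1 /h2 /affine1 base_corner_mx -/ta -/ua.
  have -> : - (4 / 3) * ua + (ta + 4 / 3 * ua) = ta by ring.
  have -> : 3 / 4 * ua + (ta - 3 / 4 * ua) = ta by ring.
  by rewrite minxx.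
- apply: filterS Pa => y ->; rewrite height_corner_mx ge_min.
  rewrite /h1 /h2 /affine1 base_corner_mx /ta /ua !mulrBr.
  by split=> [[?|?]|/orP[?|?]]; [apply/orP; left|apply/orP; right|left|right]; lra.
Qed.

End Corner.

End HalfSpaces.

(** * Local shapes of the tile and of two tiles glued along an arm end *)

Section Shapes.
Variable R : realType.
Implicit Types (x y z a : 'rV[R]_2) (P : set 'rV[R]_2) (k j : 'I_2)
  (c d : 'I_2 * bool).

Definition half_at k (sg : R) P a := sg * sg = 1 /\
  \forall y \near a, P y <-> 0 <= sg * ((y : 'rV[R]_2) 0 k - a 0 k).

(** [ShapeOr] is the three-quadrant germ at a reentrant corner of the cross, [ShapeAnd] the quadrant
    at a corner of an arm end. Recording signs rather than epigraphs makes the germs easy to carry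
    through a reflection. *)
Variant local_shape P a : Prop :=
| ShapeInterior of (\forall y \near a, P y)
| ShapeHalf k sg of half_at k sg P a
| ShapeAnd s0 s1 of s0 * s0 = 1 & s1 * s1 = 1 &
   \forall y \near a, P y <-> 0 <= s0 * ((y : 'rV[R]_2) 0 ord0 - a 0 ord0) /\
     0 <= s1 * (y 0 ord_max - a 0 ord_max)
| ShapeOr s0 s1 of s0 * s0 = 1 & s1 * s1 = 1 &
   \forall y \near a, P y <-> 0 <= s0 * ((y : 'rV[R]_2) 0 ord0 - a 0 ord0) \/
     0 <= s1 * (y 0 ord_max - a 0 ord_max).

Lemma shape_boundary P a : local_shape P a ->
  interior P a \/ piecewise_smooth_boundary_at P a.
Proof.
case=> [|k sg [s2 Pa]|s0 s1 h0 h1 Pa|s0 s1 h0 h1 Pa]; [by left|right..].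
- exact/smooth_boundary_piecewise/(smooth_boundary_half s2 Pa).
- exact: boundary_and Pa.
- exact: boundary_or Pa.
Qed.

Lemma half_at_ext k sg P P' a : (\forall y \near a, P y <-> P' y) ->
  half_at k sg P a -> half_at k sg P' a.
Proof.
by move=> PP' [s2 H]; split=> //; apply: filterS2 PP' H => y <-.
Qed.

Lemma shape_ext P P' a : (\forall y \near a, P y <-> P' y) ->
  local_shape P a -> local_shape P' a.
Proof.
move=> PP'; case=> [H|k sg H|s0 s1 h0 h1 H|s0 s1 h0 h1 H].
- by apply: ShapeInterior; apply: filterS2 PP' H => y <-.
- exact: ShapeHalf (half_at_ext PP' H).
- by apply: (ShapeAnd h0 h1); apply: filterS2 PP' H => y <-.
- by apply: (ShapeOr h0 h1); apply: filterS2 PP' H => y <-.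
Qed.

Lemma flipE c x j : flip c x 0 j =
  if j == c.1 then 2 * (2 * sgn R c.2) - x 0 c.1 else x 0 j.
Proof. exact: mirrorE. Qed.

Lemma flipK c : involutive (@flip R c).
Proof. exact: mirrorK. Qed.

Lemma flip_fix c x : facet c x -> flip c x = x.
Proof. by move=> /eqP; exact: mirror_fix. Qed.

Lemma continuous_flip c : continuous (@flip R c).
Proof. exact: continuous_mirror. Qed.

Lemma near_flip c x (Q : 'rV[R]_2 -> Prop) : (\forall y \near x, Q y) ->
  \forall z \near flip c x, Q (flip c z).
Proof.
move=> Qx; have cf : flip c y @[y --> flip c x] --> x.
  by rewrite -[in X in _ --> X](flipK c x); exact: continuous_flip.
exact: cf Qx.
Qed.

Let eps c j : R := if j == c.1 then -1 else 1.

Let eps2 c j : eps c j * eps c j = 1.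
Proof. by rewrite /eps; case: ifP => _; ring. Qed.

Let flipB c x z j : flip c z 0 j - x 0 j = eps c j * (z 0 j - flip c x 0 j).
Proof. by rewrite !flipE /eps; case: eqP => [->|_]; ring. Qed.

Let mul_eps c j (s : R) : s * s = 1 -> s * eps c j * (s * eps c j) = 1.
Proof. by move=> s2; rewrite mulrACA s2 eps2 mul1r. Qed.

Lemma half_at_flip k sg P c x : half_at k sg P x ->
  exists sg', half_at k sg' (P \o flip c) (flip c x).
Proof.
move=> [s2 H]; exists (sg * eps c k); split; first exact: mul_eps.
by apply: filterS (near_flip c H) => z /=; rewrite flipB mulrA.
Qed.

Lemma shape_flip P c x : local_shape P x -> local_shape (P \o flip c) (flip c x).
Proof.
case=> [H|k sg /(half_at_flip c)[sg' H]|s0 s1 h0 h1 H|s0 s1 h0 h1 H].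
- by apply: ShapeInterior; exact: near_flip H.
- exact: ShapeHalf H.
- apply: (ShapeAnd (mul_eps c ord0 h0) (mul_eps c ord_max h1)).
  by apply: filterS (near_flip c H) => z /=; rewrite !flipB !mulrA.
- apply: (ShapeOr (mul_eps c ord0 h0) (mul_eps c ord_max h1)).
  by apply: filterS (near_flip c H) => z /=; rewrite !flipB !mulrA.
Qed.

Lemma smooth_boundary_half_at k sg P a : half_at k sg P a ->
  smooth_boundary_at P a.
Proof. by move=> [s2 /(smooth_boundary_half s2)]. Qed.

Definition inner x := exists k,
  [/\ -2 < x 0 k, x 0 k < 2, -1 < x 0 (rev_ord k) & x 0 (rev_ord k) < 1].

Definition open_facet c x :=
  [/\ x 0 c.1 = 2 * sgn R c.2, -1 < x 0 (rev_ord c.1) & x 0 (rev_ord c.1) < 1].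

(* The free edge next to the facet c, on the side b. *)
Definition edge c b x := [/\ 1 < sgn R c.2 * x 0 c.1, sgn R c.2 * x 0 c.1 < 2 &
  x 0 (rev_ord c.1) = sgn R b].

Definition corner c b x :=
  x 0 c.1 = 2 * sgn R c.2 /\ x 0 (rev_ord c.1) = sgn R b.

Definition reentrant b0 b1 x := x 0 ord0 = sgn R b0 /\ x 0 ord_max = sgn R b1.

Lemma tileE k x : tile x <->
  [/\ -2 <= x 0 k, x 0 k <= 2, -1 <= x 0 (rev_ord k) & x 0 (rev_ord k) <= 1] \/
  [/\ -2 <= x 0 (rev_ord k), x 0 (rev_ord k) <= 2, -1 <= x 0 k & x 0 k <= 1].
Proof.
split=> [/tileP[j H]|[H|H]]; last 2 first.
- by apply/tileP; exists k.
- by apply/tileP; exists (rev_ord k); rewrite rev_ordK.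
have [e|/I2_neq e] := eqVneq j k; first by left; rewrite -e.
by right; rewrite e rev_ordK in H.
Qed.

Lemma inner_tile x : inner x -> tile x.
Proof. by move=> [k [? ? ? ?]]; apply/(tileE k); left; split; lra. Qed.

Lemma open_facet_facet c x : open_facet c x -> facet c x.
Proof. by move=> [xc _ _]; apply/eqP. Qed.

Lemma open_facet_tile c x : open_facet c x -> tile x.
Proof.
move=> [e ? ?]; apply/(tileE c.1); left; rewrite e.
by case: (sgn_cases R c.2) => ->; split; lra.
Qed.

Lemma edge_tile c b x : edge c b x -> tile x.
Proof.
move=> [h1 h2 e]; apply/(tileE c.1); left; rewrite e; move: h1 h2.
by case: (sgn_cases R c.2) => ->; case: (sgn_cases R b) => ->; split; lra.
Qed.

Lemma sgn_ex (r : R) : exists b, 0 <= sgn R b * r.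
Proof.
have [r0|/ltW r0] := leP 0 r; first by exists false; rewrite /sgn expr0 mul1r.
by exists true; rewrite /sgn expr1 mulN1r oppr_ge0.
Qed.

Lemma sgn_solve b (r u : R) : sgn R b * r = u -> r = u * sgn R b.
Proof. by move=> <-; rewrite mulrAC sgn2 mul1r. Qed.

Lemma tile_cases x : tile x -> inner x \/ (exists c, open_facet c x) \/
  (exists c b, edge c b x) \/ (exists c b, corner c b x) \/
  (exists b0 b1, reentrant b0 b1 x).
Proof.
move=> /tileP[k [h1 h2 h3 h4]].
have [b hb] := sgn_ex (x 0 k); have [b' hb'] := sgn_ex (x 0 (rev_ord k)).
have u2 : sgn R b * x 0 k <= 2 by case: (sgn_cases R b) => ->; lra.
have u1 : sgn R b' * x 0 (rev_ord k) <= 1 by case: (sgn_cases R b') => ->; lra.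
have [lt1|e1] : sgn R b' * x 0 (rev_ord k) < 1 \/ sgn R b' * x 0 (rev_ord k) = 1.
  by have [?|?|?] := ltrgtP (sgn R b' * x 0 (rev_ord k)) 1; [left|exfalso; lra|right].
  have [lt2|e2] : sgn R b * x 0 k < 2 \/ sgn R b * x 0 k = 2.
    by have [?|?|?] := ltrgtP (sgn R b * x 0 k) 2; [left|exfalso; lra|right].
    left; exists k; move: hb hb' lt1 lt2.
    by case: (sgn_cases R b) => ->; case: (sgn_cases R b') => ->; split; lra.
  right; left; exists (k, b); split=> /=; first exact: sgn_solve.
    by move: hb' lt1; case: (sgn_cases R b') => ->; lra.
  by move: hb' lt1; case: (sgn_cases R b') => ->; lra.
have {}e1 : x 0 (rev_ord k) = sgn R b' by rewrite (sgn_solve e1) mul1r.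
(* On a long side of the rectangle k, the absolute value of [x 0 k] decides: below 1 the other
   rectangle covers x, above 1 the point is on a free edge or at its outer end, and at 1 it is a
   reentrant corner. *)
have [lt2|gt2|e2] := ltrgtP (sgn R b * x 0 k) 1.
- left; exists (rev_ord k); rewrite rev_ordK e1; move: hb lt2.
  by case: (sgn_cases R b) => ->; case: (sgn_cases R b') => ->; split; lra.
- right; right; have [lt3|e3] : sgn R b * x 0 k < 2 \/ sgn R b * x 0 k = 2.
    by have [?|?|?] := ltrgtP (sgn R b * x 0 k) 2; [left|exfalso; lra|right].
    by left; exists (k, b), b'.
  by right; left; exists (k, b), b'; split=> //=; exact: sgn_solve.
- have {}e2 : x 0 k = sgn R b by rewrite (sgn_solve e2) mul1r.
  do 4 right; have [k0|/I2_neq k0] := eqVneq k ord0.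
    by exists b, b'; split; [rewrite -k0|rewrite -rev_ord0 -k0].
  exists b', b; split; last by rewrite -rev_ord0 -k0.
  by rewrite -e1 k0 rev_ordK.
Qed.

Lemma near_inner x : inner x -> \forall y \near x, inner y.
Proof.
move=> [k [h1 h2 h3 h4]]; apply: filterS2 (near_coord h1 h2) (near_coord h3 h4).
by move=> y [? ?] [? ?]; exists k; split.
Qed.

Let near_box x k (e : R) : 0 < e -> \forall y \near x,
  (x 0 k - e < (y : 'rV[R]_2) 0 k /\ y 0 k < x 0 k + e) /\
  (x 0 (rev_ord k) - e < y 0 (rev_ord k) /\ y 0 (rev_ord k) < x 0 (rev_ord k) + e).
Proof.
move=> e0; have H j : \forall y \near x, x 0 j - e < (y : 'rV[R]_2) 0 j /\ y 0 j < x 0 j + e.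
  by apply: near_coord; [rewrite ltrBlDr ltrDl|rewrite ltrDl].
by apply: filterS2 (H k) (H (rev_ord k)) => y.
Qed.

Lemma near_open_facet c x : open_facet c x ->
  half_at c.1 (- sgn R c.2) (fun y => tile y) x.
Proof.
move=> [e h1 h2]; split; first by rewrite mulrNN sgn2.
apply: filterS2 (near_box x c.1 ltr01) (near_coord h1 h2) => y [[a1 a2] _] [b1 b2].
rewrite e in a1 a2 *; move: a1 a2; split=> [ty|H].
  by have [] := tile_bound c.1 ty; case: (sgn_cases R c.2) => ->; lra.
apply/(tileE c.1); left; move: a1 a2 H b1 b2.
by case: (sgn_cases R c.2) => ->; split; lra.
Qed.

Lemma near_edge c b x : edge c b x ->
  half_at (rev_ord c.1) (- sgn R b) (fun y => tile y) x.
Proof.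
move=> [h1 h2 e]; split; first by rewrite mulrNN sgn2.
have H : \forall y \near x, 1 < sgn R c.2 * (y : 'rV[R]_2) 0 c.1 /\ sgn R c.2 * y 0 c.1 < 2.
  move: h1 h2; case: (sgn_cases R c.2) => -> h1 h2.
    by apply: filterS (near_coord (a := 1) (b := 2) (j := c.1) (x := x) _ _) => [y||]; lra.
  by apply: filterS (near_coord (a := -2) (b := -1) (j := c.1) (x := x) _ _) => [y||]; lra.
apply: filterS2 (near_box x c.1 ltr01) H => y [_ [a1 a2]] [b1 b2].
rewrite e in a1 a2 *; split=> [/(tileE c.1)[]|H1].
- by move=> [_ _]; case: (sgn_cases R b) => ->; lra.
- move=> [_ _]; move: b1; case: (sgn_cases R c.2) => ->; lra.
apply/(tileE c.1); left; move: a1 a2 b1 b2 H1.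
by case: (sgn_cases R c.2) => ->; case: (sgn_cases R b) => ->; split; lra.
Qed.

Lemma near_corner c b x : corner c b x -> \forall y \near x,
  tile y <-> 0 <= - sgn R c.2 * ((y : 'rV[R]_2) 0 c.1 - x 0 c.1) /\
    0 <= - sgn R b * (y 0 (rev_ord c.1) - x 0 (rev_ord c.1)).
Proof.
move=> [e e']; apply: filterS (near_box x c.1 (e := 1/2) _); last lra.
move=> y [[a1 a2] [b1 b2]]; rewrite e e' in a1 a2 b1 b2 *.
split=> [/(tileE c.1)[]|[H1 H2]].
- move=> [? ? ? ?]; move: a1 a2 b1 b2.
  by case: (sgn_cases R c.2) => ->; case: (sgn_cases R b) => ->; split; lra.
- move=> [? ? ? ?]; exfalso; move: a1 a2 b1 b2.
  by case: (sgn_cases R c.2) => ->; case: (sgn_cases R b) => ->; lra.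
apply/(tileE c.1); left; move: a1 a2 b1 b2 H1 H2.
by case: (sgn_cases R c.2) => ->; case: (sgn_cases R b) => ->; split; lra.
Qed.

Lemma near_reentrant b0 b1 x : reentrant b0 b1 x -> \forall y \near x,
  tile y <-> 0 <= - sgn R b0 * ((y : 'rV[R]_2) 0 ord0 - x 0 ord0) \/
    0 <= - sgn R b1 * (y 0 ord_max - x 0 ord_max).
Proof.
move=> [e e']; apply: filterS (near_box x ord0 (e := 1/2) _); last lra.
move=> y [[a1 a2] [b1' b2]]; rewrite rev_ord0 e e' in a1 a2 b1' b2 *.
split=> [/(tileE ord0)[]|]; rewrite ?rev_ord0.
- by move=> [? ? ? ?]; right; case: (sgn_cases R b1) => ->; lra.
- by move=> [? ? ? ?]; left; case: (sgn_cases R b0) => ->; lra.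
move: a1 a2 b1' b2.
case: (sgn_cases R b0) => ->; case: (sgn_cases R b1) => -> a1 a2 b1' b2 [H|H];
  apply/(tileE ord0); rewrite ?rev_ord0; (right; split; lra) || (left; split; lra).
Qed.

Lemma tile_shape x : tile x -> local_shape (fun y => tile y) x.
Proof.
move=> /tile_cases[/near_inner H|[[c /near_open_facet H]|[[c [b /near_edge H]]|
  [[c [b H]]|[b0 [b1 /near_reentrant H]]]]]].
- by apply: ShapeInterior; apply: filterS H => y /inner_tile.
- exact: ShapeHalf H.
- exact: ShapeHalf H.
- have H' := near_corner H; have [c0|/I2_neq c0] := eqVneq c.1 ord0.
    apply: (ShapeAnd (s0 := - sgn R c.2) (s1 := - sgn R b)); rewrite ?mulrNN ?sgn2//.
    by rewrite c0 rev_ord0 in H'.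
  apply: (ShapeAnd (s0 := - sgn R b) (s1 := - sgn R c.2)); rewrite ?mulrNN ?sgn2//.
  rewrite c0 rev_ordK rev_ord0 in H'; apply: filterS H' => y ->.
  by split=> -[].
- by apply: (ShapeOr (s0 := - sgn R b0) (s1 := - sgn R b1)); rewrite ?mulrNN ?sgn2.
Qed.

Lemma near_glue_open c x : open_facet c x ->
  \forall y \near x, tile y \/ tile (flip c y).
Proof.
move=> fx; have [_ H] := near_open_facet fx; have xE := flip_fix (open_facet_facet fx).
have := near_flip c H; rewrite xE => H'; apply: filterS2 H H' => y.
rewrite flipE eqxx; case: fx => -> _ _ -> ->.
have [h|h] := leP 0 (- sgn R c.2 * (y 0 c.1 - 2 * sgn R c.2)); [by left|right].
by move: h; case: (sgn_cases R c.2) => ->; lra.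
Qed.

(** Two quadrants that mirror each other across the arm end form a half-plane: the gluing flattens
    the corner. *)
Lemma near_glue_corner c b x : corner c b x ->
  half_at (rev_ord c.1) (- sgn R b) (fun y => tile y \/ tile (flip c y)) x.
Proof.
move=> fx; split; first by rewrite mulrNN sgn2.
have H := near_corner fx; case: (fx) => e e'.
have xE : flip c x = x by apply: flip_fix; apply/eqP.
have := near_flip c H; rewrite xE => H'; apply: filterS2 H H' => y -> ->.
rewrite !flipE eqxx (negPf (rev_ord2_neq c.1)) e.
split=> [[[]//|[]//]|h].
have [h1|h1] := leP 0 (- sgn R c.2 * (y 0 c.1 - 2 * sgn R c.2)); [by left|right].
by split=> //; move: h1; case: (sgn_cases R c.2) => ->; lra.
Qed.

Lemma glue_shape c x : tile x -> facet c x ->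
  local_shape (fun y => tile y \/ tile (flip c y)) x.
Proof.
move=> tx cx; have [h1 h2] := facet_other tx cx.
have [b hb] := sgn_ex (x 0 (rev_ord c.1)).
have [lt1|e1] : sgn R b * x 0 (rev_ord c.1) < 1 \/ sgn R b * x 0 (rev_ord c.1) = 1.
  have [?|h3|?] := ltrgtP (sgn R b * x 0 (rev_ord c.1)) 1; [by left| |by right].
  by exfalso; move: hb h1 h2 h3; case: (sgn_cases R b) => ->; lra.
  apply: ShapeInterior; apply: near_glue_open; split; first exact/eqP.
    by move: hb lt1; case: (sgn_cases R b) => ->; lra.
  by move: hb lt1; case: (sgn_cases R b) => ->; lra.
have fx : corner c b x by split; [exact/eqP|rewrite (sgn_solve e1) mul1r].
exact: ShapeHalf (near_glue_corner fx).
Qed.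

(** Stretching from the centre: if (1 + h) x is still in the tile for some h > 0, then the bounds
    satisfied by x are strict. *)
Lemma near_tile_inner x : (\forall y \near x, tile y) -> inner x.
Proof.
move=> /(near_line x) /near0_ex_pos[h h0 /tileP[k]].
by rewrite !mxE => -[? ? ? ?]; exists k; split; nra.
Qed.

(** The same stretching along the arm end only, so that the moved point stays fixed by [flip c] and
    both alternatives place it in the tile. *)
Lemma near_glue_inner c x : facet c x ->
  (\forall y \near x, tile y \/ tile (flip c y)) -> open_facet c x.
Proof.
move=> cx /(near_line (x 0 (rev_ord c.1) *: delta_mx 0 (rev_ord c.1))).
move=> /near0_ex_pos[h h0]; set y := _ + x => H.
have yc : facet c y.
  rewrite /facet !mxE (negPf (_ : c.1 != rev_ord c.1)) ?andbF ?mulr0 ?add0r//.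
  by rewrite eq_sym rev_ord2_neq.
have ty : tile y by case: H; rewrite ?flip_fix.
have [] := facet_other ty yc; rewrite !mxE !eqxx /= => h1 h2.
by split; [exact/eqP|nra|nra].
Qed.

(** The tile lies on one side of the line carrying the arm end, so it meets its mirror image on that
    line only. Unfolding two neighbours is therefore injective. *)
Lemma tile_flip_facet c x : tile x -> tile (flip c x) -> facet c x.
Proof.
move=> /(tile_bound c.1)[? ?] /(tile_bound c.1); rewrite flipE eqxx => -[h1 h2].
apply/eqP; move: h1 h2; by case: (sgn_cases R c.2) => -> ? ?; lra.
Qed.

Lemma near_tile_open_facet c x : open_facet c x -> \forall y \near x, tile y ->
  open_facet c y \/ inner y.
Proof.
move=> [e h1 h2]; apply: filterS2 (near_box x c.1 ltr01) (near_coord h1 h2).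
move=> y [[a1 a2] _] [b1 b2] ty; rewrite e in a1 a2.
have [] := tile_bound c.1 ty => u1 u2.
have [yc|yc] := eqVneq (y 0 c.1) (2 * sgn R c.2); first by left.
right; exists c.1; split=> //.
  by move: yc a1 a2; case: (sgn_cases R c.2) => -> /eqP; lra.
by move: yc a1 a2; case: (sgn_cases R c.2) => -> /eqP; lra.
Qed.

Lemma near_tile_edge c b x : edge c b x -> \forall y \near x, tile y ->
  edge c b y \/ inner y.
Proof.
move=> ex; have [_ H] := near_edge ex; move: ex => [h1 h2 e].
have Hn : \forall y \near x, 1 < sgn R c.2 * (y : 'rV[R]_2) 0 c.1 /\ sgn R c.2 * y 0 c.1 < 2.
  move: h1 h2; case: (sgn_cases R c.2) => -> h1 h2.
    by apply: filterS (near_coord (a := 1) (b := 2) (j := c.1) (x := x) _ _) => [y||]; lra.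
  by apply: filterS (near_coord (a := -2) (b := -1) (j := c.1) (x := x) _ _) => [y||]; lra.
apply: filterS3 (near_box x c.1 ltr01) Hn H => y [_ [a1 a2]] [b1 b2] ty /ty.
rewrite e in a1 a2 * => H1.
have [yc|/eqP yc] := eqVneq (y 0 (rev_ord c.1)) (sgn R b); first by left.
right; exists c.1; move: a1 a2 b1 b2 H1 yc.
case: (sgn_cases R c.2) => ->; case: (sgn_cases R b) => -> a1 a2 b1 b2 H1 yc; split; lra.
Qed.

End Shapes.

(** * Charts *)

Section Charts.
Variables (R : realType) (g : tile_graph).
Local Notation M := (glued R g).
Implicit Types (x y z a : 'rV[R]_2) (i t : 'I_4) (c d : 'I_2 * bool) (m : M).

Lemma glued_repr m : tile (fold m) /\ inj_tile g (val m).1 (fold m) = m.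
Proof.
case: m => -[i x] /= e; split; last by apply/val_inj; rewrite /= (eqP e).
rewrite /fold /=; have [//|tx] := boolP (tile x).
by move/eqP: e; rewrite /norm_pt /= (negPf tx) => -[_ xE]; rewrite -xE tile0 in tx.
Qed.

Lemma class_predP (p : 'I_4 -> 'rV[R]_2 -> Prop) t x :
  (forall t t' x, tile x -> inj_tile g t x = inj_tile g t' x -> p t x -> p t' x) ->
  tile x -> p (val (inj_tile g t x)).1 (fold (inj_tile g t x)) <-> p t x.
Proof.
move=> pc tx; have [tf] := glued_repr (inj_tile g t x).
rewrite fold_inj// in tf * => e; split; apply: pc => //.
Qed.

(** Unfolding: a chart draws the tile i as it is and its neighbour across c mirrored. *)
Definition loc i c t x : 'rV[R]_2 := if t == i then x else flip c x.

(* x lies on no arm end along which the tile t is glued, except possibly c. *)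
Definition clear c t x := forall d, facet d x -> d = c \/ lnk g d t = t.

(** A chart covers i and its neighbour across c, without the other arm ends along which they are
    glued further. Unglued arm ends are kept, as boundary. *)
Definition in_chart i c t x := clear c t x /\ (t = i \/ t = lnk g c i).

Lemma in_chart_class i c t t' x : tile x ->
  inj_tile g t x = inj_tile g t' x -> in_chart i c t x -> in_chart i c t' x.
Proof.
move=> tx /inj_tileP => /(_ tx) [<-//|[d dx ->]] [cl ti].
have [dc|e] := cl d dx; last by rewrite e.
rewrite dc in dx *; split; last by case: ti => ->; [right|left; rewrite lnkK].
by move=> d' d'x; left; exact: facet_uniq d'x dx.
Qed.

Definition gdom i c : set M := [set m | in_chart i c (val m).1 (fold m)].

Lemma gdomP i c t x : tile x -> gdom i c (inj_tile g t x) <-> in_chart i c t x.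
Proof. by move=> tx; apply: class_predP => //; exact: in_chart_class. Qed.

Lemma loc_continuous i c t : continuous (loc i c t).
Proof.
by move=> x; rewrite /loc; case: eqP => _; [exact: cvg_id|exact: continuous_flip].
Qed.

Lemma locK i c t : involutive (loc i c t).
Proof. by move=> x; rewrite /loc; case: eqP => // _; exact: flipK. Qed.

Lemma loc_fix i c t x : facet c x -> loc i c t x = x.
Proof. by move=> cx; rewrite /loc flip_fix//; case: ifP. Qed.

Lemma near_loc i c t x (Q : 'rV[R]_2 -> Prop) : (\forall y \near x, Q y) ->
  \forall z \near loc i c t x, Q (loc i c t z).
Proof. by rewrite /loc; case: eqP => // _; exact: near_flip. Qed.

Section Chart.
Variables (i : 'I_4) (c : 'I_2 * bool).
Hypothesis ic : lnk g c i != i.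

(** The test asks whether m has a representative in the tile i. On the arm end c both branches
    agree, since [flip c] fixes it. *)
Definition gmap m : 'rV[R]_2 :=
  if m == inj_tile g i (fold m) then fold m else flip c (fold m).

Definition ginv y : M :=
  if tile y then inj_tile g i y else inj_tile g (lnk g c i) (flip c y).

Lemma gmapE t x : tile x -> in_chart i c t x -> gmap (inj_tile g t x) = loc i c t x.
Proof.
move=> tx [cl ti]; rewrite /gmap fold_inj// /loc.
have [->|nti] := eqVneq t i; first by rewrite eqxx.
case: eqP => // /inj_tileP => /(_ tx) [e|[d dx e]]; first by rewrite e eqxx in nti.
have [dc|dt] := cl d dx; first by rewrite -dc flip_fix.
by rewrite e dt eqxx in nti.
Qed.

Lemma ginvE t x : tile x -> t = i \/ t = lnk g c i ->
  ginv (loc i c t x) = inj_tile g t x.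
Proof.
move=> tx; rewrite /ginv /loc.
have [-> _|nti [e|e]] := eqVneq t i; first by rewrite tx.
  by rewrite e eqxx in nti.
rewrite e flipK; case: ifP => // tfx.
by have cx := tile_flip_facet tx tfx; rewrite flip_fix// inj_tile_lnk.
Qed.

Lemma gimageP z : (gmap @` gdom i c) z <->
  (tile z /\ clear c i z) \/ (tile (flip c z) /\ clear c (lnk g c i) (flip c z)).
Proof.
split=> [[m]|[] [tz cl]].
- have [t [x [tx ->]]] := glued_ex m; move=> /(gdomP _ _ _ tx) mi <-.
  rewrite (gmapE tx mi) /loc; case: mi => cl ti.
  have [e|nti] := eqVneq t i; first by left; rewrite -e.
  right; rewrite flipK; split=> //.
  by case: ti => e; [rewrite e eqxx in nti|rewrite -e].
- exists (inj_tile g i z); first by apply/gdomP => //; split=> //; left.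
  by rewrite gmapE// /loc ?eqxx//; split=> //; left.
- have h : in_chart i c (lnk g c i) (flip c z) by split=> //; right.
  exists (inj_tile g (lnk g c i) (flip c z)); first by apply/gdomP.
  by rewrite gmapE// /loc (negPf ic) flipK.
Qed.

Lemma near_clear t x : clear c t x -> \forall y \near x, clear c t y.
Proof. by move=> cl; apply: filterS (near_facet x) => y H d /H /cl. Qed.

Lemma near_gimage t x : tile x -> in_chart i c t x ->
  \forall z \near loc i c t x, (gmap @` gdom i c) z <->
    if facet c x then tile z \/ tile (flip c z) else tile (loc i c t z).
Proof.
move=> tx [cl ti]; have [cx|/negPf cx] := boolP (facet c x).
  have fx := flip_fix cx; rewrite loc_fix//.
  have H : \forall z \near x, forall t', clear c t' z.
    apply: filterS (near_facet x) => z H t' d dz; left.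
    exact: facet_uniq tx (H d dz) cx.
  have := near_flip c H; rewrite fx => H'.
  apply: filterS2 H H' => z h h'; split=> [/gimageP[[? _]|[? _]]|]; [by left|by right|].
  by move=> [?|?]; apply/gimageP; [left|right].
have ntx : ~~ tile (flip c x).
  by apply/negP => /(tile_flip_facet tx); rewrite cx.
case: ti => ti; subst t.
  rewrite /loc eqxx; have := near_flip c (near_not_tile ntx); rewrite flipK => H.
  apply: filterS2 H (near_clear cl) => z h hc.
  split=> [/gimageP[[]|[]]//|tz]; first by rewrite (negPf h).
  by apply/gimageP; left.
rewrite /loc (negPf ic).
apply: filterS2 (near_not_tile ntx) (near_flip c (near_clear cl)) => z h hc.
split=> [/gimageP[[]|[]]//|tz]; first by rewrite (negPf h).
by apply/gimageP; right.
Qed.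

Lemma gdom_open : open (gdom i c).
Proof.
rewrite openE => m mi; have [t [x [tx mE]]] := glued_ex m; subst m.
move/(gdomP _ _ _ tx) : mi => mi; apply/near_gluedP => // t' e.
have [cl ti] := in_chart_class tx (esym e) mi.
by apply: filterS (near_clear cl) => y cly ty; apply/gdomP.
Qed.

Lemma gmap_continuous : {within gdom i c, continuous gmap}.
Proof.
apply/within_continuousP => m mi B nB.
have [t [x [tx mE]]] := glued_ex m; subst m.
move/(gdomP _ _ _ tx) : mi => mi; apply/near_gluedP => // t' e.
have mi' := in_chart_class tx (esym e) mi.
have nB' : nbhs (loc i c t' x) B by rewrite -(gmapE tx mi') e.
have {}nB' : \forall y \near x, B (loc i c t' y) by exact: loc_continuous nB'.
apply: filterS nB' => y By ty /(gdomP _ _ _ ty) yi.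
by rewrite gmapE.
Qed.

Lemma gmapK m : gdom i c m -> ginv (gmap m) = m.
Proof.
have [t [x [tx ->]]] := glued_ex m; move=> /(gdomP _ _ _ tx) mi.
by rewrite gmapE// ginvE//; case: mi.
Qed.

Lemma ginv_continuous : {within gmap @` gdom i c, continuous ginv}.
Proof.
apply/within_continuousP => y yI B nB.
have H1 : \forall z \near y, tile z -> B (inj_tile g i z).
  have [ty|ty] := boolP (tile y); last first.
    by apply: filterS (near_not_tile ty) => z /negPf ->.
  by apply: near_inj_tile => //; move: nB; rewrite /ginv ty.
have H2 : \forall z \near y, tile (flip c z) -> B (inj_tile g (lnk g c i) (flip c z)).
  have [ty|ty] := boolP (tile (flip c y)); last first.
    have := near_flip c (near_not_tile ty); rewrite flipK.
    by apply: filterS => z /negPf ->.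
  have e : ginv y = inj_tile g (lnk g c i) (flip c y).
    by rewrite -ginvE//; [rewrite /loc (negPf ic) flipK|right].
  rewrite e in nB; have := near_flip c (near_inj_tile ty nB).
  by rewrite flipK.
apply: filterS2 H1 H2 => z h1 h2 /gimageP zI; rewrite /ginv.
case: ifP => [/h1//|tz]; apply: h2.
by case: zI => -[]//; rewrite tz.
Qed.

Lemma gimage_shape t x : tile x -> in_chart i c t x ->
  local_shape (gmap @` gdom i c) (loc i c t x).
Proof.
move=> tx mi; apply: (@shape_ext _ (fun z => if facet c x then
    tile z \/ tile (flip c z) else tile (loc i c t z) : Prop)).
  by apply: filterS (near_gimage tx mi) => z ->.
have [cx|cx] := boolP (facet c x); first by rewrite loc_fix//; exact: glue_shape.
rewrite /loc; case: eqP => _; first exact: tile_shape.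
exact: (@shape_flip _ (fun y => tile y) c x (tile_shape tx)).
Qed.

Lemma gimage_boundary m : gdom i c m -> interior (gmap @` gdom i c) (gmap m) \/
  piecewise_smooth_boundary_at (gmap @` gdom i c) (gmap m).
Proof.
have [t [x [tx ->]]] := glued_ex m; move=> /(gdomP _ _ _ tx) mi.
by rewrite gmapE//; apply: shape_boundary; exact: gimage_shape.
Qed.

Definition gchart : chart R 0 M := Chart gdom_open gmap_continuous
  ginv_continuous gmapK gimage_boundary.

End Chart.

(** Charts come from glued pairs only; every tile has a neighbour because of the hub, so no chart
    for a single tile has to be added. *)
Definition gatlas : set (chart R 0 M) :=
  [set ch | exists i c (h : lnk g c i != i), ch = gchart h].

Lemma linked_tile t : exists c, lnk g c t != t.
Proof.
have [->|[c [e nh]]] := hubP g t.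
  have [j jh] : exists j, j != hub g.
    by have [e|] := eqVneq ord0 (hub g); [exists ord_max; rewrite -e|exists ord0].
  have [e|[c [e _]]] := hubP g j; first by rewrite e eqxx in jh.
  by exists c; rewrite e.
by exists c; rewrite -e lnkK e eq_sym.
Qed.

Lemma in_chart_ex t x : tile x -> exists c, lnk g c t != t /\ in_chart t c t x.
Proof.
move=> tx; have [c0 c0t] := linked_tile t.
(* If x lies on a glued arm end, the chart has to unfold across that end; otherwise any glued end of
   t will do. *)
have [[c [cx ct]]|H] := pselect (exists c, facet c x /\ lnk g c t != t).
  exists c; split=> //; split; last by left.
  by move=> d dx; left; exact: facet_uniq dx cx.
exists c0; split=> //; split; last by left.
move=> d dx; right; apply/eqP; apply: contrapT => /negP nd.
by apply: H; exists d.
Qed.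

Lemma gatlas_cover m : exists2 ch, gatlas ch & cdom ch m.
Proof.
have [t [x [tx ->]]] := glued_ex m; have [c [h mi]] := in_chart_ex t tx.
by exists (gchart h); [exists t, c, h|apply/gdomP].
Qed.

End Charts.

(** * The flat manifold *)

Section Manifold.
Variables (R : realType) (g : tile_graph).
Local Notation M := (glued R g).
Implicit Types (x y z a : 'rV[R]_2) (i j t : 'I_4) (c d : 'I_2 * bool) (m : M).

Definition side_sign i t : R := if t == i then 1 else -1.

Lemma side_sign2 i t : side_sign i t * side_sign i t = 1.
Proof. by rewrite /side_sign; case: ifP => _; ring. Qed.

Lemma flip_affine c : exists Q b, [/\ orthogonal_mx Q, \det Q = -1 &
  forall y : 'rV[R]_2, flip c y = y *m Q + b].
Proof.
pose e (k : 'I_2) : R := if k == c.1 then -1 else 1.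
exists (diag_mx (\row_k e k)), (\row_j if j == c.1 then 2 * (2 * sgn R c.2) else 0).
split.
- rewrite /orthogonal_mx tr_diag_mx mulmx_diag -[1%:M]diag_const_mx; congr diag_mx.
  by apply/rowP => k; rewrite !mxE /e; case: ifP => _; ring.
- rewrite det_diag (bigD1 c.1)//= mxE /e eqxx big1 ?mulr1// => k kc.
  by rewrite mxE /e (negPf kc).
- move=> y; apply/rowP => k; rewrite flipE mul_mx_diag !mxE /e.
  by case: eqP => [->|_]; ring.
Qed.

Lemma loc_affine i c t : exists Q b, [/\ orthogonal_mx Q,
  \det Q = side_sign i t & forall y : 'rV[R]_2, loc i c t y = y *m Q + b].
Proof.
rewrite /loc /side_sign; case: eqP => _; last exact: flip_affine.
exists 1%:M, 0; split; [by rewrite /orthogonal_mx trmx1 mulmx1|exact: det1|].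
by move=> y; rewrite mulmx1 addr0.
Qed.

Lemma orthogonal_mxM (Q Q' : 'M[R]_2) : orthogonal_mx Q -> orthogonal_mx Q' ->
  orthogonal_mx (Q *m Q').
Proof.
by rewrite /orthogonal_mx => h h'; rewrite trmx_mul mulmxA -(mulmxA Q) h' mulmx1.
Qed.

Lemma loc_swap i c t y : lnk g c i != i -> t = i \/ t = lnk g c i ->
  loc (lnk g c i) c t y = flip c (loc i c t y).
Proof.
move=> ic [->|->]; rewrite /loc ?eqxx; last by rewrite (negPf ic) flipK.
by rewrite eq_sym (negPf ic).
Qed.

(** Off the glued arm ends a single tile t is near x, and the transition undoes one unfolding of t
    and applies the other. On a glued arm end both charts unfold across it, so they are equal or
    differ by the reflection in it. *)
Lemma gtransition i c j d (ic : lnk g c i != i) (jd : lnk g d j != j) t x :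
  tile x -> in_chart g i c t x -> in_chart g j d t x -> exists Q b,
    [/\ orthogonal_mx Q, \det Q = side_sign i t * side_sign j t &
    \forall m \near inj_tile g t x, gmap j d m = gmap i c m *m Q + b].
Proof.
move=> tx mi mj.
suff [Q [b [hQ dQ H]]] : exists Q b, [/\ orthogonal_mx Q,
    \det Q = side_sign i t * side_sign j t &
    forall t', inj_tile g t' x = inj_tile g t x ->
      forall y, loc j d t' y = loc i c t' y *m Q + b].
  exists Q, b; split=> //; apply/near_gluedP => // t' e.
  have [cli ti] := in_chart_class tx (esym e) mi.
  have [clj tj] := in_chart_class tx (esym e) mj.
  apply: filterS2 (near_clear cli) (near_clear clj) => y hi hj ty.
  by rewrite !gmapE//; exact: H.
have [[e [ex et]]|nl] := pselect (exists e, facet e x /\ lnk g e t != t); last first.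
  have [Q1 [b1 [h1 d1 H1]]] := loc_affine i c t.
  have [Q2 [b2 [h2 d2 H2]]] := loc_affine j d t.
  exists (Q1 *m Q2), (b1 *m Q2 + b2); split; first exact: orthogonal_mxM.
    by rewrite det_mulmx d1 d2.
  suff H t' : inj_tile g t' x = inj_tile g t x -> t' = t.
    move=> t' /H -> y; rewrite mulmxA addrA -mulmxDl -H1 -H2.
    by rewrite locK.
  move=> /esym/inj_tileP => /(_ tx) [->//|[e ex te]].
  apply/eqP; apply: contrapT => /negP tt; apply: nl; exists e; split=> //.
  by rewrite -te.
have ec : e = c by case: (mi.1 e ex) => // h; rewrite h eqxx in et.
have ed : e = d by case: (mj.1 e ex) => // h; rewrite h eqxx in et.
subst c; subst d; have ti := mi.2; have tj := mj.2.
have [ij|ij] := eqVneq j i.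
  subst j; exists 1%:M, 0; split; first by rewrite /orthogonal_mx trmx1 mulmx1.
    by rewrite det1 side_sign2.
  by move=> t' _ y; rewrite mulmx1 addr0.
have jE : j = lnk g e i.
  case: ti => ti; case: tj => tj.
  - by rewrite -ti -tj eqxx in ij.
  - by rewrite -ti tj lnkK.
  - by rewrite -ti -tj.
  - by rewrite -(can_inj (lnkK g e) (etrans (esym ti) tj)) eqxx in ij.
have [Q [b [hQ dQ H]]] := flip_affine e; exists Q, b; split=> //.
  rewrite dQ jE /side_sign; case: ti => ->; first by rewrite eqxx eq_sym (negPf ic) mul1r.
  by rewrite (negPf ic) eqxx mulr1.
move=> t' /esym e' y; have [_ ti'] := in_chart_class tx e' mi.
by rewrite jE -H loc_swap.
Qed.

Lemma gatlas_flat ch ch' : @gatlas R g ch -> @gatlas R g ch' ->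
  euclidean_transition (fun=> True) ch ch'.
Proof.
move=> [i [c [ic ->]]] [j [d [jd ->]]] m /=.
have [t [x [tx ->]]] := glued_ex m => /(gdomP _ _ _ _ tx) mi /(gdomP _ _ _ _ tx) mj.
by have [Q [b [hQ _ H]]] := gtransition ic jd tx mi mj; exists Q, b.
Qed.

Definition gmanifold : compact_flat_manifold R 0 :=
  CompactFlatManifold (@glued_hausdorff R g) (@glued_compact R g)
    (@gatlas_cover R g) gatlas_flat.

(** Keep the charts that draw a tile of colour true unreflected. By the alternating colouring they
    all draw tiles of colour false reflected, so any two of them agree on the orientation of each
    tile. *)
Lemma gmanifold_orientable (col : 'I_4 -> bool) :
  (forall c i, lnk g c i != i -> col (lnk g c i) = ~~ col i) ->
  orientable gmanifold.
Proof.
move=> colP; exists [set ch | exists i c (h : lnk g c i != i), ch = gchart R h /\ col i].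
have sideE i c t x : lnk g c i != i -> col i -> in_chart g i c t x ->
    side_sign i t = if col t then 1 else -1.
  move=> ic ci [_ [->|->]]; rewrite /side_sign; first by rewrite eqxx ci.
  by rewrite (negPf ic) (colP _ _ ic) ci.
split.
- move=> m; have [t [x [tx ->]]] := glued_ex m.
  have [c [h mi]] := in_chart_ex g t tx; have [ct|ct] := boolP (col t).
    by exists (gchart R h); [exists t, c, h|apply/gdomP].
  have h' : lnk g c (lnk g c t) != lnk g c t by rewrite lnkK eq_sym.
  exists (gchart R h'); first by exists (lnk g c t), c, h'; rewrite (colP _ _ h) ct.
  by apply/gdomP => //; split; [case: mi|right; rewrite lnkK].
- move=> ch ch' H [i [c [ic [-> _]]]]; apply: gatlas_flat => //.
  by exists i, c, ic.
- move=> _ _ [i [c [ic [-> ci]]]] [j [d [jd [-> cj]]]] m /=.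
  have [t [x [tx ->]]] := glued_ex m => /(gdomP _ _ _ _ tx) mi /(gdomP _ _ _ _ tx) mj.
  have [Q [b [hQ dQ H]]] := gtransition ic jd tx mi mj; exists Q, b; split=> //.
  rewrite dQ (sideE _ _ _ _ ic ci mi) (sideE _ _ _ _ jd cj mj).
  by case: ifP => _; rewrite ?mulrNN mulr1.
Qed.

Lemma minteriorP t x : tile x -> minterior gmanifold (inj_tile g t x) <->
  inner x \/ exists c, open_facet c x /\ lnk g c t != t.
Proof.
move=> tx; split.
  move=> [_ [[i [c [ic ->]]] /(gdomP _ _ _ _ tx) mi /=]].
  rewrite gmapE// /interior => H0.
  have {H0}H : \forall z \near loc i c t x,
      (if facet c x then tile z \/ tile (flip c z) else tile (loc i c t z)) : Prop.
    by apply: filterS2 H0 (near_gimage ic tx mi) => z hz <-.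
  have [cx|/negPf cx] := boolP (facet c x); rewrite cx in H.
    right; exists c; split; last first.
      case: mi => _ [->|->]; first exact: ic.
      by rewrite lnkK eq_sym.
    rewrite (loc_fix _ _ cx) in H; exact: near_glue_inner cx H.
  left; apply: near_tile_inner; have := near_loc i c t H; rewrite locK.
  by apply: filterS => y; rewrite locK.
move=> H.
have [c [h mi]] : exists c, lnk g c t != t /\ in_chart g t c t x.
  exact: in_chart_ex.
exists (gchart R h); split; [by exists t, c, h|by apply/gdomP|].
rewrite /= gmapE// /interior.
suff H' : \forall z \near loc t c t x,
    (if facet c x then tile z \/ tile (flip c z) else tile (loc t c t z)) : Prop.
  by apply: filterS2 H' (near_gimage h tx mi) => z hz ->.
have [cx|cx] := boolP (facet c x).
  rewrite loc_fix//; apply: near_glue_open.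
  case: H => [ix|[d [dx _]]].
    exfalso; case: ix => k [h1 h2 h3 h4]; move/eqP: cx.
    have [e|/I2_neq e] := eqVneq c.1 k; rewrite e.
      by case: (sgn_cases R c.2) => ->; lra.
    by case: (sgn_cases R c.2) => ->; lra.
  by rewrite -(facet_uniq tx (open_facet_facet dx) cx).
rewrite /loc eqxx.
case: H => [ix|[d [dx dt]]]; last first.
  case: (mi.1 d (open_facet_facet dx)) => e; first by rewrite -e open_facet_facet in cx.
  by rewrite e eqxx in dt.
by apply: filterS (near_inner ix) => y /inner_tile.
Qed.

End Manifold.

(** * Boundary conditions *)

Section Mixed.
Variables (R : realType) (g : tile_graph).
Local Notation M := (gmanifold R g).
Implicit Types (x y z a : 'rV[R]_2) (i j t : 'I_4) (c d : 'I_2 * bool) (m : M)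
  (k : 'I_2).

Lemma inner_facet x c : inner x -> ~ facet c x.
Proof.
move=> [k [h1 h2 h3 h4]] /eqP.
have [e|/I2_neq e] := eqVneq c.1 k; rewrite e.
  by case: (sgn_cases R c.2) => ->; lra.
by case: (sgn_cases R c.2) => ->; lra.
Qed.

Lemma edge_facet c b d x : edge c b x -> ~ facet d x.
Proof.
move=> [h1 h2 e] /eqP.
have [e'|/I2_neq e'] := eqVneq d.1 c.1; rewrite e' ?e; move: h1 h2.
  by case: (sgn_cases R c.2) => ->; case: (sgn_cases R d.2) => ->; lra.
by case: (sgn_cases R b) => ->; case: (sgn_cases R d.2) => ->; lra.
Qed.

Lemma edge_inner c b x : edge c b x -> ~ inner x.
Proof.
move=> [h1 h2 e] [k [a1 a2 a3 a4]].
have [e'|/I2_neq e'] := eqVneq k c.1; rewrite e' ?rev_ordK ?e in a1 a2 a3 a4.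
  by move: a3 a4; case: (sgn_cases R b) => ->; lra.
by move: h1 h2 a3 a4; case: (sgn_cases R c.2) => ->; lra.
Qed.

Definition is_dir t x := exists c, open_facet c x /\ dir g c t.

(** Every free edge is Neumann. Tile corners are excluded even where two free edges continue each
    other across a glued arm end. *)
Definition is_neu t x :=
  (exists c, [/\ open_facet c x, lnk g c t = t & ~~ dir g c t]) \/
  (exists c b, edge c b x).

Definition gdir : set M := [set m | is_dir (val m).1 (fold m)].
Definition gneu : set M := [set m | is_neu (val m).1 (fold m)].

Lemma gdirP t x : tile x -> gdir (inj_tile g t x) <-> is_dir t x.
Proof.
move=> tx; apply: class_predP => // {x tx}t {}t' x tx.
move=> /inj_tileP => /(_ tx) [->//|[d dx ->]] [c [cx ct]].
have -> := facet_uniq tx dx (open_facet_facet cx).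
by rewrite (dir_loop ct); exists c.
Qed.

Lemma gneuP t x : tile x -> gneu (inj_tile g t x) <-> is_neu t x.
Proof.
move=> tx; apply: class_predP => // {x tx}t {}t' x tx.
move=> /inj_tileP => /(_ tx) [->//|[d dx ->]] [[c [cx ct nc]]|[c [b e]]].
  by have -> := facet_uniq tx dx (open_facet_facet cx); rewrite ct; left; exists c.
by case: (edge_facet e dx).
Qed.

Lemma mboundaryP t x : tile x -> mboundary M (inj_tile g t x) <->
  ~ inner x /\ forall c, open_facet c x -> lnk g c t = t.
Proof.
move=> tx; split=> [H|[ni H] /(minteriorP g t tx) [//|[c [cx ct]]]].
  split=> [ix|c cx]; first by apply: H; apply/minteriorP => //; left.
  apply/eqP; apply: contrapT => /negP ct; apply: H; apply/minteriorP => //.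
  by right; exists c.
by rewrite (H c cx) eqxx in ct.
Qed.

Lemma minterior_open : open (minterior M).
Proof.
rewrite openE => m mi; have [t [x [tx mE]]] := glued_ex m; subst m.
apply/near_gluedP => // t' e; rewrite -e in mi.
have [ix|[c [cx ct]]] := (minteriorP _ _ tx).1 mi.
  by apply: filterS (near_inner ix) => y iy ty; apply/minteriorP => //; left.
apply: filterS (near_tile_open_facet cx) => y H ty; apply/minteriorP => //.
by case: (H ty) => ?; [right; exists c|left].
Qed.

Lemma gdir_boundary m : gdir m -> mboundary M m.
Proof.
have [t [x [tx ->]]] := glued_ex m; move=> /(gdirP _ tx)[c [cx ct]].
apply/mboundaryP => //; split=> [ix|d dx].
  exact: inner_facet ix (open_facet_facet cx).
have -> := facet_uniq tx (open_facet_facet dx) (open_facet_facet cx).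
exact: dir_loop.
Qed.

Lemma gneu_boundary m : gneu m -> mboundary M m.
Proof.
have [t [x [tx ->]]] := glued_ex m; move=> /(gneuP _ tx)[[c [cx ct nc]]|[c [b e]]].
  apply/mboundaryP => //; split=> [ix|d dx].
    exact: inner_facet ix (open_facet_facet cx).
  by have -> := facet_uniq tx (open_facet_facet dx) (open_facet_facet cx).
apply/mboundaryP => //; split; first exact: edge_inner e.
by move=> d /open_facet_facet /(edge_facet e).
Qed.

Lemma loop_class c t t' x : tile x -> facet c x -> lnk g c t = t ->
  inj_tile g t' x = inj_tile g t x -> t' = t.
Proof.
move=> tx cx ct /esym/inj_tileP => /(_ tx) [//|[d dx ->]].
by have -> := facet_uniq tx dx cx.
Qed.

Lemma gdir_open : exists2 O, open O & gdir = O `&` mboundary M.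
Proof.
exists (gdir `|` minterior M); last first.
  rewrite eqEsubset; split=> m; last by case=> -[].
  by move=> dm; split; [left|exact: gdir_boundary].
rewrite openE => m [dm|mi]; last first.
  by apply: filterS (minterior_open mi) => y; right.
have [t [x [tx mE]]] := glued_ex m; subst m; move/(gdirP _ tx) : dm => [c [cx ct]].
apply/near_gluedP => // t' /(loop_class tx (open_facet_facet cx) (dir_loop ct)) ->.
apply: filterS (near_tile_open_facet cx) => y H ty.
case: (H ty) => hy; first by left; apply/gdirP => //; exists c.
by right; apply/minteriorP => //; left.
Qed.

Lemma gneu_open : exists2 O, open O & gneu = O `&` mboundary M.
Proof.
exists (gneu `|` minterior M); last first.
  rewrite eqEsubset; split=> m; last by case=> -[].
  by move=> dm; split; [left|exact: gneu_boundary].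
rewrite openE => m [dm|mi]; last first.
  by apply: filterS (minterior_open mi) => y; right.
have [t [x [tx mE]]] := glued_ex m; subst m.
move/(gneuP _ tx) : dm => [[c [cx ct nc]]|[c [b e]]].
  apply/near_gluedP => // t' /(loop_class tx (open_facet_facet cx) ct) ->.
  apply: filterS (near_tile_open_facet cx) => y H ty.
  case: (H ty) => hy; first by left; apply/gneuP => //; left; exists c.
  by right; apply/minteriorP => //; left.
apply/near_gluedP => // t' _; apply: filterS (near_tile_edge e) => y H ty.
case: (H ty) => hy; first by left; apply/gneuP => //; right; exists c, b.
by right; apply/minteriorP => //; left.
Qed.

(** Here k is the axis of the normal; unglued arm ends and free edges can then be treated together,
    whatever their boundary condition. *)
Definition flat_boundary t x k :=
  (exists c, [/\ open_facet c x, lnk g c t = t & k = c.1]) \/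
  (exists c b, edge c b x /\ k = rev_ord c.1).

Lemma flat_boundary_facet i c t x k : lnk g c i != i -> in_chart g i c t x ->
  tile x -> flat_boundary t x k -> facet c x = false.
Proof.
move=> ic [_ ti] tx [[d [dx dt _]]|[d [b [e _]]]]; apply/negP => cx.
  have dc := facet_uniq tx (open_facet_facet dx) cx; rewrite dc in dt.
  case: ti => ti; first by rewrite -ti dt eqxx in ic.
  by rewrite ti lnkK in dt; rewrite -dt eqxx in ic.
exact: edge_facet e cx.
Qed.

Lemma flat_boundary_half t x k : flat_boundary t x k ->
  exists sg, half_at k sg (fun y => tile y) x.
Proof.
move=> [[c [cx _ ->]]|[c [b [e ->]]]].
  by exists (- sgn R c.2); exact: near_open_facet.
by exists (- sgn R b); exact: near_edge.
Qed.

Lemma flat_boundary_image i c t x k (ic : lnk g c i != i) : in_chart g i c t x ->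
  tile x -> flat_boundary t x k ->
  exists sg, half_at k sg (@gmap R g i c @` gdom i c) (loc i c t x).
Proof.
move=> mi tx fb; have cx := flat_boundary_facet ic mi tx fb.
have [sg hx] := flat_boundary_half fb.
have [sg' H] : exists sg, half_at k sg (fun y => tile (loc i c t y)) (loc i c t x).
  rewrite /loc; case: eqP => _; first by exists sg.
  exact: (half_at_flip c hx).
exists sg'; apply: half_at_ext H.
by apply: filterS (near_gimage ic tx mi) => z ->; rewrite cx.
Qed.

Lemma flat_boundary_smooth t x k : tile x -> flat_boundary t x k ->
  smooth_boundary_point (inj_tile g t x : M).
Proof.
move=> tx fb; have [c [h mi]] := in_chart_ex g t tx.
exists (gchart R h); split; [by exists t, c, h|by apply/gdomP|].
rewrite /= gmapE//; have [sg H] := flat_boundary_image h mi tx fb.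
exact: smooth_boundary_half_at H.
Qed.

Lemma is_dir_flat t x : is_dir t x -> exists k, flat_boundary t x k.
Proof.
by move=> [c [cx ct]]; exists c.1; left; exists c; split=> //; exact: dir_loop.
Qed.

Lemma is_neu_flat t x : is_neu t x -> exists k, flat_boundary t x k.
Proof.
move=> [[c [cx ct _]]|[c [b e]]]; first by exists c.1; left; exists c.
by exists (rev_ord c.1); right; exists c, b.
Qed.

Lemma gdir_smooth m : gdir m -> smooth_boundary_point m.
Proof.
have [t [x [tx ->]]] := glued_ex m; move=> /(gdirP _ tx)/is_dir_flat[k].
exact: flat_boundary_smooth.
Qed.

Lemma gneu_smooth m : gneu m -> smooth_boundary_point m.
Proof.
have [t [x [tx ->]]] := glued_ex m; move=> /(gneuP _ tx)/is_neu_flat[k].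
exact: flat_boundary_smooth.
Qed.

Lemma gdir_gneu_disjoint : gdir `&` gneu = set0.
Proof.
rewrite -subset0 => m []; have [t [x [tx ->]]] := glued_ex m.
move=> /(gdirP _ tx) [c [cx ct]] /(gneuP _ tx) [[d [dx dt nd]]|[d [b e]]].
  by rewrite (facet_uniq tx (open_facet_facet dx) (open_facet_facet cx)) ct in nd.
exact: edge_facet e (open_facet_facet cx).
Qed.

Lemma boundary_cases t x : tile x -> mboundary M (inj_tile g t x) ->
  [\/ is_dir t x, is_neu t x, exists c b, corner c b x |
      exists b0 b1, reentrant b0 b1 x].
Proof.
move=> tx /(mboundaryP _ tx) [ni H].
case: (tile_cases tx) => [//|[[c cx]|[e|[h|h]]]].
- have [dc|dc] := boolP (dir g c t); first by apply: Or41; exists c.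
  by apply: Or42; left; exists c; split=> //; exact: H.
- by apply: Or42; right.
- by apply: Or43.
- by apply: Or44.
Qed.

Lemma corner_closure t x k b : tile x -> x 0 (rev_ord k) = sgn R b ->
  1 <= `|x 0 k| <= 2 -> closure (gdir `|` gneu) (inj_tile g t x).
Proof.
move=> tx xb xk B nB; have := near_inj_tile tx nB.
have [s hs] := sgn_ex (x 0 k).
have {}xk : 1 <= sgn R s * x 0 k <= 2.
  have <- // : `|x 0 k| = sgn R s * x 0 k.
  move: hs; case: (sgn_cases R s) => -> h; first by rewrite mul1r ger0_norm//; lra.
  by rewrite mulN1r ler0_norm//; lra.
(* Points from x to the middle of the adjacent free edge, where the coordinate k is 3/2 up to sign;
   for 0 < h < 1 the moved point is strictly inside that edge. *)
pose v : 'rV[R]_2 := (sgn R s * (3 / 2) - x 0 k) *: delta_mx 0 k.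
have n1 : \forall h \near (0 : R), `|h| < 1 by exact: nbhs0_lt.
move=> /(near_line v) /(filterI n1) /near0_ex_pos[h h0 [/= h1 H]].
have {}h1 : h < 1 by rewrite gtr0_norm in h1.
have e : edge (k, s) b (h *: v + x).
  split=> /=; rewrite !mxE ?eqxx ?(negPf (rev_ord2_neq k)) /=.
  - by move: xk hs; case: (sgn_cases R s) => -> /andP[? ?] ?; nra.
  - by move: xk hs; case: (sgn_cases R s) => -> /andP[? ?] ?; nra.
  - by rewrite mulr0 mulr0 add0r.
have te := edge_tile e; exists (inj_tile g t (h *: v + x)); split; last exact: H.
by right; apply/gneuP => //; right; exists (k, s), b.
Qed.

Lemma gboundary_dense : mboundary M = closure (gdir `|` gneu).
Proof.
rewrite eqEsubset; split.
  move=> m; have [t [x [tx ->]]] := glued_ex m => mb.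
  have sub : gdir `|` gneu `<=` closure (gdir `|` gneu) by exact: subset_closure.
  case: (boundary_cases tx mb) => [h|h|[c [b [e e']]]|[b0 [b1 [e e']]]].
  - by apply: sub; left; apply/gdirP.
  - by apply: sub; right; apply/gneuP.
  - apply: (corner_closure tx e'); rewrite e.
    by case: (sgn_cases R c.2) => ->; rewrite ?mulr1 ?mulrN1 ?normrN ger0_norm; lra.
  - apply: (corner_closure (k := ord0) (b := b1) tx); first by rewrite rev_ord0.
    by rewrite e; case: (sgn_cases R b0) => ->; rewrite ?normrN normr1; lra.
have cl : closed (mboundary M) by apply: open_closedC; exact: minterior_open.
rewrite [X in _ `<=` X]((closure_id (mboundary M)).1 cl).
by apply: closure_subset => m [/gdir_boundary|/gneu_boundary].
Qed.

Lemma leftover_grid t x : tile x ->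
  (mboundary M `\` (gdir `|` gneu)) (inj_tile g t x) ->
  forall j : 'I_2, [\/ x 0 j = 1, x 0 j = -1, x 0 j = 2 | x 0 j = -2].
Proof.
move=> tx [mb nb].
case: (boundary_cases tx mb) => [h|h|[c [b [e e']]]|[b0 [b1 [e e']]]].
- by exfalso; apply: nb; left; apply/gdirP.
- by exfalso; apply: nb; right; apply/gneuP.
- apply: (@I2_all _ c.1); rewrite ?e ?e'.
    by case: (sgn_cases R c.2) => ->; [apply: Or43|apply: Or44]; lra.
  by case: (sgn_cases R b) => ->; [apply: Or41|apply: Or42].
- apply: (@I2_all _ ord0); rewrite ?rev_ord0 ?e ?e'.
    by case: (sgn_cases R b0) => ->; [apply: Or41|apply: Or42].
  by case: (sgn_cases R b1) => ->; [apply: Or41|apply: Or42].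
Qed.

(** In dimension 2 the leftover must be locally finite. Its points have coordinates among 1, -1, 2
    and -2, so two of them within 1/4 in each coordinate coincide, and one constant map covers the
    leftover near m. *)
Lemma gleftover m : (mboundary M `\` (gdir `|` gneu)) m ->
  exists (c : chart R 0 M) (k : nat) (gamma : 'I_k -> 'rV[R]_0 -> 'rV[R]_2),
   [/\ @atlas R 0 M c, cdom c m,
       forall (i : 'I_k) (t : 'rV[R]_0) (j : 'I_2), smooth_near (fun u => gamma i u 0 j) t &
       \forall q \near m, (mboundary M `\` (gdir `|` gneu)) q ->
         exists (i : 'I_k) (t : 'rV[R]_0), cmap c q = gamma i t].
Proof.
have [t [x [tx ->]]] := glued_ex m => lm.
have [c [h mi]] := in_chart_ex g t tx.
exists (gchart R h), 1%N, (fun _ _ => gmap t c (inj_tile g t x)); split.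
- by exists t, c, h.
- by apply/gdomP.
- by move=> _ u j; exact: smooth_near_cst.
apply/near_gluedP => // t' e.
have H (j : 'I_2) : \forall y \near x, x 0 j - 1/4 < (y : 'rV[R]_2) 0 j /\ y 0 j < x 0 j + 1/4.
  by apply: near_coord; lra.
have {}H : \forall y \near x, forall j : 'I_2,
    x 0 j - 1/4 < (y : 'rV[R]_2) 0 j /\ y 0 j < x 0 j + 1/4.
  exact: filter_forall H.
apply: filterS H => y H ty ly; exists ord0, 0.
suff -> : y = x by rewrite /= e.
apply/rowP => j; have [? ?] := H j.
by case: (leftover_grid tx lm j) => ?; case: (leftover_grid ty ly j) => ?; lra.
Qed.

Definition gmixed : mixed_manifold R 0 := MixedManifold gdir_open gneu_open
  gdir_smooth gneu_smooth gdir_gneu_disjoint gboundary_dense gleftover.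

End Mixed.

(** * Normal vectors *)

Section Normals.
Variable R : realType.
Implicit Types (x y z a v : 'rV[R]_2) (P : set 'rV[R]_2) (k j : 'I_2) (Q : 'M[R]_2).

Lemma delta_mulmx j Q l : (delta_mx 0 j *m Q : 'rV[R]_2) 0 l = Q j l.
Proof. by rewrite -rowE mxE. Qed.

Lemma normal_entry (al be : R) Q j :
  ((row_mx (const_mx al : 'M[R]_1) (const_mx be : 'rV[R]_1) : 'rV[R]_(1 + 1)) *m Q^T) 0 j =
  al * Q j ord0 + be * Q j ord_max.
Proof.
rewrite mxE (I2_sum _ ord0) rev_ord0 !mxE.
case: splitP => [l _|l]; last by rewrite ord1.
case: splitP => [l' /= h|l' _]; first by have := ltn_ord l'; rewrite -h.
by rewrite !mxE.
Qed.

Lemma row1_const (w : 'rV[R]_1) : w = const_mx (w 0 ord0).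
Proof. by apply/rowP => i; rewrite !mxE ord1. Qed.

Lemma half_at_normal k sg P a : half_at k sg P a -> exists v,
  outward_normal_at P a v /\ forall j, v 0 j = if j == k then - sg else 0.
Proof.
move=> [s2 H].
pose h : 'rV[R]_1 -> R := cst (sg * a 0 k).
exists ((row_mx (const_mx (-1) : 'M[R]_1)
   (\row_l 'D_(delta_mx 0 l) h (base (a *m half_mx k sg))) : 'rV[R]_(1 + 1))
   *m (half_mx k sg)^T); split.
  exists (half_mx k sg), h; split=> //; split.
  - exact: half_mx_orthogonal.
  - exact: smooth_near_cst.
  - by rewrite height_half_mx.
  - by apply: filterS H => y ->; rewrite height_half_mx mulrBr subr_ge0.
move=> j; rewrite [\row_l _]row1_const normal_entry !mxE derive_cst mul0r addr0 eqxx.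
by case: eqP => _; ring.
Qed.

(** The step s bounds D - q from above, the step -s bounds it from below. *)
Let squeeze (s e hp hm hb D q K : R) : 0 < s -> hp - hb <= s * q ->
  hm - hb <= - s * q -> `|hp - hb - s * D| <= K -> `|hm - hb - (- s) * D| <= K ->
  K <= s * e -> `|D - q| <= e.
Proof.
move=> s0 h1 h2; rewrite !ler_norml => /andP[h3 h4] /andP[h5 h6] Ke.
by apply/andP; split; rewrite -(ler_pM2l s0) mulrBr ?mulrN; lra.
Qed.

(** The presentation by [Q] and [h] is arbitrary. The boundary line through a in the direction j
    lies in P near a, so along it [h] minus the height is at most 0, with equality at a. Its
    derivative at this maximum vanishes, which says that the normal is orthogonal to the line. *)
Lemma normal_half_at k sg P a v j : half_at k sg P a ->
  outward_normal_at P a v -> j != k -> v 0 j = 0.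
Proof.
move=> [s2 HP] [Q [h [[hQ sh ha hP] ->]]] jk.
set b := base (a *m Q) in sh ha *.
rewrite [\row_l _]row1_const normal_entry mxE.
pose w : 'rV[R]_1 := const_mx (Q j ord_max).
have L0 (l : 'I_1) : lift ord0 l = ord_max :> 'I_2 by rewrite ord1; exact/val_inj.
have entryE (s : R) (l : 'I_2) :
    ((s *: delta_mx 0 j + a) *m Q) 0 l = s * Q j l + (a *m Q) 0 l.
  by rewrite mulmxDl -scalemxAl mxE [X in X + _]mxE delta_mulmx.
have baseE (s : R) : base ((s *: delta_mx 0 j + a) *m Q) = s *: w + b.
  apply/rowP => l; rewrite [LHS]mxE L0 entryE [RHS]mxE; congr (_ + _).
    by rewrite !mxE.
  by rewrite [RHS]mxE L0.
have heightE (s : R) : height ((s *: delta_mx 0 j + a) *m Q) =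
    s * Q j ord0 + height (a *m Q) by exact: entryE.
have dh : differentiable h b by exact: smooth_near_differentiable.
have dw : 'd h b w = 'D_(delta_mx 0 ord0) h b * Q j ord_max.
  by rewrite diffE_delta// big_ord1 mxE mulrC.
have below : \forall s \near (0 : R), h (s *: w + b) - h b <= s * Q j ord0.
  have H1 := near_line (delta_mx 0 j) HP.
  have H2 := near_line (delta_mx 0 j) hP.
  apply: filterS2 H1 H2 => s {}H1 {}H2.
  have : P (s *: delta_mx 0 j + a).
    by apply/H1; rewrite !mxE eqxx eq_sym (negPf jk) mulr0 add0r subrr mulr0.
  by move=> /H2; rewrite baseE heightE ha; lra.
suff -> : 'D_(delta_mx 0 ord0) h b * Q j ord_max = Q j ord0 by ring.
rewrite -dw; apply/eqP; rewrite -subr_eq0 -normr_le0; apply/ler_addgt0Pl => e e0.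
rewrite addr0; have w1 : 0 < `|w| + 1 by rewrite ltr_wpDl.
have d0 : 0 < e / (`|w| + 1) by rewrite divr_gt0.
have eps := near0_scale w (differentiable_eps dh d0).
have H : \forall s \near (0 : R),
    `|h (s *: w + b) - h b - 'd h b (s *: w)| <= e / (`|w| + 1) * `|s *: w| /\
    h (s *: w + b) - h b <= s * Q j ord0 by exact: filterI eps below.
have HN : \forall s \near (0 : R), 
    `|h ((- s) *: w + b) - h b - 'd h b ((- s) *: w)| <= e / (`|w| + 1) * `|(- s) *: w| /\
    h ((- s) *: w + b) - h b <= (- s) * Q j ord0.
  have cN : (fun s : R => - s) s @[s --> (0 : R)] --> (0 : R).
    by rewrite -[X in _ --> X]oppr0; exact: opp_continuous.
  exact: (cN _ H).
have [s s0 [[h1 h2] [h3 h4]]] := near0_ex_pos (filterI H HN).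
have dE (u : R) : 'd h b (u *: w) = u * 'd h b w by rewrite linearZ.
rewrite !dE !normrZ normrN gtr0_norm// in h1 h3.
have bnd : e / (`|w| + 1) * (s * `|w|) <= s * e.
  rewrite mulrCA ler_pM2l// mulrAC ler_pdivrMr// ler_pM2l// lerDl.
  exact: ler01.
exact: squeeze s0 h2 h4 h1 h3 bnd.
Qed.

End Normals.

(** * Eigenfunctions, tile by tile *)

Section TileSolutions.
Variables (R : realType) (g : tile_graph).
Implicit Types (x y z a v : 'rV[R]_2) (i j t : 'I_4) (c d : 'I_2 * bool)
  (k : 'I_2) (F G : 'rV[R]_2 -> R) (u : 'I_4 -> 'rV[R]_2 -> R) (lam : R).

Definition dsg c t : R := sgn R (dir g c t).

Definition helmholtz lam F x := - \sum_(i < 2) iter_partial [:: i; i] F x = lam * F x.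

(* The eigenvalue problem read tile by tile; across a facet, a solution is
   continued by its mirror neighbour, with a sign at Dirichlet facets. *)
Definition tile_solution lam u :=
  [/\ forall t, {within [set x | tile x], continuous (u t)},
      forall c t x, tile x -> facet c x -> dsg c t * u (lnk g c t) x = u t x,
      forall t x, inner x -> smooth_near (u t) x /\ helmholtz lam (u t) x,
      forall t x c b, edge c b x -> exists F, [/\ smooth_near F x,
        \forall y \near x, tile y -> u t y = F y &
        'D_(delta_mx 0 (rev_ord c.1)) F x = 0] &
      forall t x c, open_facet c x -> exists F, [/\ smooth_near F x,
        \forall y \near x, tile y -> u t y = F y &
        \forall y \near x, tile (flip c y) ->
           dsg c t * u (lnk g c t) (flip c y) = F y]].

Let loc_cases i c t F : (@loc R i c t = id /\ F \o loc i c t = F) \/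
  @loc R i c t = @flip R c.
Proof.
have [e|/negPf e] := eqVneq t i; [left|right].
  have E : @loc R i c t = id by apply/funext => x; rewrite /loc e eqxx.
  by split=> //; rewrite E; apply/funext.
by apply/funext => x; rewrite /loc e.
Qed.

Lemma smooth_loc i c t F a : smooth_near F (loc i c t a) ->
  smooth_near (F \o loc i c t) a.
Proof.
have [[-> ->]//|->] := loc_cases i c t F.
by move=> /iter_partial_mirror[].
Qed.

Lemma iter_partial2_loc i c t F a k : smooth_near F (loc i c t a) ->
  iter_partial [:: k; k] (F \o loc i c t) a = iter_partial [:: k; k] F (loc i c t a).
Proof.
have [[-> ->] _|->] := loc_cases i c t F; first exact: erefl.
exact: iter_partial2_mirror.
Qed.

Lemma derive_loc i c t F a k : smooth_near F (loc i c t a) -> exists2 e : R,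
  e != 0 & 'D_(delta_mx 0 k) (F \o loc i c t) a = e * 'D_(delta_mx 0 k) F (loc i c t a).
Proof.
have [[-> ->] _|->] := loc_cases i c t F.
  by exists 1; [exact: oner_neq0|rewrite mul1r].
move=> /iter_partial_mirror[_ /(_ [:: k])]; rewrite big_seq1 => H.
exists (if k == c.1 then -1 else 1); last exact: H.
by case: (k == c.1); rewrite ?oppr_eq0 oner_neq0.
Qed.

Lemma derive_flip F x c : smooth_near F x -> facet c x ->
  'D_(delta_mx 0 c.1) (F \o flip c) x = - 'D_(delta_mx 0 c.1) F x.
Proof.
move=> sF cx; have fx := flip_fix cx; rewrite -[in smooth_near _ _]fx in sF.
have [_ /(_ [:: c.1])] := iter_partial_mirror sF.
by rewrite big_seq1 eqxx mulN1r => /= ->; rewrite -/(flip c x) fx.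
Qed.

Lemma dsgE c t : ~~ dir g c t -> dsg c t = 1.
Proof. by rewrite /dsg /sgn => /negPf ->; rewrite expr0. Qed.

Lemma dsg_lnk c t : lnk g c t != t -> dsg c t = 1.
Proof.
move=> h; apply: dsgE; apply/negP => /dir_loop e; by rewrite e eqxx in h.
Qed.

(** At an unglued Neumann arm end the mirror neighbour is the tile itself with sign 1, so the common
    extension F is even under [flip c] and its normal derivative vanishes. *)
Lemma tile_solution_neumann lam u t x k : tile_solution lam u ->
  is_neu g t x -> flat_boundary g t x k -> exists F, [/\ smooth_near F x,
    \forall y \near x, tile y -> u t y = F y & 'D_(delta_mx 0 k) F x = 0].
Proof.
move=> [_ _ _ uE uF] neu [[c [cx ct ->]]|[c [b [e ->]]]]; last exact: uE e.
have nd : ~~ dir g c t.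
  case: neu => [[d [dx _ nd]]|[d [b e]]].
    by rewrite (facet_uniq (open_facet_tile cx) (open_facet_facet cx) (open_facet_facet dx)).
  by case: (edge_facet e (open_facet_facet cx)).
have [F [sF F1 F2]] := uF t x c cx; exists F; split=> //.
have fcx := open_facet_facet cx.
rewrite dsgE// in F2; have H : \forall y \near x, (F \o flip c) y = F y.
  have := near_flip c F1; rewrite flip_fix// => F1'.
  have := near_flip c F2; rewrite flip_fix// => F2'.
  near=> y; have [ty|ty] : tile y \/ tile (flip c y).
    by near: y; exact: near_glue_open.
  - rewrite -(near F1 y _ ty)// /= -(near F2' y)// ?flipK//.
    by rewrite mul1r ct.
  - rewrite -(near F2 y _ ty)// /= -(near F1' y _ ty)// mul1r ct//.
have := near_eq_derive (delta_mx 0 c.1) H.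
by rewrite derive_flip// => h; lra.
Unshelve. all: by end_near. Qed.

Lemma tile_solution_dir lam u c t x : tile_solution lam u -> tile x ->
  facet c x -> dir g c t -> u t x = 0.
Proof.
move=> [_ uf _ _ _] tx cx ct; have := uf c t x tx cx.
by rewrite /dsg ct (dir_loop ct) /sgn expr1 => h; lra.
Qed.

End TileSolutions.

(** * From eigenfunctions to tile solutions *)

Section Eigenfunctions.
Variables (R : realType) (g : tile_graph) (lam : R).
Local Notation M := (gmixed R g).
Implicit Types (x y z a v : 'rV[R]_2) (i j t : 'I_4) (c d : 'I_2 * bool)
  (k : 'I_2) (F G : 'rV[R]_2 -> R).

Definition pull (phi : M -> R) t x := phi (inj_tile g t x).

Lemma smooth_extension_tile phi t x ch F : tile x ->
  smooth_extension phi (inj_tile g t x : M) ch F ->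
  exists i c (ic : lnk g c i != i), [/\ ch = gchart R ic, in_chart g i c t x,
    smooth_near (F \o loc i c t) x &
    forall t', inj_tile g t' x = inj_tile g t x ->
      \forall y \near x, tile y -> pull phi t' y = F (loc i c t' y)].
Proof.
move=> tx [[i [c [ic ->]]] /(gdomP _ _ _ _ tx) mi /=]; rewrite gmapE// => sF nF.
exists i, c, ic; split=> //; first exact: smooth_loc.
move=> t' e; have [cl _] := in_chart_class tx (esym e) mi.
have mi' := in_chart_class tx (esym e) mi.
have nF' : \forall m \near inj_tile g t' x, phi m = F (gmap i c m) by rewrite e.
have H := near_inj_tile tx nF'.
apply: filterS2 H (near_clear cl) => y H cly ty.
by rewrite /pull H// gmapE//; split=> //; case: mi'.
Qed.

Lemma extension_tile phi t x ch F : tile x ->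
  smooth_extension phi (inj_tile g t x : M) ch F ->
  exists G, smooth_near G x /\ \forall y \near x, tile y -> pull phi t y = G y.
Proof.
move=> tx /(smooth_extension_tile tx)[i [c [ic [_ _ sF H]]]].
by exists (F \o loc i c t); split=> //; exact: H.
Qed.

Lemma pull_neumann phi t x k : eigenfunctions M lam phi -> tile x ->
  is_neu g t x -> flat_boundary g t x k -> exists F, [/\ smooth_near F x,
    \forall y \near x, tile y -> pull phi t y = F y &
    'D_(delta_mx 0 k) F x = 0].
Proof.
move=> [_ sphi _ _ nphi] tx neu fb.
have nm : neumann M (inj_tile g t x) by apply/gneuP.
have [ch [F HF]] := sphi (inj_tile g t x) (or_intror nm).
have [i [c [ic [chE mi sF nF]]]] := smooth_extension_tile tx HF.
exists (F \o loc i c t); split=> //; first exact: nF.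
have sF' : smooth_near F (loc i c t x).
  by case: HF => _ _; rewrite chE /= gmapE.
have [e _ ->] := derive_loc k sF'.
have [sg hs] := flat_boundary_image ic mi tx fb.
have [v [nv vE]] := half_at_normal hs.
have := nphi _ ch F v nm HF; rewrite chE /= gmapE// => /(_ nv).
rewrite deriveE; last exact: smooth_near_differentiable.
rewrite diffE_delta; last exact: smooth_near_differentiable.
rewrite (I2_sum _ k) !vE eqxx (negPf (rev_ord2_neq k)) mul0r addr0 mulNr.
move/eqP; rewrite oppr_eq0 mulf_eq0 => /orP[/eqP s0|/eqP ->]; last by rewrite mulr0.
by have [s2 _] := hs; rewrite s0 mul0r in s2; have := @oner_neq0 R; rewrite -s2 eqxx.
Qed.

Lemma pull_continuous phi t : eigenfunctions M lam phi ->
  {within [set x | tile x], continuous (pull phi t)}.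
Proof. by move=> [cphi _ _ _ _]; move/glued_continuousP : cphi; apply. Qed.

Lemma pull_facet phi c t x : eigenfunctions M lam phi -> tile x -> facet c x ->
  dsg R g c t * pull phi (lnk g c t) x = pull phi t x.
Proof.
move=> ephi tx cx; have [ct|nct] := boolP (dir g c t); last first.
  by rewrite dsgE// mul1r /pull inj_tile_lnk.
rewrite (dir_loop ct); suff -> : pull phi t x = 0 by rewrite mulr0.
(* The Dirichlet condition is imposed on the open arm end only. A nonzero value at an endpoint would
   persist nearby, in particular at points moved towards the middle of the end. *)
apply/eqP; apply: contrapT => /negP n0.
have o : open [set r : R | r != 0] by exact: open_neq.
have H0 : \forall y \near x, tile y -> pull phi t y != 0.
  have := pull_continuous (t := t) ephi; move/within_continuousP.
  by move=> /(_ x tx [set r | r != 0]); apply; apply: open_nbhs_nbhs; split.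
have H := near_line (- x 0 (rev_ord c.1) *: delta_mx 0 (rev_ord c.1)) H0.
have n1 : \forall h \near (0 : R), `|h| < 1 by exact: nbhs0_lt.
have [h h0 [/= h1]] := near0_ex_pos (filterI n1 H).
set y := _ + x => Hy; rewrite gtr0_norm// in h1.
have [a1 a2] := facet_other tx cx.
have yc : open_facet c y.
  have cr : (c.1 == rev_ord c.1) = false by rewrite eq_sym (negPf (rev_ord2_neq _)).
  have y1 : y 0 c.1 = x 0 c.1 by rewrite /y !mxE cr !mulr0 add0r.
  have y2 : y 0 (rev_ord c.1) = (1 - h) * x 0 (rev_ord c.1).
    by rewrite /y !mxE !eqxx mulr1 mulrBl mul1r mulrN addrC.
  by split; rewrite ?y1 ?y2; [exact/eqP|nra|nra].
have ty := open_facet_tile yc; have := Hy ty.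
case: ephi => _ _ _ dphi _; rewrite /= /pull dphi ?eqxx//.
by apply/gdirP => //; exists c.
Qed.

Lemma near_pull_eq phi t x F : inner x ->
  (\forall y \near x, tile y -> pull phi t y = F y) ->
  \forall y \near x, F y = pull phi t y.
Proof.
by move=> ix H; apply: filterS2 (near_inner ix) H => y iy /(_ (inner_tile iy)).
Qed.

Lemma pull_inner phi t x : eigenfunctions M lam phi -> inner x ->
  smooth_near (pull phi t) x /\ helmholtz lam (pull phi t) x.
Proof.
move=> [_ sphi lphi _ _] ix; have tx := inner_tile ix.
have mi : minterior M (inj_tile g t x) by apply/minteriorP => //; left.
split.
  have [ch [F HF]] := sphi _ (or_introl (or_introl mi)).
  have [G [sG GE]] := extension_tile tx HF.
  exact: near_eq_smooth (near_pull_eq ix GE) sG.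
have [c [h mc]] := in_chart_ex g t tx.
have hg : gdom t c (inj_tile g t x) by apply/gdomP.
have at_h : gatlas (gchart R h) by exists t, c, h.
have L := lphi (inj_tile g t x) (gchart R h) mi at_h hg.
rewrite /laplacian /= (gmapE tx mc) /loc eqxx in L.
have E : \forall y \near x, pull phi t y = (phi \o ginv g t c) y.
  by apply: filterS (near_inner ix) => y /inner_tile ty; rewrite /= /ginv ty.
have S : \sum_(k < 2) iter_partial [:: k; k] (pull phi t) x =
    \sum_(k < 2) iter_partial [:: k; k] (phi \o ginv g t c) x.
  by apply: eq_bigr => k _; exact: near_eq_iter_partial.
by rewrite /helmholtz S; exact: L.
Qed.

(** At a glued end a chart around x unfolds across c, so the given smooth extension already
    describes both sides. At an unglued end its values beyond the tile are arbitrary, and it is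
    replaced by the odd or even reflection of its values on the tile. *)
Lemma pull_open_facet phi t x c : eigenfunctions M lam phi -> open_facet c x ->
  exists F, [/\ smooth_near F x,
    \forall y \near x, tile y -> pull phi t y = F y &
    \forall y \near x, tile (flip c y) ->
       dsg R g c t * pull phi (lnk g c t) (flip c y) = F y].
Proof.
move=> ephi cx; have tx := open_facet_tile cx; have fcx := open_facet_facet cx.
have [_ sphi _ _ _] := ephi.
have reg : (minterior M `|` dirichlet M `|` neumann M) (inj_tile g t x).
  have [ct|ct] := eqVneq (lnk g c t) t; last first.
    by left; left; apply/minteriorP => //; right; exists c.
  have [dc|dc] := boolP (dir g c t).
    by left; right; apply/gdirP => //; exists c.
  by right; apply/gneuP => //; left; exists c.
have [ch [F HF]] := sphi _ reg.
have [i [d [id [_ mi sF nF]]]] := smooth_extension_tile tx HF.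
have [ct|ct] := eqVneq (lnk g c t) t; last first.
  have cd : c = d by case: (mi.1 c fcx) => // e; rewrite e eqxx in ct.
  subst d; exists (F \o loc i c t); split=> //; first exact: nF.
  rewrite dsg_lnk//; have e : inj_tile g (lnk g c t) x = inj_tile g t x.
    exact: inj_tile_lnk.
  have := near_flip c (nF _ e); rewrite flip_fix//; apply: filterS => y H ty.
  rewrite mul1r H//= /loc; have [_ [ti|ti]] := mi; rewrite ti ?lnkK eqxx.
    by rewrite (negPf id) flipK.
  by rewrite (negPf id).
set G := F \o loc i d t in sF *; have nG := nF t erefl.
pose b := dir g c t.
have sgE : forall y, sgn R c.2 * y 0 c.1 <= sgn R c.2 * (2 * sgn R c.2) <->
    sgn R c.2 * y 0 c.1 <= 2.
  by move=> y; rewrite mulrCA sgn2 mulr1.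
have nsel : \forall z \near x, tile z -> open_facet c z \/ inner z.
  exact: near_tile_open_facet.
have [_ near_half] := near_open_facet cx.
have tside : \forall z \near x, (tile z : Prop) <-> sgn R c.2 * z 0 c.1 <= 2.
  apply: filterS near_half => z ->; case: cx => -> _ _.
  by rewrite mulNr oppr_ge0 mulrBr mulrCA sgn2 mulr1 subr_le0.
have nG2 : \forall z \near x, \forall y \near z, tile y -> pull phi t y = G y.
  by move: nG; rewrite -nbhs_nearE => /nbhs_interior.
have sG2 : \forall z \near x, smooth_near G z.
  by move: sF; rewrite /smooth_near -nbhs_nearE => /nbhs_interior.
exists (reflect_ext c.1 (2 * sgn R c.2) (sgn R c.2) b G); split.
(* The factor is [- lam] because the Laplacian is minus the sum of the second derivatives. *)
- apply: (@reflection_principle R 2 c.1 (2 * sgn R c.2) (sgn R c.2) (sgn2 R c.2) b G x (- lam)) => //.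
  + by case: cx.
  + near=> y => yc.
    have {}yc : sgn R c.2 * y 0 c.1 < 2 by rewrite mulrCA sgn2 mulr1 in yc.
    have ty : tile y by apply/(near tside y) => //; exact: ltW.
    have iy : inner y.
      case: (near nsel y _ ty) => // -[e _ _]; exfalso.
      by rewrite e mulrCA sgn2 mulr1 ltxx in yc.
    have E := near_pull_eq iy (near nG2 y _).
    have [_] := pull_inner t ephi iy; rewrite /helmholtz -(nbhs_singleton (E _))//.
    rewrite mulNr => <-; rewrite opprK.
    by apply: eq_bigr => j _; apply: near_eq_iter_partial; exact: E.
  + near=> y => yc; have ty : tile y.
      by apply/(near tside y) => //; rewrite yc mulrCA sgn2 mulr1.
    have fy : open_facet c y.
      case: (near nsel y _ ty) => // iy.
      by case: (@inner_facet R y c iy); exact/eqP.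
    rewrite /b; case: ifP => dc.
      rewrite -(nbhs_singleton (near nG2 y _) ty)//.
      have := pull_facet t ephi ty (open_facet_facet fy).
      rewrite ct /dsg dc /sgn expr1 => h; lra.
    have [||H [sH nH dH]] := pull_neumann (k := c.1) ephi ty (t := t).
      by left; exists c; rewrite dc.
      by left; exists c.
    rewrite -dH; have [s2 hf] := near_open_facet fy.
    have s0 : - sgn R c.2 != 0.
      by rewrite oppr_eq0 /sgn expf_eq0 oppr_eq0 oner_eq0 andbF.
    have sGy : smooth_near G y by near: y.
    have dG := smooth_near_differentiable sGy.
    have dHy := smooth_near_differentiable sH.
    apply: (@derive_eq_half R 2 G H y c.1 (- sgn R c.2) (delta_mx 0 c.1) s0 dG dHy).
    have nGy : \forall z \near y, tile z -> pull phi t z = G z by near: y.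
    apply: filterS3 hf nGy nH => z hz h1 h2 hz'.
    by have tz := hz.2 hz'; rewrite -h1// -h2.
- apply: filterS2 nG tside => y h hs ty; rewrite h// /reflect_ext ifT//.
  exact/sgE/hs.
- have := near_flip c nG; have := near_flip c tside; rewrite flip_fix//.
  move=> tsf nGf; near=> y => ty.
  have hs : sgn R c.2 * flip c y 0 c.1 <= 2 by apply/(near tsf y).
  (* If y is on the side of the tile as well, it lies on the arm end, where the sign relation
     [pull_facet] reconciles the two branches. *)
  rewrite ct /reflect_ext; case: ifP => [/sgE h|_]; last by rewrite (near nGf y).
  have cy : facet c y.
    move: hs h; rewrite /facet flipE eqxx; case: (sgn_cases R c.2) => -> ? ?; 
      by apply/eqP; lra.
  rewrite flip_fix// in ty *.
  have := pull_facet t ephi ty cy; rewrite ct => ->.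
  by apply: (near nG y).
Unshelve. all: by end_near. Qed.

Lemma pull_solution phi : eigenfunctions M lam phi ->
  tile_solution g lam (pull phi).
Proof.
move=> ephi; split.
- by move=> t; exact: pull_continuous.
- by move=> c t x; exact: pull_facet.
- by move=> t x; exact: pull_inner.
- move=> t x c b e; apply: pull_neumann => //; first exact: edge_tile e.
    by right; exists c, b.
  by right; exists c, b.
- by move=> t x c; exact: pull_open_facet.
Qed.

End Eigenfunctions.

(** * From tile solutions back to eigenfunctions *)

Section Push.
Variables (R : realType) (g : tile_graph) (lam : R) (u : 'I_4 -> 'rV[R]_2 -> R).
Hypothesis su : tile_solution g lam u.
Local Notation M := (gmixed R g).
Implicit Types (x y z a v : 'rV[R]_2) (i j t : 'I_4) (c d : 'I_2 * bool)
  (k : 'I_2) (F G : 'rV[R]_2 -> R).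

Definition push (m : M) : R := u (val m).1 (fold m).

(** The sign at a glued arm end is 1, since Dirichlet ends are unglued, so the values of u on the
    two tiles agree there and the choice of representative is immaterial. *)
Lemma push_inj t x : tile x -> push (inj_tile g t x) = u t x.
Proof.
move=> tx; pose p t' x' := u t' x' = u t x.
apply: (iffRL (@class_predP R g (fun t' x' => u t' x' = u t x) t x _ tx)) => //.
move=> {p}t1 t2 {tx} y ty /inj_tileP => /(_ ty) [->//|[c cy ->]] <-.
have [_ uf _ _ _] := su; have [ct|nct] := boolP (dir g c t1).
  by rewrite (dir_loop ct).
by rewrite -(uf c t1 y ty cy) dsgE// mul1r.
Qed.

Lemma push_continuous : continuous push.
Proof.
apply/glued_continuousP => t; apply/within_continuousP => x tx B /=.
rewrite push_inj// => nB; have [uc _ _ _ _] := su.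
have /within_continuousP/(_ x tx B nB) := uc t.
by apply: filterS => y H ty; rewrite /= push_inj//; exact: H.
Qed.

Lemma push_extension t x c (ic : lnk g c t != t) F : tile x -> in_chart g t c t x ->
  smooth_near F x -> (\forall y \near x, tile y -> u t y = F y) ->
  (facet c x -> \forall y \near x, tile (flip c y) -> u (lnk g c t) (flip c y) = F y) ->
  smooth_at push (inj_tile g t x).
Proof.
move=> tx mi sF F1 F2; exists (gchart R ic), F; split.
- by exists t, c, ic.
- by apply/gdomP.
- by rewrite /= gmapE// /loc eqxx.
apply/near_gluedP => // t' e.
have mi' := in_chart_class tx (esym e) mi; have [cl ti] := mi'.
suff H : \forall y \near x, tile y -> u t' y = F (loc t c t' y).
  apply: filterS2 H (near_clear cl) => y H cly ty.
  by rewrite push_inj//= gmapE ?H.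
case: ti => t'E; first by rewrite t'E /loc eqxx.
rewrite t'E /loc (negPf ic).
have cx : facet c x.
  move/inj_tileP : e => /(_ tx) [e|[d dx dt]].
    by move: ic; rewrite -t'E e eqxx.
  case: (mi.1 d dx) => [<-//|h]; exfalso.
  by move: ic; rewrite -t'E -(lnkK g d t') -dt h eqxx.
have := near_flip c (F2 cx); rewrite flip_fix//; apply: filterS => y H ty.
by rewrite -H flipK.
Qed.

Lemma push_smooth p : (minterior M `|` dirichlet M `|` neumann M) p ->
  smooth_at push p.
Proof.
have [t [x [tx ->]]] := glued_ex p => H.
have [_ uf ui ue ufa] := su.
have [c [h mi]] := in_chart_ex g t tx.
have [ix|[[d dx]|[d [b e]]]] : inner x \/ (exists d, open_facet d x) \/
    (exists d b, edge d b x).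
- case: H => [[/(minteriorP _ _ tx)|/(gdirP _ _ tx)]|/(gneuP _ _ tx)].
  + by case=> [|[d [dx _]]]; [left|right; left; exists d].
  + by move=> [d [dx _]]; right; left; exists d.
  + by case=> [[d [dx _ _]]|]; [right; left; exists d|right; right].
- have [sF _] := ui t x ix; apply: (push_extension (c := c) h tx mi sF).
    by apply: filterE.
  by move=> cx; case: (inner_facet ix cx).
- have fdx := open_facet_facet dx; have [F [sF F1 F2]] := ufa t x d dx.
  have [dt|dt] := eqVneq (lnk g d t) t; last first.
    have cd : d = c by case: (mi.1 d fdx) => // e; rewrite e eqxx in dt.
    subst c; apply: (push_extension h tx mi sF F1) => _.
    by apply: filterS F2 => y H2 ty; rewrite -H2// dsg_lnk// mul1r.
  apply: (push_extension h tx mi sF F1) => cx.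
  by rewrite (facet_uniq tx cx fdx) dt eqxx in h.
- have [F [sF F1 _]] := ue t x d b e; apply: (push_extension h tx mi sF F1).
  by move=> cx; case: (edge_facet e cx).
Qed.

Lemma helmholtz_continuous F x k (s : R) : s != 0 -> smooth_near F x ->
  (\forall y \near x, 0 < s * ((y : 'rV[R]_2) 0 k - x 0 k) -> helmholtz lam F y) ->
  helmholtz lam F x.
Proof.
move=> s0 sF H.
have E y : - \sum_(i < 2) iter_partial [:: i; i] F y =
    (- \sum_(i < 2) iter_partial [:: i; i] F) y.
  by rewrite -[RHS]/(- ((\sum_(i < 2) iter_partial [:: i; i] F) y)) fct_sumE.
rewrite /helmholtz E.
apply: (@continuous_eq_half R 2 (- \sum_(i < 2) iter_partial [:: i; i] F)
   (fun y => lam * F y) x k s s0).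
- apply: differentiable_continuous; apply: differentiableN.
  have H2 (k' : 'I_2) : differentiable (iter_partial [:: k'; k'] F) x.
    exact: (nbhs_singleton sF).
  exact: differentiable_sum H2.
- apply: differentiable_continuous; apply: differentiableZ.
  exact: smooth_near_differentiable.
- by apply: filterS H => y H /H; rewrite /helmholtz E.
Qed.

(** On a glued arm end the equation is not part of [tile_solution]: it holds inside the tile i near
    x and passes to the end by continuity of the second derivatives of the common extension. *)
Lemma push_laplacian p (ch : chart R 0 M) : minterior M p -> atlas ch ->
  cdom ch p -> laplacian ch push p = lam * push p.
Proof.
have [t [x [tx ->]]] := glued_ex p.
move=> /(minteriorP _ _ tx) H [i [c [ic ->]]] /(gdomP _ _ _ _ tx) mi.
rewrite /laplacian /= gmapE// push_inj//; have [_ uf ui ue ufa] := su.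
have [cx|ncx] := boolP (facet c x); last first.
  have ix : inner x.
    case: H => // -[d [dx dt]]; case: (mi.1 d (open_facet_facet dx)) => e.
      by rewrite e in dx; rewrite (open_facet_facet dx) in ncx.
    by rewrite e eqxx in dt.
  have [sF hF] := ui t x ix.
  have sF' : smooth_near (u t) (loc i c t (loc i c t x)) by rewrite locK.
  have E : \forall z \near loc i c t x, (push \o ginv g i c) z = (u t \o loc i c t) z.
    have := near_loc i c t (near_inner ix); apply: filterS => z /inner_tile tz.
    rewrite /= -{1}(locK i c t z) ginvE//; last by case: mi.
    by rewrite push_inj.
  have S (k : 'I_2) : iter_partial [:: k; k] (push \o ginv g i c) (loc i c t x) =
      iter_partial [:: k; k] (u t) x.
    apply: etrans (near_eq_iter_partial E _) _.
    apply: etrans (iter_partial2_loc k sF') _.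
    by congr (iter_partial [:: k; k] (u t) _); exact: locK.
  have SS : \sum_(k < 2) iter_partial [:: k; k] (push \o ginv g i c) (loc i c t x) =
      \sum_(k < 2) iter_partial [:: k; k] (u t) x by apply: eq_bigr => k _; exact: S.
  rewrite SS; exact: hF.
have dx : open_facet c x.
  by case: H => [/inner_facet/(_ cx)//|[d [dx _]]];
    rewrite -(facet_uniq tx (open_facet_facet dx) cx).
rewrite loc_fix//.
(* The extension is taken from the tile i, which the chart draws unreflected, although x may be
   presented in the neighbour t. *)
have [F [sF F1 F2]] := ufa i x c dx; rewrite dsg_lnk// in F2.
have E : \forall z \near x, F z = (push \o ginv g i c) z.
  apply: filterS3 F1 F2 (near_glue_open dx) => z h1 h2 h3 /=; rewrite /ginv.
  case: ifP => tz; first by rewrite push_inj ?h1.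
  by case: h3; rewrite ?tz// => tfz; rewrite push_inj// -h2 ?mul1r.
have ut : u t x = F x.
  rewrite -(nbhs_singleton F1 tx); apply: etrans (esym (push_inj t tx)) _.
  rewrite -push_inj//; congr push; case: (mi.2) => ->//.
  by rewrite inj_tile_lnk.
have S : \sum_(k < 2) iter_partial [:: k; k] (push \o ginv g i c) x =
    \sum_(k < 2) iter_partial [:: k; k] F x.
  by apply: eq_bigr => k _; exact/esym/near_eq_iter_partial.
rewrite ut S.
have s0 : - sgn R c.2 != 0.
  by rewrite oppr_eq0 /sgn expf_eq0 oppr_eq0 oner_eq0 andbF.
apply: (helmholtz_continuous (k := c.1) s0 sF).
have nF1 : \forall z \near x, \forall y \near z, tile y -> u i y = F y.
  by move: F1; rewrite -nbhs_nearE => /nbhs_interior.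
have [_ hf] := near_open_facet dx.
apply: filterS3 nF1 hf (near_tile_open_facet dx) => z h1 h2 h3 hz.
have tz : tile z by apply/h2; exact: ltW.
have iz : inner z.
  case: (h3 tz) => [[e _ _]|h4]; last exact: h4.
  exfalso.
  by move: hz; rewrite e; case: dx => -> _ _; rewrite subrr mulr0 ltxx.
have [_ hz'] := ui i z iz.
have Ez : \forall y \near z, u i y = F y.
  by apply: filterS2 (near_inner iz) h1 => y /inner_tile ty; apply.
have Sz : \sum_(k < 2) iter_partial [:: k; k] F z =
    \sum_(k < 2) iter_partial [:: k; k] (u i) z.
  by apply: eq_bigr => k _; exact/esym/near_eq_iter_partial.
have uz : u i z = F z by exact: nbhs_singleton Ez.
by rewrite /helmholtz Sz -uz; exact: hz'.
Qed.

Lemma push_dirichlet p : dirichlet M p -> push p = 0.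
Proof.
have [t [x [tx ->]]] := glued_ex p => /(gdirP _ _ tx)[c [cx ct]].
rewrite push_inj//.
exact: tile_solution_dir su tx (open_facet_facet cx) ct.
Qed.

(** Both F and v are arbitrary. The vector v is along the axis k by [normal_half_at], and F has the
    same normal derivative, up to a nonzero factor, as the extension supplied by the tile solution,
    because both extend u from the tile side. *)
Lemma push_neumann p ch F v : neumann M p -> smooth_extension push p ch F ->
  outward_normal_at (cmap ch @` cdom ch) (cmap ch p) v -> 'D_v F (cmap ch p) = 0.
Proof.
have [t [x [tx ->]]] := glued_ex p => /(gneuP _ _ tx) neu HF.
have [k fb] := is_neu_flat neu.
have [i [c [ic [chE mi sF nF]]]] := smooth_extension_tile tx HF.
have sF' : smooth_near F (loc i c t x).
  by case: HF => _ _; rewrite chE /= gmapE.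
have [sg hs] := flat_boundary_image ic mi tx fb.
rewrite chE /= gmapE// => nv.
rewrite deriveE; last exact: smooth_near_differentiable.
rewrite diffE_delta; last exact: smooth_near_differentiable.
rewrite (I2_sum _ k) (normal_half_at hs nv (rev_ord2_neq k)) mul0r addr0.
have [H [sH nH dH]] := tile_solution_neumann su neu fb.
have [sg' [s2 ht]] := flat_boundary_half fb.
have s0 : sg' != 0.
  by apply/eqP => s0; move: s2; rewrite s0 mul0r => /esym/eqP; rewrite oner_eq0.
have D := @derive_eq_half R 2 (F \o loc i c t) H x k sg' (delta_mx 0 k) s0
  (smooth_near_differentiable sF) (smooth_near_differentiable sH).
have [e e0 De] := derive_loc k sF'.
have {}D : e * 'D_(delta_mx 0 k) F (loc i c t x) = 0.
  rewrite -De -dH; apply: D.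
  apply: filterS3 ht nH (nF t erefl) => z h1 h2 h3 hz.
  by have tz := h1.2 hz; rewrite -h2// /= -h3// /pull push_inj.
by move/eqP: D; rewrite mulf_eq0 (negPf e0) => /eqP ->; rewrite mulr0.
Qed.

Lemma push_eigenfunction : eigenfunctions M lam push.
Proof.
split.
- exact: push_continuous.
- exact: push_smooth.
- exact: push_laplacian.
- exact: push_dirichlet.
- exact: push_neumann.
Qed.

End Push.

(** * Transplantation *)

Section Transplantation.
Variables (R : realType) (g1 g2 : tile_graph) (T : 'I_4 -> 'I_4 -> R).
Implicit Types (x y : 'rV[R]_2) (i j t : 'I_4) (c : 'I_2 * bool)
  (u : 'I_4 -> 'rV[R]_2 -> R) (lam : R).

(** Entrywise form of D2 T = T D1, where D1 and D2 are the signed permutations of the colour c in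
    [g1] and [g2], sending w to the vector with entries [dsg c i * w (lnk c i)]. *)
Hypothesis intertwines : forall c j i,
  dsg R g2 c j * T (lnk g2 c j) i = T j (lnk g1 c i) * dsg R g1 c (lnk g1 c i).

Definition transplant u j x : R := \sum_i T j i * u i x.

Lemma transplant_facet (w : 'I_4 -> R) c j :
  dsg R g2 c j * \sum_i T (lnk g2 c j) i * w i =
  \sum_i T j i * (dsg R g1 c i * w (lnk g1 c i)).
Proof.
rewrite mulr_sumr [RHS](reindex_inj (can_inj (lnkK g1 c))).
by apply: eq_bigr => i _; rewrite lnkK !mulrA intertwines.
Qed.

(** Every clause is linear in u. Only the two clauses about arm ends mix different tiles, and they
    do so through the signed permutation of one colour, past which T can be moved. *)
Lemma transplant_solution lam u : tile_solution g1 lam u ->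
  tile_solution g2 lam (transplant u).
Proof.
move=> [uc uf ui ue ufa]; split.
- move=> j; have -> : transplant u j = \sum_i (fun x => T j i * u i x).
    by apply/funext => x; rewrite fct_sumE.
  apply: (big_ind (fun f : 'rV[R]_2 -> R => {within [set x | tile x], continuous f})).
  + by move=> x; exact: cvg_cst.
  + by move=> f h cf ch x; exact: (cvgD (cf x) (ch x)).
  + by move=> i _ x; exact: (cvgM (cvg_cst _) (uc i x)).
- move=> c j x tx cx; rewrite transplant_facet; apply: eq_bigr => i _.
  by rewrite uf.
- move=> j x ix; have sF i := (ui i x ix).1; have hF i := (ui i x ix).2.
  have [sT dT] := iter_partial_sum (T j) sF; split; first exact: sT.
  have S : \sum_(k < 2) iter_partial [:: k; k] (transplant u j) x =
      \sum_i T j i * \sum_(k < 2) iter_partial [:: k; k] (u i) x.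
    transitivity (\sum_(k < 2) \sum_i T j i * iter_partial [:: k; k] (u i) x).
      by apply: eq_bigr => k _; exact: (dT [:: k; k]).
    rewrite exchange_big /=.
    by apply: eq_bigr => i _; rewrite mulr_sumr.
  rewrite /helmholtz S /transplant mulr_sumr -sumrN; apply: eq_bigr => i _.
  by rewrite -mulrN mulrCA -(hF i).
- move=> j x c b e; have /choice[F FP] := fun i => ue i x c b e.
  have sF i : smooth_near (F i) x by case: (FP i).
  have [sT dT] := iter_partial_sum (T j) sF.
  exists (fun y => \sum_i T j i * F i y); split=> //.
    have nF : \forall y \near x, forall i, tile y -> u i y = F i y.
      have H i : \forall y \near x, tile y -> u i y = F i y by case: (FP i).
      exact: filter_forall H.
    by apply: filterS nF => y H ty; apply: eq_bigr => i _; rewrite H.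
  have /= -> := dT [:: rev_ord c.1]; apply: big1 => i _.
  by case: (FP i) => _ _ ->; rewrite mulr0.
- move=> j x c cx; have /choice[F FP] := fun i => ufa i x c cx.
  have sF i : smooth_near (F i) x by case: (FP i).
  have [sT _] := iter_partial_sum (T j) sF.
  exists (fun y => \sum_i T j i * F i y); split=> //.
    have nF : \forall y \near x, forall i, tile y -> u i y = F i y.
      have H i : \forall y \near x, tile y -> u i y = F i y by case: (FP i).
      exact: filter_forall H.
    by apply: filterS nF => y H ty; apply: eq_bigr => i _; rewrite H.
  have nF : \forall y \near x, forall i, tile (flip c y) ->
      dsg R g1 c i * u (lnk g1 c i) (flip c y) = F i y.
    have H i : \forall y \near x, tile (flip c y) ->
      dsg R g1 c i * u (lnk g1 c i) (flip c y) = F i y by case: (FP i).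
    exact: filter_forall H.
  apply: filterS nF => y H ty.
  rewrite /transplant (transplant_facet (fun i => u i (flip c y))).
  by apply: eq_bigr => i _; rewrite H.
Qed.

Variable S : 'I_4 -> 'I_4 -> R.
Hypothesis left_inverse : forall l k, \sum_j S l j * T j k = (l == k)%:R.

(** T acts on the tile index alone, so a linear relation between transplanted functions is carried
    back by [S] to the same relation between the original ones. *)
Lemma transplant_multiplicity lam m : multiplicity_ge (gmixed R g1) lam m ->
  multiplicity_ge (gmixed R g2) lam m.
Proof.
move=> [phi [ephi indep]].
have sol (i : 'I_m) := transplant_solution (pull_solution (ephi i)).
exists (fun i : 'I_m => push (transplant (pull (phi i)))); split.
  by move=> i; exact: push_eigenfunction (sol i).
move=> a Ha; apply: indep => p.
have [l [x [tx ->]]] := glued_ex p.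
have H j : \sum_(i < m) a i * \sum_k T j k * pull (phi i) k x = 0.
  rewrite -[RHS](Ha (inj_tile g2 j x)); apply: eq_bigr => i _; congr (_ * _).
  by rewrite (push_inj (sol i)).
have E : \sum_j S l j * \sum_(i < m) a i * \sum_k T j k * pull (phi i) k x = 0.
  by apply: big1 => j _; rewrite H mulr0.
rewrite -[RHS]E.
under [RHS]eq_bigr => j _ do rewrite mulr_sumr.
rewrite exchange_big /=; apply: eq_bigr => i _.
under eq_bigr => j _ do rewrite mulrCA mulr_sumr.
rewrite -mulr_sumr exchange_big /=; congr (_ * _).
under eq_bigr => k _.
  under eq_bigr => j _ do rewrite mulrA.
  rewrite -mulr_suml left_inverse.
over.
rewrite (bigD1 l)//= eqxx mul1r big1 ?addr0// => k kl.
by rewrite eq_sym (negPf kl) mul0r.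
Qed.

End Transplantation.

(** * Non-orientability *)

Section NonOrientable.
Variables (R : realType) (g : tile_graph).
Local Notation M := (gmanifold R g).
Implicit Types (x y z : 'rV[R]_2) (i j t : 'I_4) (c : 'I_2 * bool)
  (k : 'I_2) (s : bool) (d : chart R 0 M) (Q : 'M[R]_2).

(** A nonzero vector along the axis k leading from x into the tile: towards [x 0 k = 0], or a unit
    vector if x is already there. Such vectors detect the linear part of an affine map known on the
    tile only, even at corners. *)
Definition nudge x k : 'rV[R]_2 := (if x 0 k == 0 then 1 else - x 0 k) *: delta_mx 0 k.

Lemma tile_nudge x k (h : R) : tile x -> 0 < h -> h <= 1 -> tile (h *: nudge x k + x).
Proof.
move=> /(tileE k) H h0 h1; apply/(tileE k).
have e1 : (h *: nudge x k + x) 0 k = if x 0 k == 0 then h else (1 - h) * x 0 k.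
  by rewrite /nudge !mxE !eqxx; case: eqP => [->|_] /=; ring.
have e2 : (h *: nudge x k + x) 0 (rev_ord k) = x 0 (rev_ord k).
  by rewrite /nudge !mxE (negPf (rev_ord2_neq k)) !mulr0 add0r.
rewrite {}e1 {}e2; case: eqP => [x0|_].
  by case: H => -[? ? ? ?]; [left|right]; split; lra.
by case: H => -[? ? ? ?]; [left|right]; split; nra.
Qed.

Lemma affine_tile_eq x Q Q' (b b' : 'rV[R]_2) : tile x ->
  (\forall y \near x, tile y -> y *m Q + b = y *m Q' + b') -> Q = Q'.
Proof.
move=> tx H; have x0 := nbhs_singleton H tx.
apply/row_matrixP => k; rewrite !rowE.
have n1 : \forall h \near (0 : R), `|h| < 1 by exact: nbhs0_lt.
have [h h0 [/= h1 {}H]] := near0_ex_pos (filterI n1 (near_line (nudge x k) H)).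
rewrite gtr0_norm// in h1.
have := H (tile_nudge k tx h0 (ltW h1)).
rewrite !mulmxDl -!addrA x0 => /addIr; rewrite /nudge scalerA -!scalemxAl.
apply: scalerI; apply: mulf_neq0; first by rewrite gt_eqF.
by have [_|ne] := eqVneq (x 0 k) 0; rewrite ?oner_neq0 ?oppr_eq0.
Qed.

Variable B : set (chart R 0 M).
Hypothesis cover : forall p, exists2 d, B d & cdom d p.
Hypothesis compat : forall d d', @atlas R 0 M d -> B d' ->
  euclidean_transition (fun=> True) d d'.
Hypothesis oriented : forall d d', B d -> B d' ->
  euclidean_transition (fun Q => 0 < \det Q) d d'.

(* The tile t, read in the charts of B, has the orientation s near x. *)
Definition orient s t x := exists d Q b, [/\ B d, cdom d (inj_tile g t x),
  0 < sgn R s * \det Q &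
  \forall y \near x, tile y -> cmap d (inj_tile g t y) = y *m Q + b].

Lemma orthogonal_sign Q : orthogonal_mx Q -> exists s, 0 < sgn R s * \det Q.
Proof.
move=> oQ; have : \det Q * \det Q = 1 by rewrite -[X in _ * X]det_tr -det_mulmx oQ det1.
have [s hs] := sgn_ex (\det Q) => d1; exists s; rewrite lt_def hs andbT.
apply/eqP => /eqP; rewrite mulf_eq0 => /orP[|/eqP d0].
  by rewrite /sgn expf_eq0 oppr_eq0 oner_eq0 andbF.
by rewrite d0 mul0r in d1; have := @oner_neq0 R; rewrite -d1 eqxx.
Qed.

Lemma orient_uniq s s' t x : tile x -> orient s t x -> orient s' t x -> s = s'.
Proof.
move=> tx [d [Q [b [Bd dx dQ H]]]] [d' [Q' [b' [Bd' d'x dQ' H']]]].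
have [Q2 [b2 [_ Q2p H2]]] := oriented Bd Bd' dx d'x.
have H2' := near_inj_tile tx H2.
have E : Q' = Q *m Q2.
  apply: (@affine_tile_eq x _ _ b' (b *m Q2 + b2)) => //.
  apply: filterS3 H H' H2' => y h h' h2 ty.
  by rewrite -h'// h2// h// mulmxDl mulmxA addrA.
rewrite E det_mulmx mulrA pmulr_lgt0// in dQ'.
move: dQ dQ'; rewrite /sgn; case: s; case: s' => //; rewrite ?expr0 ?expr1; lra.
Qed.

Lemma orient_ex t x : tile x -> exists s, orient s t x.
Proof.
move=> tx; have [d Bd dx] := cover (inj_tile g t x).
have [c [h mi]] := in_chart_ex g t tx.
have at_h : @atlas R 0 M (gchart R h) by exists t, c, h.
have hx : cdom (gchart R h) (inj_tile g t x) by apply/gdomP.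
have [Q [b [oQ _ H]]] := compat at_h Bd hx dx.
have [s sQ] := orthogonal_sign oQ; exists s, d, Q, b; split=> //.
have H' := near_inj_tile tx H; have [cl _] := mi.
apply: filterS2 H' (near_clear cl) => y hy cly ty.
rewrite hy//= gmapE//; first by rewrite /loc eqxx.
by split=> //; left.
Qed.

Lemma orient_near s t x : tile x -> orient s t x ->
  \forall y \near x, tile y -> orient s t y.
Proof.
move=> tx [d [Q [b [Bd dx dQ H]]]].
have nd : \forall m \near inj_tile g t x, cdom d m.
  by apply: open_nbhs_nbhs; split=> //; exact: cdom_open.
have nd' := near_inj_tile tx nd.
have H2 : \forall y \near x, \forall z \near y, tile z ->
    cmap d (inj_tile g t z) = z *m Q + b.
  by move: H; rewrite -nbhs_nearE => /nbhs_interior.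
by apply: filterS2 nd' H2 => y h h2 ty; exists d, Q, b; split=> //; exact: h.
Qed.

(** Exactly one of the two orientations holds at each point, and each is a relatively open
    condition; the tile is connected. *)
Lemma orient_constant s t x y : tile x -> tile y -> orient s t x -> orient s t y.
Proof.
move=> tx ty ox.
pose U s := interior [set z | tile z -> orient s t z].
have oU s' : open (U s') by exact: open_interior.
have UE s' z : tile z -> U s' z <-> orient s' t z.
  by move=> tz; split=> [/interior_subset|]; [apply|exact: orient_near].
have sN s' z : tile z -> orient s' t z <-> ~ orient (~~ s') t z.
  move=> tz; split=> [h h'|nh].
    by have := orient_uniq tz h h'; case: (s').
  by have [s2 h] := orient_ex t tz; case: (eqVneq s2 s') h => [->//|]; case: s2; case: s' nh.
suff H : [set z | tile z] `&` U s = [set z | tile z].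
  have [_ Uy] : ([set z | tile z] `&` U s) y by rewrite H.
  exact: (UE s y ty).1 Uy.
apply: (@connected_tile R).
- by exists x; split=> //; apply/UE.
- by exists (U s).
- exists (~` U (~~ s)); first by apply: open_closedC.
  rewrite eqEsubset; split=> z [tz h]; split=> //.
    by move=> /(UE _ _ tz); exact: (sN s z tz).1 ((UE s z tz).1 h).
  apply: (UE s z tz).2; apply: (sN s z tz).2 => o.
  exact: h ((UE _ z tz).2 o).
Qed.

(** At the middle of the glued arm end a single chart of [B] sees both tiles, and it sees the
    neighbour through one more reflection, of determinant -1. *)
Lemma orient_link s t c : lnk g c t != t -> orient s t 0 ->
  orient (~~ s) (lnk g c t) 0.
Proof.
move=> ct o0; have tx := @facet_pt_tile R c; have cx := @facet_ptP R c.
move: tx cx; set x := facet_pt R c => tx cx.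
have ox := orient_constant (tile0 R) tx o0.
apply: (orient_constant tx (tile0 R)).
have [d Bd dx] := cover (inj_tile g t x).
have at_h : @atlas R 0 M (gchart R ct) by exists t, c, ct.
have mi : in_chart g t c t x.
  by split; [move=> e ex; left; exact: facet_uniq ex cx|left].
have hx : cdom (gchart R ct) (inj_tile g t x) by apply/gdomP.
have [Q [b [oQ _ H]]] := compat at_h Bd hx dx.
have [s' sQ] := orthogonal_sign oQ.
have e : inj_tile g (lnk g c t) x = inj_tile g t x by exact: inj_tile_lnk.
have mi' := in_chart_class tx (esym e) mi.
have os' : orient s' t x.
  exists d, Q, b; split=> //; apply: filterS2 (near_inj_tile tx H) (near_clear mi.1).
  move=> y hy cly ty; rewrite hy//= gmapE//; first by rewrite /loc eqxx.
  by split=> //; left.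
have -> := orient_uniq tx ox os'.
have [F [b0 [oF dF HF]]] := @flip_affine R c.
exists d, (F *m Q), (b0 *m Q + b); split=> //.
- by rewrite e.
- by rewrite det_mulmx dF; move: sQ; rewrite /sgn; case: s' {os'}; rewrite ?expr0 ?expr1; lra.
have nH : \forall m \near inj_tile g (lnk g c t) x, cmap d m = cmap (gchart R ct) m *m Q + b.
  by rewrite e.
apply: filterS2 (near_inj_tile tx nH) (near_clear mi'.1) => y hy cly ty.
rewrite hy//= gmapE//; last by split=> //; right.
by rewrite /loc (negPf ct) HF mulmxDl mulmxA addrA.
Qed.

End NonOrientable.

(** Going once round the cycle reverses the orientation of the tile i three times, contradicting its
    uniqueness. *)
Lemma odd_cycle_nonorientable (R : realType) (g : tile_graph) i c1 c2 c3 :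
  lnk g c1 i != i -> lnk g c2 (lnk g c1 i) != lnk g c1 i ->
  lnk g c3 (lnk g c2 (lnk g c1 i)) != lnk g c2 (lnk g c1 i) ->
  lnk g c3 (lnk g c2 (lnk g c1 i)) = i -> ~ orientable (gmanifold R g).
Proof.
move=> h1 h2 h3 e [B [cover compat oriented]].
have [s os] := orient_ex cover compat i (tile0 R).
have := orient_link cover compat oriented h3
  (orient_link cover compat oriented h2 (orient_link cover compat oriented h1 os)).
rewrite e => os'; have := orient_uniq oriented (tile0 R) os os'.
by case: (s).
Qed.

(** * Dirichlet components *)

Section Components.
Variables (R : realType) (g : tile_graph).
Local Notation M := (gmixed R g).
Implicit Types (x y z : 'rV[R]_2) (t : 'I_4) (c d : 'I_2 * bool).

Definition facet_param c (r : R) : 'rV[R]_2 :=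
  r *: delta_mx 0 (rev_ord c.1) + facet_pt R c.

Lemma facet_param1 c r : facet_param c r 0 c.1 = 2 * sgn R c.2.
Proof.
rewrite /facet_param /facet_pt !mxE !eqxx.
by rewrite [c.1 == _]eq_sym (negPf (rev_ord2_neq c.1)) mulr0 add0r mulr1.
Qed.

Lemma facet_param2 c r : facet_param c r 0 (rev_ord c.1) = r.
Proof.
rewrite /facet_param /facet_pt !mxE !eqxx.
by rewrite (negPf (rev_ord2_neq c.1)) mulr0 addr0 mulr1.
Qed.

Definition facet_seg c : set 'rV[R]_2 := [set x | tile x /\ facet c x].

Lemma facet_segE c : facet_seg c = facet_param c @` `[-1, 1]%classic.
Proof.
rewrite eqEsubset; split=> [x [tx cx]|_ [r /= r1 <-]].
  have [h1 h2] := facet_other tx cx; exists (x 0 (rev_ord c.1)).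
    by rewrite /= in_itv/= h1 h2.
  apply/rowP; apply: (@I2_all _ c.1); first by rewrite facet_param1 (eqP cx).
  exact: facet_param2.
move: r1; rewrite in_itv/= => /andP[? ?]; split; last by rewrite /facet facet_param1.
apply/(tileE c.1); left; rewrite facet_param1 facet_param2.
by case: (sgn_cases R c.2) => ->; split; lra.
Qed.

Lemma facet_param_continuous c : continuous (facet_param c).
Proof.
by move=> r; apply: cvgD; [exact: scalel_continuous|exact: cvg_cst].
Qed.

Definition gseg c t : set M := inj_tile g t @` facet_seg c.

Lemma gseg_continuous c t :
  {within `[-1, 1]%classic, continuous (inj_tile g t \o facet_param c)}.
Proof.
apply/within_continuousP => r r1 A nA.
have tx : tile (facet_param c r).
  by have [] : facet_seg c (facet_param c r) by rewrite facet_segE; exists r.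
have H := near_inj_tile tx nA.
have cr : facet_param c s @[s --> r] --> facet_param c r by exact: facet_param_continuous.
have {}H : \forall s \near r, tile (facet_param c s) ->
    A (inj_tile g t (facet_param c s)) by exact: (cr _ H).
apply: filterS H => s /= h s1; apply: h.
by have [] : facet_seg c (facet_param c s) by rewrite facet_segE; exists s.
Qed.

Lemma gsegE c t : gseg c t = (inj_tile g t \o facet_param c) @` `[-1, 1]%classic.
Proof. by rewrite /gseg facet_segE image_comp. Qed.

Lemma gseg_connected c t : connected (gseg c t).
Proof.
rewrite gsegE; apply: connected_continuous_connected; first exact: segment_connected.
exact: gseg_continuous.
Qed.

Lemma gseg_closed c t : closed (gseg c t).
Proof.
apply: compact_closed; first exact: glued_hausdorff.
rewrite gsegE; apply: continuous_compact; first exact: gseg_continuous.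
exact: segment_compact.
Qed.

Lemma closure_dirichletP t x : tile x ->
  closure (dirichlet M) (inj_tile g t x) <-> exists c, facet c x /\ dir g c t.
Proof.
move=> tx; split=> [H|[c [cx ct]] A nA].
  apply: contrapT => nd.
  have nN : \forall m \near inj_tile g t x, ~ dirichlet M m.
    apply/near_gluedP => // t' e; apply: filterS (near_facet x) => y fy ty.
    move=> /(gdirP _ _ ty) [c [cy ct']].
    have cx := fy c (open_facet_facet cy); have lt' := dir_loop ct'.
    have tt' : t = t' by exact: loop_class tx cx lt' (esym e).
    by apply: nd; exists c; rewrite tt'.
  by have [m [h1 h2]] := H _ nN; exact: h2.
have H0 := near_inj_tile tx nA.
have H := near_line (- x 0 (rev_ord c.1) *: delta_mx 0 (rev_ord c.1)) H0.
have n1 : \forall h \near (0 : R), `|h| < 1 by exact: nbhs0_lt.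
have [h h0 [/= h1]] := near0_ex_pos (filterI n1 H).
set y := _ + x => Hy; rewrite gtr0_norm// in h1.
have [a1 a2] := facet_other tx cx.
have yc : open_facet c y.
  have cr : (c.1 == rev_ord c.1) = false by rewrite eq_sym (negPf (rev_ord2_neq _)).
  have y1 : y 0 c.1 = x 0 c.1 by rewrite /y !mxE cr !mulr0 add0r.
  have y2 : y 0 (rev_ord c.1) = (1 - h) * x 0 (rev_ord c.1).
    by rewrite /y !mxE !eqxx mulr1 mulrBl mul1r mulrN addrC.
  by split; rewrite ?y1 ?y2; [exact/eqP|nra|nra].
have ty := open_facet_tile yc; exists (inj_tile g t y); split; last exact: Hy.
by apply/gdirP => //; exists c.
Qed.

Lemma gseg_closure c t : dir g c t -> gseg c t `<=` closure (dirichlet M).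
Proof.
by move=> ct _ [x [tx cx] <-]; apply/closure_dirichletP => //; exists c.
Qed.

Lemma arm_facet c d x : tile x -> 1 < sgn R c.2 * x 0 c.1 -> facet d x -> d = c.
Proof.
move=> tx h dx; have [a1 a2] := facet_other tx dx.
have e : d.1 = c.1.
  apply/eqP; apply: contraT => /eqP ne.
  have e : c.1 = rev_ord d.1 by apply: I2_neq; apply/eqP => e; exact: ne.
  by exfalso; move: h a1 a2; rewrite e; case: (sgn_cases R c.2) => ->; lra.
rewrite (surjective_pairing d) (surjective_pairing c) e; congr (_, _).
move/eqP: dx h; rewrite e => ->; rewrite /sgn.
by case: d.2; case: c.2; rewrite ?expr0 ?expr1 => //; lra.
Qed.

(** The arm end is connected, and it is relatively closed and open in the closure of the Dirichlet
    part: closed by compactness, open because the outer part of its arm meets that closure in this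
    end alone. *)
Lemma component_gseg c t x : tile x -> facet c x -> dir g c t ->
  connected_component (closure (dirichlet M)) (inj_tile g t x) = gseg c t.
Proof.
move=> tx cx ct.
have xs : gseg c t (inj_tile g t x) by exists x.
rewrite eqEsubset; split; last first.
  apply: connected_component_max => //; first exact: gseg_closure.
  exact: gseg_connected.
move=> m [A [Ax sA cA] Am].
pose O : set M := [set m | exists y, [/\ tile y, m = inj_tile g t y &
  1 < sgn R c.2 * y 0 c.1]].
(* A Dirichlet end is unglued, so points of the outer part of the arm have a single
   representative. *)
have oO : open O.
  rewrite openE => _ [y [ty -> y1]]; apply/near_gluedP => // t' e.
  have tt' : t' = t.
    move/esym/inj_tileP : e => /(_ ty) [//|[d dy ->]].
    by rewrite (arm_facet ty y1 dy) (dir_loop ct).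
  have n1 : \forall z \near y, 1 < sgn R c.2 * (z : 'rV[R]_2) 0 c.1.
    have cc : {for y, continuous (fun z : 'rV[R]_2 => sgn R c.2 * z 0 c.1)}.
      by apply: differentiable_continuous; apply: differentiableZ; exact: differentiable_coord.
    exact: (cc [set r | 1 < r] (lt_nbhsr y1)).
  by apply: filterS n1 => z z1 tz; exists z; rewrite tt'.
have OE : A `&` gseg c t = A `&` O.
  rewrite eqEsubset; split=> p [].
    move=> Ay [y [ty cy] e]; split=> //; exists y; split=> //.
    by rewrite (eqP cy) mulrCA sgn2; lra.
  move=> Ay [y [ty e y1]]; split=> //; rewrite e in Ay *; exists y => //; split=> //.
  have [d [dy _]] := (closure_dirichletP t ty).1 (sA _ Ay).
  by rewrite -(arm_facet ty y1 dy).
suff H : A `&` gseg c t = A by have [] : (A `&` gseg c t) m by rewrite H.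
apply: cA.
- by exists (inj_tile g t x).
- by exists O.
- by exists (gseg c t) => //; exact: gseg_closed.
Qed.

Lemma gseg_inj c d t t' : dir g c t -> gseg c t = gseg d t' -> (c, t) = (d, t').
Proof.
move=> ct e; have tp := facet_pt_tile R c; have cp := facet_ptP R c.
have : gseg d t' (inj_tile g t (facet_pt R c)) by rewrite -e; exists (facet_pt R c).
move=> [y [ty dy] e']; have yE := inj_tile_eq ty tp e'; rewrite {}yE in ty dy e'.
have dc := facet_uniq tp dy cp.
by rewrite dc (loop_class tp cp (dir_loop ct) e').
Qed.

Lemma dirichlet_components_card n (f : 'I_n -> ('I_2 * bool) * 'I_4) :
  injective f -> (forall c t, dir g c t <-> exists i, f i = (c, t)) ->
  (dirichlet_components M #= `I_n)%card.
Proof.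
move=> finj fP.
have fd i : dir g (f i).1 (f i).2 by apply/fP; exists i; case: (f i).
have -> : dirichlet_components M = (fun i => gseg (f i).1 (f i).2) @` [set: 'I_n].
  rewrite eqEsubset; split=> [_ [m mc <-]|_ [i _ <-]].
    have [t [x [tx mE]]] := glued_ex m; rewrite mE in mc *.
    have [c [cx ct]] := (closure_dirichletP _ tx).1 mc.
    have [i fi] := (fP c t).1 ct; exists i => //.
    by rewrite fi /= (component_gseg tx cx ct).
  exists (inj_tile g (f i).2 (facet_pt R (f i).1)).
    apply/closure_dirichletP; first exact: facet_pt_tile.
    by exists (f i).1; split; [exact: facet_ptP|].
  by rewrite (component_gseg (facet_pt_tile R _) (facet_ptP R _) (fd i)).
rewrite card_eq_sym (card_eql card_II) card_eq_sym; apply: inj_card_eq.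
move=> i j _ _ /(gseg_inj (fd i)) e; apply: finj.
by rewrite (surjective_pairing (f i)) e -surjective_pairing.
Qed.

End Components.

(** * The two gluings *)

Section Graphs.

Let o0 : 'I_4 := @Ordinal 4 0 isT.
Let o1 : 'I_4 := @Ordinal 4 1 isT.
Let o2 : 'I_4 := @Ordinal 4 2 isT.
Let o3 : 'I_4 := @Ordinal 4 3 isT.

Let swap (a b i : 'I_4) : 'I_4 := if i == a then b else if i == b then a else i.

(* The two graphs differ in the first colour only. *)
Let lnk_of (l : 'I_4 -> 'I_4) (c : 'I_2 * bool) : 'I_4 -> 'I_4 :=
  match nat_of_ord c.1, c.2 with
  | 0%N, false => l
  | 0%N, true => swap o2 o3
  | _, false => swap o1 o2
  | _, true => swap o0 o2
  end.

Let dir_of (p : pred 'I_4) (c : 'I_2 * bool) : pred 'I_4 :=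
  match nat_of_ord c.1, c.2 with
  | 0%N, false => p
  | 0%N, true => [pred i : 'I_4 | i < 2]%N
  | _, _ => pred0
  end.

Let I4_case (P : 'I_4 -> Prop) : P o0 -> P o1 -> P o2 -> P o3 -> forall i, P i.
Proof.
move=> h0 h1 h2 h3 [[|[|[|[|//]]]] h]; rewrite (bool_irrelevance h isT) //.
Qed.

Let swapK a b : involutive (swap a b).
Proof.
move=> i; rewrite /swap; have [->|ia] := eqVneq i a.
  by have [->|] := eqVneq b a; rewrite ?eqxx.
by have [->|ib] := eqVneq i b; rewrite ?eqxx// (negPf ia) (negPf ib).
Qed.

(** The pair 0, 1 closes the triangle of the tiles 0, 1, 2, while the pair 2, 3 joins these two
    tiles along a second arm end. *)
Let l2 (i : 'I_4) : 'I_4 := swap o0 o1 (swap o2 o3 i).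

Let lnk_ofK l : involutive l -> forall c, involutive (lnk_of l c).
Proof.
by move=> lK [[[|[|//]] h] []]; rewrite /lnk_of //=; exact: swapK.
Qed.

Let dir1_loop c i : dir_of [pred i : 'I_4 | i < 2]%N c i -> lnk_of id c i = i.
Proof.
by case: c => [[[|[|//]] h] []]; rewrite /dir_of /lnk_of //=;
  move: i; apply: I4_case.
Qed.

Let dir2_loop c i : dir_of pred0 c i -> lnk_of l2 c i = i.
Proof.
by case: c => [[[|[|//]] h] []]; rewrite /dir_of /lnk_of //=;
  move: i; apply: I4_case.
Qed.

Let hub_of l i : i = o2 \/ exists c, lnk_of l c o2 = i /\ i != o2.
Proof.
move: i; apply: I4_case; [right|right|by left|right].
- by exists (ord_max, true).
- by exists (ord_max, false).
- by exists (ord0, true).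
Qed.

Let l2K : involutive l2.
Proof. by apply: I4_case; apply/val_inj. Qed.

Definition star_graph : tile_graph :=
  TileGraph (lnk_ofK (fun i => erefl)) dir1_loop (hub_of id).

Definition triangle_graph : tile_graph :=
  TileGraph (lnk_ofK l2K) dir2_loop (hub_of l2).

Lemma star_colouring c i : lnk star_graph c i != i ->
  (lnk star_graph c i == o2) = ~~ (i == o2).
Proof.
by case: c => [[[|[|//]] h] []]; rewrite /= /lnk_of //=; move: i; apply: I4_case.
Qed.

Variable R : realType.

(** A symmetric Hadamard matrix of order 4, so its square is 4 times the identity. It commutes with
    the three signed permutations common to both gluings and conjugates the diagonal matrix (-1, -1,
    1, 1) of the first colour of the star into the permutation [l2]. *)
Definition transplant_mx (j i : 'I_4) : R :=
  if [|| i == j, i == o3 | j == o3] then 1 else -1.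

Lemma transplant_mx_intertwines c j i :
  dsg R triangle_graph c j * transplant_mx (lnk triangle_graph c j) i =
  transplant_mx j (lnk star_graph c i) * dsg R star_graph c (lnk star_graph c i).
Proof.
case: c => [[[|[|//]] h] []];
  rewrite /dsg /sgn /= /dir_of /lnk_of /=; move: i j;
  apply: I4_case; apply: I4_case; rewrite /transplant_mx /= ?expr0 ?expr1;
  by rewrite ?mulr1 ?mul1r ?mulrN1 ?mulN1r ?opprK.
Qed.

(** Up to a scalar the matrix is its own inverse, so it also intertwines in the opposite
    direction. *)
Lemma transplant_mx_intertwines_back c j i :
  dsg R star_graph c j * transplant_mx (lnk star_graph c j) i =
  transplant_mx j (lnk triangle_graph c i) *
    dsg R triangle_graph c (lnk triangle_graph c i).
Proof.
case: c => [[[|[|//]] h] []];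
  rewrite /dsg /sgn /= /dir_of /lnk_of /=; move: i j;
  apply: I4_case; apply: I4_case; rewrite /transplant_mx /= ?expr0 ?expr1;
  by rewrite ?mulr1 ?mul1r ?mulrN1 ?mulN1r ?opprK.
Qed.

Lemma transplant_mx_inverse l k :
  \sum_j (transplant_mx l j / 4) * transplant_mx j k = (l == k)%:R.
Proof.
rewrite !big_ord_recl big_ord0 /transplant_mx; move: l k.
by apply: I4_case; apply: I4_case; rewrite /=; lra.
Qed.

Lemma gmixed_isospectral : isospectral (gmixed R star_graph) (gmixed R triangle_graph).
Proof.
move=> lam m; split.
  exact: (transplant_multiplicity transplant_mx_intertwines transplant_mx_inverse).
exact: (transplant_multiplicity transplant_mx_intertwines_back transplant_mx_inverse).
Qed.

Let first_facet : 'I_2 * bool := (ord0, false).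
Let second_facet : 'I_2 * bool := (ord0, true).

Lemma star_dirichlet_components :
  (dirichlet_components (gmixed R star_graph) #= `I_4)%card.
Proof.
apply: (@dirichlet_components_card _ _ _ (fun i : 'I_4 =>
  (if (i < 2)%N then first_facet else second_facet, if odd i then o1 else o0))).
  by apply: I4_case; apply: I4_case => //= /(congr1 (fun p => (p.1.2, nat_of_ord p.2))).
move=> c t; split=> [|[i [<- <-]]]; last by move: i; apply: I4_case.
case: c => [[[|[|//]] h] []]; rewrite /= /dir_of //=; move: t.
  by apply: I4_case => // _; [exists o2|exists o3]; congr (_, _, _); exact/val_inj.
by apply: I4_case => // _; [exists o0|exists o1]; congr (_, _, _); exact/val_inj.
Qed.

Lemma triangle_dirichlet_components :
  (dirichlet_components (gmixed R triangle_graph) #= `I_2)%card.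
Proof.
apply: (@dirichlet_components_card _ _ _ (fun i : 'I_2 =>
  (second_facet, if odd i then o1 else o0))).
  by case=> [[|[|//]] h] [[|[|//]] h'] //= _; apply/val_inj.
move=> c t; split=> [|[[[|[|//]] h] [<- <-]]]//.
case: c => [[[|[|//]] h] []]; rewrite /= /dir_of //=; move: t.
by apply: I4_case => // _; [exists ord0|exists ord_max]; congr (_, _, _); exact/val_inj.
Qed.

Lemma gdir_nonempty g c t : dir g c t -> dirichlet (gmixed R g) !=set0.
Proof.
move=> ct; have tx := facet_pt_tile R c.
have cx : open_facet c (facet_pt R c).
  rewrite -[facet_pt R c]add0r -[0](scale0r (delta_mx 0 (rev_ord c.1))).
  by split; rewrite ?facet_param1 ?facet_param2; lra.
by exists (inj_tile g t (facet_pt R c)); apply/gdirP => //; exists c.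
Qed.

Lemma gneu_nonempty g : neumann (gmixed R g) !=set0.
Proof.
pose x : 'rV[R]_2 := (3 / 2) *: delta_mx 0 ord0 + delta_mx 0 ord_max.
have e : edge (ord0, false) false x.
  by split; rewrite /x ?rev_ord0 !mxE /= /sgn expr0; lra.
exists (inj_tile g ord0 x); apply/gneuP; first exact: edge_tile e.
by right; exists (ord0, false), false.
Qed.

End Graphs.

Theorem mainTheorem7 (R : realType) :
  exists (n : nat) (M1 M2 : mixed_manifold R n),
    (connected [set: M1] /\ connected [set: M2]) /\
    (dirichlet M1 !=set0 /\ neumann M1 !=set0) /\
    (dirichlet M2 !=set0 /\ neumann M2 !=set0) /\
    isospectral M1 M2 /\
    orientable M1 /\ ~ orientable M2 /\
    exists k1 k2 : nat,
      dirichlet_components M1 #= `I_k1 /\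
      dirichlet_components M2 #= `I_k2 /\
      k1 <> k2.
Proof.
(* Charts take values in dimension n + 2, so these are surfaces. *)
exists 0%N, (gmixed R star_graph), (gmixed R triangle_graph).
split; first by split; exact: glued_connected.
split.
  split; last exact: gneu_nonempty.
  exact: (@gdir_nonempty R star_graph (ord0, true) ord0).
split.
  split; last exact: gneu_nonempty.
  exact: (@gdir_nonempty R triangle_graph (ord0, true) ord0).
split; first exact: gmixed_isospectral.
split; first exact: gmanifold_orientable star_colouring.
split.
  (* The cycle runs through the tiles 0, 1, 2 and back to 0. *)
  apply: (@odd_cycle_nonorientable R triangle_graph ord0 (ord0, false)
    (ord_max, false) (ord_max, true)) => //; exact/val_inj.
exists 4%N, 2%N; split; first exact: star_dirichlet_components.
by split; first exact: triangle_dirichlet_components.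
Qed.
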